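(* Let $(S_n)$ be any estimator sequence. (a) Suppose $\mathcal G=\tilde{\mathcal G}$ is a convex cone. Assume there exists a sequence of tangents $g_m\in\tilde{\mathcal G}$ such that $g_m\to\tilde\kappa$ in $L_2(P)$ and, for every convergent sequence $t_n\to t$ in $(0,\infty)$, $$\liminf_{m}\liminf_{n}P^n_{n,t_n,g_m}\bigl\{S_n\ge T(P_{n,t_n,g_m})\bigr\}\ge\tfrac12. \qquad (1)$$ Then, for every $t\in(0,\infty)$ and every convergent sequence $t_n\to t$ in $(0,\infty)$, $$\limsup_nP^n\bigl\{\sqrt n\,(S_n-T(P))<t_n\bigr\}\le\Phi\Bigl(\frac{t}{\Vert\tilde\kappa\Vert}\Bigr). \qquad (2)$$ The upper bound (2) is attained by any estimator sequence $(\tilde S_n)$ satisfying $$\sqrt n\,(\tilde S_n-T(P))=\frac1{\sqrt n}\sum_{i=1}^n\tilde\kappa(x_i)+o_{P^n}(n^0),$$ with $t_n=t$, uniformly in $-\infty\le t\le\infty$, and with $\limsup_n$ replaced by $\liminf_n$: that is, $(\tilde S_n)$ itself fulfills the assumption of (a) (existence of $g_m\to\tilde\kappa$ in $\tilde{\mathcal G}$ with (1)), and $$\liminf_n\inf_{-\infty\le t\le\infty}\Bigl(P^n\bigl\{\sqrt n\,(\tilde S_n-T(P))<t\bigr\}-\Phi\Bigl(\frac{t}{\Vert\tilde\kappa\Vert}\Bigr)\Bigr)\ge0 .$$ (b) Suppose $\mathcal G=\bar{\mathcal G}$ is a linear space. Assume there exist two sequences of tangents $g_m',g_m''\in\bar{\mathcal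 G}$ such that $g_m'\to\bar\kappa$, $g_m''\to-\bar\kappa$ in $L_2(P)$ and, for every convergent sequence $t_n\to t$ in $(0,\infty)$, $$\liminf_m\liminf_nP^n_{n,t_n,g_m'}\bigl\{S_n\ge T(P_{n,t_n,g_m'})\bigr\}\ge\tfrac12,\qquad \liminf_m\liminf_nP^n_{n,t_n,g_m''}\bigl\{S_n\le T(P_{n,t_n,g_m''})\bigr\}\ge\tfrac12. \qquad (3)$$ Then, for every $t',t''\in(0,\infty)$ and all sequences $t_n'\to t'$, $t_n''\to t''$ in $(0,\infty)$, $$\limsup_nP^n\bigl\{-t_n'<\sqrt n\,(S_n-T(P))<t_n''\bigr\}\le\Phi\Bigl(\frac{t''}{\Vert\bar\kappa\Vert}\Bigr)-\Phi\Bigl(-\frac{t'}{\Vert\bar\kappa\Vert}\Bigr). \qquad (4)$$ The upper bound (4) is attained by any estimator sequence $(\bar S_n)$ satisfying $$\sqrt n\,(\bar S_n-T(P))=\frac1{\sqrt n}\sum_{i=1}^n\bar\kappa(x_i)+o_{P^n}(n^0),$$ with $t_n'=t'$, $t_n''=t''$, uniformly in $-\infty\le-t'<t''\le\infty$, and with $\limsup_n$ replaced by $\liminf_n$: that is, $(\bar S_n)$ itself fulfills the assumption of (b) (existence of $g_m'\to\bar\kappa$, $g_m''\to-\bar\kappa$ in $\bar{\mathcal G}$ with (3)), and $$\liminf_n\inf_{-\infty\le-t'<t''\le\infty}\Bigl(P^n\bigl\{-t'<\sqrt n\,(\bar S_n-T(P))<t''\bigr\}-\Bigl[\Phi\Bigl(\frac{t''}{\Vert\bar\kappa\Vert}\Bigr)-\Phi\Bigl(-\frac{t'}{\Vert\bar\kappa\Vert}\Bigr)\Bigr]\Bigr)\ge0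 .$$
   Context: Model and tangents. $\mathcal P$ is a set of probability measures on a sample space, $P\in\mathcal P$ is fixed, $T:\mathcal P\to\mathbb R$ is a functional. $\langle\cdot|\cdot\rangle$ and $\Vert\cdot\Vert$ are the inner product and norm of $L_2(P)$. A path in $\mathcal P$ with tangent $g\in L_2(P)$ at $P$ is a family $(P_{g,s})_{s>0}$ in $\mathcal P$ such that $\sqrt{dP_{g,s}}=(1+\tfrac12 s g)\sqrt{dP}+o(s)$ as $s\downarrow0$ in the Hilbert space of square root densities (i.e. the $L_2$-norm of the remainder, with respect to a dominating measure, is $o(s)$). Such $g$ necessarily have $\int g\,dP=0$. The tangent set $\mathcal G\subset L_2(P)$ of $\mathcal P$ at $P$ is the set of all such tangents; it is a cone with vertex $0$. It is denoted $\tilde{\mathcal G}$ when assumed to be a convex cone ($\gamma_1g_1+\gamma_2g_2\in\tilde{\mathcal G}$ for $g_i\in\tilde{\mathcal G}$, $\gamma_i\ge0$) and $\bar{\mathcal G}$ when assumed to be a linear space. For each $g\in\mathcal G$ let $(P_{g,s})_{s>0}$ be a (fixed, arbitrary) path in $\mathcal P$ with tangent $g$, and put $P_{n,t,g}=P_{g,t/\sqrt n}$ for $t\in(0,\infty)$; $P_{n,t,g}^n$ is its $n$-fold product. Differentiability of $T$. There is $\kappa\in L_2(P)$ (an influence curve of $T$ at $P$) such that for every $g\in\mathcal G$ and any path $(P_{g,s})$ in $\mathcal P$ with tangent $g$: $T(P_{g,s})=T(P)+s\langle\kappa|g\rangle+o(s)$ as $s\downarrow0$. Projections. For a convex tangent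 cone $\tilde{\mathcal G}$, $\tilde\kappa$ is the projection (unique closest element) of $\kappa$ on the $L_2(P)$-closure of $\tilde{\mathcal G}$. For a linear tangent space $\bar{\mathcal G}$, $\bar\kappa$ is the orthogonal projection of $\kappa$ on the closure of $\bar{\mathcal G}$. It is assumed throughout that $\tilde\kappa\ne0$ and $\bar\kappa\ne0$, respectively. Estimators. An estimator sequence $(S_n)$ is any sequence of real-valued measurable functions $S_n$ of the observations $(x_1,\dots,x_n)$ (they may depend on the fixed $P$). $o_{P^n}(n^0)$ denotes a term tending to $0$ in $P^n$-probability as $n\to\infty$. $\Phi$ is the standard normal distribution function, with $\Phi(-\infty)=0$, $\Phi(\infty)=1$. Limits in $n$ are as $n\to\infty$, limits in $m$ as $m\to\infty$. ''Convergent sequence $t_n\to t$ in $(0,\infty)$'' means $t_n\in(0,\infty)$ and limit $t\in(0,\infty)$. *)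

(* Defs.v *)
From HB Require Import structures.
From mathcomp Require Import all_boot all_order all_algebra.
From mathcomp Require Import all_classical all_reals all_analysis.

Set Implicit Arguments.
Unset Strict Implicit.
Unset Printing Implicit Defensive.

Import Order.TTheory GRing.Theory Num.Theory.
Import numFieldNormedType.Exports.

Local Open Scope classical_set_scope.
Local Open Scope ring_scope.

Section iid_power.
Context {d : measure_display} {X : measurableType d} {R : realType}.

Definition tuple_cons (n : nat) (z : X * n.-tuple X) : n.+1.-tuple X :=
  [tuple of z.1 :: z.2].

Lemma measurable_tuple_cons n : measurable_fun setT (@tuple_cons n).
Proof. exact: measurable_cons. Qed.

HB.instance Definition _ n := isMeasurableFun.Build _ _ _ _ (@tuple_cons n)
  (@measurable_tuple_cons n).

(* The n-fold product of P on the product sigma-algebra of n.-tuple X,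
   obtained from the binary product through the identification of
   X * n.-tuple X with n.+1.-tuple X; see iid_power_box. *)
Fixpoint iid_power (P : probability X R) (n : nat) :
    probability (n.-tuple X) R :=
  if n is m.+1
  then distribution (P \x iid_power P m)%E (@tuple_cons m)
  else dirac [tuple].

Lemma measurable_box n (A : 'I_n -> set X) : (forall i, measurable (A i)) ->
  measurable [set x : n.-tuple X | forall i, A i (tnth x i)].
Proof.
move=> mA.
rewrite (_ : [set _ | _] = \bigcap_(i in [set: 'I_n]) ((@tnth n X)^~ i @^-1` A i)).
  apply: fin_bigcap_measurable; first exact: finite_finset.
  by move=> i _; have := @measurable_tnth _ X n i measurableT _ (mA i); rewrite setTI.
by apply/seteqP; split=> x /= h i; [move=> _; exact: h|exact: h].
Qed.

Lemma iid_power_box (P : probability X R) (n : nat) (A : 'I_n -> set X) :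
  (forall i, measurable (A i)) ->
  iid_power P n [set x | forall i, A i (tnth x i)] = (\prod_(i < n) P (A i))%E.
Proof.
elim: n A => [|n IHn] A mA.
  rewrite big_ord0 /= diracE mem_set//=.
  by move=> [].
rewrite big_ord_recl -IHn; last by move=> i; exact: mA.
rewrite -product_measure1E//; last by apply: (@measurable_box _ (fun i => A (lift ord0 i))) => i.
rewrite /= /pushforward; congr product_measure1.
apply/seteqP; split=> -[x y] /=.
  move=> h; split; first by have := h ord0; rewrite tnth0.
  by move=> i; have := h (lift ord0 i); rewrite tnthS.
move=> [h0 h] i; have [j ->|->] := unliftP ord0 i; first by rewrite tnthS.
by rewrite tnth0.
Qed.

End iid_power.

Section tangents.
Context {d : measure_display} {X : measurableType d} {R : realType}.

(* Elements of L_2(P) are represented by functions; identities between them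
   are meant P-almost everywhere. *)
Definition L2 (P : probability X R) := LfunType P (lee1n 2).

Definition L2norm (P : probability X R) (f : X -> R) : R :=
  fine ('N[P]_2%:E [EFin \o f])%E.

Definition L2dot (P : probability X R) (f g : X -> R) : R :=
  \int[P]_x (f x * g x).

Definition L2cvg (P : probability X R) (u : nat -> L2 P) (f : L2 P) : Prop :=
  L2norm P (u m \- f) @[m --> \oo] --> (0 : R).

Definition L2closure (P : probability X R) (G : set (L2 P)) : set (L2 P) :=
  [set f | exists u : nat -> L2 P, (forall m, G (u m)) /\ L2cvg u f].

Definition sum_measure (P Q : probability X R) : set X -> \bar R :=
  measure_add P Q.

HB.instance Definition _ (P Q : probability X R) :=
  Measure.on (sum_measure P Q).

Lemma sum_measure_fin P Q : fin_num_fun (sum_measure P Q).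
Proof.
by move=> A mA; rewrite /sum_measure measure_addE fin_numD !fin_num_measure.
Qed.

HB.instance Definition _ (P Q : probability X R) :=
  Measure_isFinite.Build _ _ _ (sum_measure P Q) (sum_measure_fin P Q).

Local Open Scope charge_scope.

(* Square root of the density of P with respect to mu (for P << mu). *)
Definition sqrt_density (P : probability X R)
    (mu : {sigma_finite_measure set X -> \bar R}) (x : X) : R :=
  Num.sqrt (fine (('d (charge_of_finite_measure P) '/d mu) x)).

Local Close Scope charge_scope.

(* The norm of sqrt(dQ) - (1 + s g / 2) sqrt(dP) in the Hilbert space of
   square root densities.  It does not depend on the dominating measure, which
   is taken to be P + Q. *)
Definition path_remainder (P : probability X R) (g : X -> R) (s : R)
    (Q : probability X R) : \bar R :=
  ('N[sum_measure P Q]_2%:E [(fun x =>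
     (sqrt_density Q (sum_measure P Q) x
      - (1 + 2^-1 * s * g x) * sqrt_density P (sum_measure P Q) x)%:E)])%E.

(* The values Q s for s <= 0 are irrelevant. *)
Definition path_with_tangent (Pm : set (probability X R))
    (P : probability X R) (g : X -> R) (Q : R -> probability X R) : Prop :=
  (forall s, 0 < s -> Pm (Q s)) /\
  ((s^-1)%:E * path_remainder P g s (Q s))%E @[s --> 0^'+] --> 0%E.

Definition tangent_set (Pm : set (probability X R)) (P : probability X R) :
    set (L2 P) :=
  [set g : L2 P | exists Q, path_with_tangent Pm P g Q].
Local Arguments tangent_set : clear implicits.

Definition convex_cone (P : probability X R) (G : set (L2 P)) : Prop :=
  forall (g1 g2 : L2 P) (c1 c2 : R), G g1 -> G g2 -> 0 <= c1 -> 0 <= c2 ->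
    G (c1 *: g1 + c2 *: g2).

Definition linear_space (P : probability X R) (G : set (L2 P)) : Prop :=
  G 0 /\ forall (g1 g2 : L2 P) (c1 c2 : R), G g1 -> G g2 ->
    G (c1 *: g1 + c2 *: g2).

(* Only the values of T on Pm matter. *)
Definition influence_curve (Pm : set (probability X R)) (P : probability X R)
    (T : probability X R -> R) (kappa : L2 P) : Prop :=
  forall (g : L2 P) (Q : R -> probability X R),
    tangent_set Pm P g -> path_with_tangent Pm P g Q ->
    (T (Q s) - T P - s * L2dot P kappa g) / s @[s --> 0^'+] --> (0 : R).

Definition closest_element (P : probability X R) (C : set (L2 P))
    (f k : L2 P) : Prop :=
  C k /\ forall h : L2 P, C h -> L2norm P (f \- k) <= L2norm P (f \- h).

Definition orthogonal_projection (P : probability X R) (C : set (L2 P))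
    (f k : L2 P) : Prop :=
  C k /\ forall h : L2 P, C h -> L2dot P (f \- k) h = 0.

Definition L2nonzero (P : probability X R) (f : X -> R) : Prop :=
  ~ (\forall x \ae P, f x = 0).

End tangents.
Arguments tangent_set {d X R} Pm P.

Definition estimator_seq {d : measure_display} (X : measurableType d)
    (R : realType) : Type := forall n : nat, {mfun (n.-tuple X) >-> R}.

(* The standard normal distribution function on the extended real line. *)
Definition Phi {R : realType} (t : \bar R) : \bar R :=
  normal_prob (0 : R) 1 [set y : R | (y%:E <= t)%E].

Section estimators.
Context {d : measure_display} {X : measurableType d} {R : realType}.

(* t_n -> t in (0, oo) *)
Definition cvg_in_pos (tn : nat -> R) (t : R) : Prop :=
  [/\ forall n, 0 < tn n, 0 < t & tn n @[n --> \oo] --> t].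

(* P_(n,t,g), for Q the path with tangent g. *)
Definition local_alt (Q : R -> probability X R) (n : nat) (t : R) :
    probability X R := Q (t / Num.sqrt n%:R).

Definition rescaled_error (S : estimator_seq X R) (theta : R) (n : nat)
    (x : n.-tuple X) : R :=
  Num.sqrt n%:R * (S n x - theta).

Definition asymp_linear (P : probability X R) (T : probability X R -> R)
    (S : estimator_seq X R) (k : X -> R) : Prop :=
  forall eps : R, 0 < eps ->
    iid_power P n [set x | eps < `|rescaled_error S (T P) x
      - (Num.sqrt n%:R)^-1 * \sum_(i < n) k (tnth x i)| ] @[n --> \oo] --> 0%E.

(* In the next two conditions, g is a sequence of tangents and path h is the
   path chosen for the tangent h. *)
Definition asymp_no_underestimation (P : probability X R)
    (T : probability X R -> R) (path : L2 P -> R -> probability X R)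
    (S : estimator_seq X R) (g : nat -> L2 P) : Prop :=
  forall (tn : nat -> R) (t : R), cvg_in_pos tn t ->
    ((2^-1)%:E <= limn_einf (fun m => limn_einf (fun n =>
       iid_power (local_alt (path (g m)) n (tn n)) n
         [set x | (T (local_alt (path (g m)) n (tn n)) <= S n x)%R])))%E.

Definition asymp_no_overestimation (P : probability X R)
    (T : probability X R -> R) (path : L2 P -> R -> probability X R)
    (S : estimator_seq X R) (g : nat -> L2 P) : Prop :=
  forall (tn : nat -> R) (t : R), cvg_in_pos tn t ->
    ((2^-1)%:E <= limn_einf (fun m => limn_einf (fun n =>
       iid_power (local_alt (path (g m)) n (tn n)) n
         [set x | (S n x <= T (local_alt (path (g m)) n (tn n)))%R])))%E.

Definition one_sided_assumption (P : probability X R)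
    (G : set (L2 P)) (k : L2 P) (T : probability X R -> R)
    (path : L2 P -> R -> probability X R) (S : estimator_seq X R) : Prop :=
  exists g : nat -> L2 P, [/\ forall m, G (g m), L2cvg g k &
    asymp_no_underestimation T path S g].

Definition two_sided_assumption (P : probability X R)
    (G : set (L2 P)) (k : L2 P) (T : probability X R -> R)
    (path : L2 P -> R -> probability X R) (S : estimator_seq X R) : Prop :=
  exists g1 g2 : nat -> L2 P,
    [/\ forall m, G (g1 m), forall m, G (g2 m), L2cvg g1 k & L2cvg g2 (- k)] /\
    asymp_no_underestimation T path S g1 /\
    asymp_no_overestimation T path S g2.

End estimators.

(* Main.v *)
(** Write [Q_n] for the local alternative with tangent [g] and parameter
[t_n / sqrt n], [t_n -> t].  Differentiability in quadratic mean gives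
[dQ_n = (1 + W_n)^2 dP] up to a mass [o(1/n)], with [sqrt n W_n -> t g / 2] in
[L_2(P)].  Local asymptotic normality and the central limit theorem are replaced
by Lindeberg-type inductions on the sample size, run on explicit solutions of a
parabolic equation.

For tests, [P^n(A) - l Q_n^n(A)] is bounded, uniformly in [A], by the
Black-Scholes put price with strike 1, spot [l] and variance [t^2 |g|^2]: one
observation multiplies the spot by [(1 + W_n)^2], and the put price solves the
corresponding heat equation.  The choice [l = exp (- t^2 |g|^2 / 2)] is the
Neyman-Pearson bound [P^n(A) <= Phi (t |g|) + o(1)] when
[Q_n^n(A) <= 1/2 + o(1)]; letting [l -> 0] gives contiguity.

For sums, the functions [Phi (x / s)] solve the heat equation in [s^2], and the
induction carried out under [Q_n] yields the normal limit of
[n^(-1/2) sum k(x_i)] with drift [t <k, g>].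

The bound (2) tests [P] against [Q_n] with [g = g_m] close to [k] and [t]
slightly larger than [t / |k|^2]; here [<kappa, k> = |k|^2] because [k] is a
projection on a cone.  The same argument with the sign of the error reversed
bounds the other tail, and (4) follows from
[P(a < Y < b) = P(Y < b) + P(a < Y) - 1]. *)
Require Import Defs.
From HB Require Import structures.
From mathcomp Require Import all_boot all_order all_algebra.
From mathcomp Require Import all_classical all_reals all_analysis.
From mathcomp Require Import measurable_realfun ring lra.

Set Implicit Arguments.
Unset Strict Implicit.
Unset Printing Implicit Defensive.

Import Order.TTheory GRing.Theory Num.Theory.
Import numFieldNormedType.Exports.

Local Open Scope classical_set_scope.
Local Open Scope ring_scope.

(** * The standard normal density and distribution function *)

Section normal_cdf.
Context {R : realType}.
Implicit Types x y : R.

(** A tangent brings second moments only, and a likelihood ratio need not exist: [Q_n] may have a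
    part singular to [P], and [1 + W_n] may vanish. Hence the estimates are stated for (1 + W)^2 up
    to a lost mass, and third-order remainders are truncated to h^2 min(1, |h|), whose expectation
    is o(1/n) by uniform integrability.

    The put payoff and the indicator of a half-line are not smooth. Both inductions therefore start
    the heat flow at a variance b^2 > 0. The constants of one step are then powers of 1 + 1/b,
    uniform in the current state, and the errors of n steps add up to n o(1/n). The put dominates
    its payoff, so the test bound only pays the extra variance; the half-line also needs a shift
    [delta] of its threshold. The parameter [b] is fixed, small according to the tolerance, before n
    grows.

    Uniformity does the rest. The test bound holds for all events at once, so no optimal rejection
    region has to be found; the bound for sums is uniform in the threshold, which yields the infimum
    over t directly. *)

Definition npdf x : R := normal_pdf 0 1 x.

Definition ncdf x : R := fine (Phi x%:E).

Let PhisetE x : [set y : R | (y%:E <= x%:E)%E] = `]-oo, x]%classic.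
Proof. by apply/seteqP; split=> z /=; rewrite in_itv/= lee_fin. Qed.

Lemma PhiE x : Phi x%:E = (ncdf x)%:E.
Proof. by rewrite /ncdf fineK// /Phi PhisetE fin_num_measure. Qed.

Lemma Phiy : Phi +oo%E = 1%E :> \bar R.
Proof.
rewrite /Phi (_ : [set _ | _] = setT) ?probability_setT//.
by apply/seteqP; split=> y //= _; rewrite leey.
Qed.

Lemma PhiNy : Phi -oo%E = 0%E :> \bar R.
Proof.
rewrite /Phi (_ : [set _ | _] = set0) ?measure0//.
by apply/seteqP; split=> y //=; rewrite leeNy_eq.
Qed.

Lemma npdfE x : npdf x = normal_peak 1 * expR (- (x ^+ 2 / 2)).
Proof.
rewrite /npdf normal_pdfE ?oner_eq0// /normal_fun subr0 expr1n.
by rewrite -[in RHS]mulNr.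
Qed.

Lemma npdf_ge0 x : 0 <= npdf x. Proof. exact: normal_pdf_ge0. Qed.

Lemma npdfN x : npdf (- x) = npdf x. Proof. by rewrite !npdfE sqrrN. Qed.

Lemma normal_peak1_le1 : normal_peak (1 : R) <= 1.
Proof.
rewrite /normal_peak expr1n mul1r invf_le1.
  rewrite -[leLHS]sqrtr1 ler_wsqrtr//.
  by have := pi_ge2 R; lra.
by rewrite sqrtr_gt0; have := pi_gt0 R; lra.
Qed.

(* [t^j <= j! e^t] with [t = x^2/2]. *)
Lemma npdf_moment_le (j : nat) x : (x ^+ 2) ^+ j * npdf x <= 2 ^+ j * j`!%:R.
Proof.
rewrite npdfE; set t := x ^+ 2 / 2.
have t0 : 0 <= t by rewrite divr_ge0 ?sqr_ge0.
have -> : x ^+ 2 = 2 * t by rewrite /t; lra.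
rewrite exprMn -mulrA ler_pM2l ?exprn_gt0//.
have /ler_wpM2l : normal_peak 1 * expR (- t) <= expR (- t).
  by rewrite ler_piMl ?expR_ge0 ?normal_peak1_le1.
move=> /(_ (t ^+ j)); rewrite exprn_ge0// => /(_ isT)/le_trans; apply.
rewrite expRN ler_pdivrMr ?expR_gt0//.
case: j => [|j]; first by rewrite expr0 fact0 mul1r -expR0 ler_expR.
have f0 : 0 < (j.+1)`!%:R :> R by rewrite ltr0n fact_gt0.
rewrite mulrC -ler_pdivrMr//; have := expR_ge1Dxn j t0; lra.
Qed.

Lemma npdf_le1 x : npdf x <= 1.
Proof. by have := npdf_moment_le 0 x; rewrite !expr0 fact0 !mul1r. Qed.

Lemma npdf_sqr_le x : x ^+ 2 * npdf x <= 2.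
Proof. by have := npdf_moment_le 1 x; rewrite !expr1 (_ : 1`! = 1)%N ?mulr1//. Qed.

Lemma npdf_quart_le x : x ^+ 4 * npdf x <= 8.
Proof.
have := npdf_moment_le 2 x; rewrite -exprM (_ : 2`! = 2)%N//.
by rewrite (_ : 2 ^+ 2 * 2%:R = 8 :> R)//; lra.
Qed.

Lemma npdf_abs_le x : `|x| * npdf x <= 2.
Proof.
have [h|h] := leP `|x| 1.
  apply: (@le_trans _ _ 1); last by lra.
  by rewrite -[leRHS]mulr1 ler_pM ?npdf_ge0 ?npdf_le1.
apply: le_trans (npdf_sqr_le x); rewrite ler_wpM2r ?npdf_ge0//.
by rewrite -real_normK ?num_real// expr2 ler_peMl// ltW.
Qed.

Lemma npdf_cube_le x : `|x| ^+ 3 * npdf x <= 8.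
Proof.
have [h|h] := leP `|x| 1.
  apply: (@le_trans _ _ 1); last by lra.
  by rewrite -[leRHS]mulr1 ler_pM ?npdf_ge0 ?npdf_le1// exprn_ile1.
apply: le_trans (npdf_quart_le x); rewrite ler_wpM2r ?npdf_ge0//.
have -> : x ^+ 4 = `|x| ^+ 4 by rewrite -normrX ger0_norm// (exprM _ 2 2) sqr_ge0.
by rewrite [leRHS]exprS ler_peMl ?exprn_ge0// ltW.
Qed.

Lemma is_derive_npdf (g : R -> R) x b : is_derive x 1 g b ->
  is_derive x 1 (fun y => npdf (g y)) (- g x * npdf (g x) * b).
Proof.
move=> gb; rewrite (_ : (fun _ => _) =
  (fun y => expR (- ((g y * g y) / 2)) * normal_peak 1)); last first.
  by apply/funext => y; rewrite npdfE expr2 mulrC.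
have h : is_derive x 1 (fun y => - ((g y * g y) / 2)) (- (g x * b)).
  apply: is_derive_eq; rewrite /GRing.scale/=; lra.
have := @is_derive1_comp _ expR _ _ _ _ (is_derive_expR _) h => h2.
apply: is_derive_eq; rewrite /GRing.scale/= npdfE.
by ring.
Qed.

Lemma is_derive_ncdf_id x : is_derive x 1 ncdf (npdf x).
Proof.
have [] := @continuous_FTC1 R npdf -oo%O x (x + 1).
- by rewrite ltrDl.
- apply: integrableS (integrable_normal_pdf 0 1) => //.
- by rewrite ltNyr.
- exact: continuous_normal_pdf (oner_neq0 R) x.
rewrite (_ : (fun x0 => _) = ncdf); last first.
  by apply/funext => y; rewrite /ncdf /Phi PhisetE.
by rewrite derive1E => h <-; exact: derivableP.
Qed.

Lemma is_derive_ncdf (g : R -> R) x b : is_derive x 1 g b ->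
  is_derive x 1 (fun y => ncdf (g y)) (npdf (g x) * b).
Proof. by move=> gb; have := is_derive1_comp (is_derive_ncdf_id (g x)) gb. Qed.

Lemma ncdf_ge0 x : 0 <= ncdf x.
Proof. by rewrite fine_ge0. Qed.

Lemma ncdf_le1 x : ncdf x <= 1.
Proof.
rewrite -lee_fin -PhiE /Phi PhisetE; exact: probability_le1.
Qed.

Lemma ncdf_MVT x y : x < y -> exists2 c, c \in `]x, y[%R &
  ncdf y - ncdf x = npdf c * (y - x).
Proof.
move=> xy; apply: MVT => //.
  by move=> z _; exact: is_derive_ncdf_id.
apply: continuous_subspaceT => z.
by apply/differentiable_continuous/derivable1_diffP; case: (is_derive_ncdf_id z).
Qed.

Lemma ncdf_nd x y : x <= y -> ncdf x <= ncdf y.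
Proof.
rewrite le_eqVlt => /predU1P[->//|xy]; have [c _] := ncdf_MVT xy.
by move=> e; rewrite -subr_ge0 e mulr_ge0 ?npdf_ge0// subr_ge0 ltW.
Qed.

Lemma ncdf_lip x y : `|ncdf x - ncdf y| <= `|x - y|.
Proof.
wlog : x y / x <= y => [H|].
  by have [/H//|/ltW/H] := leP x y; rewrite distrC (distrC x).
rewrite le_eqVlt => /predU1P[->|xy]; first by rewrite !subrr.
have [c _] := ncdf_MVT xy.
rewrite distrC (distrC x) => ->; rewrite normrM ler_piMl//.
by rewrite ger0_norm ?npdf_ge0 ?npdf_le1.
Qed.

Lemma ncdf_continuous : continuous (ncdf : R -> R).
Proof.
move=> z.
by apply/differentiable_continuous/derivable1_diffP; case: (is_derive_ncdf_id z).
Qed.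

(** The identity viewed as a random variable under the normal law: its distribution function is
    [ncdf], which thus inherits the limits of a distribution function at both infinities. *)
Let idTR : measurableTypeR R -> R := idfun.
#[local] HB.instance Definition _ :=
  @isMeasurableFun.Build _ _ _ _ idTR (@measurable_id _ _ setT).

Let cdfE : cdf (idTR : {RV (normal_prob (0 : R) 1) >-> R}) = EFin \o ncdf.
Proof.
by apply/funext => x; rewrite /= -PhiE /Phi PhisetE /cdf /distribution.
Qed.

Lemma ncdf_cvgy : ncdf x @[x --> +oo] --> (1 : R).
Proof.
by have := cvg_cdfy1 (idTR : {RV (normal_prob (0 : R) 1) >-> R});
  rewrite cdfE => /fine_cvgP[].
Qed.

Lemma ncdf_cvgNy : ncdf x @[x --> -oo] --> (0 : R).
Proof.
by have := cvg_cdfNy0 (idTR : {RV (normal_prob (0 : R) 1) >-> R});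
  rewrite cdfE => /fine_cvgP[].
Qed.

(** As [npdf] is even, [ncdf y + ncdf (- y)] has derivative 0; the constant is its limit 1 at
    infinity. *)
Lemma ncdfN x : ncdf (- x) = 1 - ncdf x.
Proof.
have cst y z : ncdf y + ncdf (- y) = ncdf z + ncdf (- z).
  apply: (@is_derive_0_is_cst R (fun y => ncdf y + ncdf (- y))) => w.
  have h : is_derive w 1 (-%R : R -> R) (-1) by apply: is_derive_eq.
  have h1 := is_derive_ncdf h; have h2 := is_derive_ncdf_id w.
  by apply: is_derive_eq; rewrite npdfN mulrN1 subrr.
have lim1 : ncdf y + ncdf (- y) @[y --> +oo] --> (1 + 0 : R).
  by apply: cvgD; [exact: ncdf_cvgy|exact/(cvgNy_compNP ncdf)/ncdf_cvgNy].
have lim2 : ncdf y + ncdf (- y) @[y --> +oo] --> ncdf x + ncdf (- x).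
  by under eq_fun do rewrite (cst _ x); exact: cvg_cst.
have := cvg_unique _ lim1 lim2; rewrite addr0 => -> //; lra.
Qed.

Lemma ncdf0 : ncdf 0 = 2^-1 :> R.
Proof. have := ncdfN 0; rewrite oppr0 => h; lra. Qed.

End normal_cdf.

(** * Mean value and Taylor estimates *)

Section mean_value_bounds.
Context {R : realType}.
Implicit Types (f : R -> R) (a b x y : R).

Lemma le_norm_MVT f df a b B x y :
  (forall z, a <= z <= b -> is_derive z 1 f (df z)) ->
  (forall z, a <= z <= b -> `|df z| <= B) ->
  a <= x <= b -> a <= y <= b -> `|f y - f x| <= B * `|y - x|.
Proof.
move=> fd fB; wlog xy : x y / x <= y => [H hx hy|/andP[ax xb] /andP[ay yb]].
  have [xy|/ltW yx] := leP x y; first exact: H.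
  by rewrite distrC (distrC y); exact: H.
have sub z : x <= z <= y -> a <= z <= b.
  by move=> /andP[xz zy]; rewrite (le_trans ax)// (le_trans zy).
have [z zxy|z|c] := @MVT_segment R f df x y xy.
- by apply/fd/sub; move: zxy; rewrite in_itv/= => /andP[/ltW-> /ltW->].
- apply: continuous_in_subspaceT => w; rewrite inE/= in_itv/= => hw.
  apply/differentiable_continuous/derivable1_diffP.
  by case: (fd w (sub _ hw)).
- rewrite in_itv/= => hc ->; rewrite normrM ler_wpM2r//.
  exact/fB/sub.
Qed.

(** Three mean value inequalities in a row, applied to remainders that vanish at [x]. Each one only
    contributes a factor |y - x|, which is why the constant is [C] and not C/6. *)
Lemma taylor2_le (f f1 f2 f3 : R -> R) a b C x y :
  (forall z, a <= z <= b -> is_derive z 1 f (f1 z)) ->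
  (forall z, a <= z <= b -> is_derive z 1 f1 (f2 z)) ->
  (forall z, a <= z <= b -> is_derive z 1 f2 (f3 z)) ->
  (forall z, a <= z <= b -> `|f3 z| <= C) ->
  a <= x <= b -> a <= y <= b ->
  `|f y - f x - f1 x * (y - x) - f2 x / 2 * (y - x) ^+ 2| <= C * `|y - x| ^+ 3.
Proof.
move=> d1 d2 d3 hC hx hy.
have C0 : 0 <= C by apply: le_trans (hC _ hx).
(* On the hull of [x] and [y] the distance to [x] stays below |y - x|, which is what the repeated
   inequalities need. *)
set u := Num.min x y; set v := Num.max x y.
have sub z : u <= z <= v -> a <= z <= b.
  move=> /andP[uz zv]; move: hx hy => /andP[ax xb] /andP[ay yb].
  by rewrite (le_trans _ uz) ?(le_trans zv)// /u /v ?le_min ?ge_max ?ax ?ay ?xb ?yb.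
have uxv : u <= x <= v by rewrite /u /v ge_min le_max lexx.
have uyv : u <= y <= v by rewrite /u /v ge_min le_max lexx !orbT.
have dist z : u <= z <= v -> `|z - x| <= `|y - x|.
  rewrite /u /v; case: (leP x y) => xy /andP[h1 h2].
    by rewrite !ger0_norm ?subr_ge0// lerB.
  by rewrite !ler0_norm ?subr_le0 ?(ltW xy)// lerN2 lerB.
have k2 z : u <= z <= v -> `|f2 z - f2 x| <= C * `|y - x|.
  move=> hz; apply: le_trans (_ : C * `|z - x| <= _); last exact/ler_wpM2l/dist.
  by apply: (@le_norm_MVT f2 f3 a b) => //; exact: sub.
pose l z := f1 z - f1 x - f2 x * (z - x).
have dl z : u <= z <= v -> is_derive z 1 l (f2 z - f2 x).
  move=> hz; have h := d2 z (sub _ hz); rewrite /l.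
  by apply: is_derive_eq; rewrite /GRing.scale/=; ring.
have k1 z : u <= z <= v -> `|l z| <= C * `|y - x| ^+ 2.
  move=> hz; have := le_norm_MVT dl k2 uxv hz.
  have -> : l x = 0 by rewrite /l; ring.
  rewrite subr0 => /le_trans; apply; rewrite expr2 mulrA.
  by rewrite ler_wpM2l ?mulr_ge0//; exact: dist.
pose m z := f z - f x - f1 x * (z - x) - f2 x / 2 * ((z - x) * (z - x)).
have dm z : u <= z <= v -> is_derive z 1 m (l z).
  move=> hz; have h := d1 z (sub _ hz); rewrite /l /m.
  by apply: is_derive_eq; rewrite /GRing.scale/=; field.
have := le_norm_MVT dm k1 uxv uyv.
have -> : m x = 0 by rewrite /m; ring.
rewrite subr0 /m -expr2.
by rewrite (_ : C * `|y - x| ^+ 3 = C * `|y - x| ^+ 2 * `|y - x|)//; ring.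
Qed.

(* Time is [s^2]: a change of [s^2] by [t] moves [f s] by [t f'(s)/(2 s)]. *)
Lemma sqr_param_le f df (b B K L s s' : R) : 0 < b -> 0 <= K -> 0 <= L ->
  (forall z, b <= z <= B -> is_derive z 1 f (df z)) ->
  (forall z w, b <= z <= B -> b <= w <= B -> `|df z - df w| <= K * `|z - w|) ->
  (forall z, b <= z <= B -> `|df z| <= L) ->
  b <= s -> s <= s' -> s' <= B ->
  `|f s' - f s - (s' ^+ 2 - s ^+ 2) * df s / (2 * s)|
     <= (K + L) * (1 + b^-1) ^+ 3 * (s' ^+ 2 - s ^+ 2) ^+ 2.
Proof.
move=> b0 K0 L0 fd dlip dL bs ss' s'B.
have hs : b <= s <= B by rewrite bs (le_trans ss').
have hs' : b <= s' <= B by rewrite s'B (le_trans bs).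
have s0 : 0 < s by rewrite (lt_le_trans b0).
have s'0 : 0 < s' by rewrite (lt_le_trans s0).
set t := s' ^+ 2 - s ^+ 2.
have te : t = (s' - s) * (s' + s) by rewrite /t; ring.
have t0 : 0 <= t by rewrite te mulr_ge0 ?subr_ge0// ltW// addr_gt0.
have de : s' - s = t / (s' + s) by rewrite te mulfK// gt_eqF// addr_gt0.
have dle : s' - s <= t * b^-1.
  rewrite de ler_wpM2l// lef_pV2 ?posrE ?addr_gt0//.
  by rewrite (le_trans bs)// lerDr ltW.
have i0 : 0 < b^-1 by rewrite invr_gt0.
set c := 1 + b^-1.
have c1 : 1 <= c by rewrite /c lerDl ltW.
have ic : b^-1 <= c by rewrite /c lerDr.
have c0 : 0 < c by apply: lt_le_trans c1.
have dist z : s <= z <= s' -> `|z - s| <= s' - s.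
  by move=> /andP[h1 h2]; rewrite ger0_norm ?subr_ge0// lerB.
have sub z : s <= z <= s' -> b <= z <= B.
  by move=> /andP[h1 h2]; rewrite (le_trans bs)// (le_trans h2).
have h1 : `|f s' - f s - df s * (s' - s)| <= K * (s' - s) ^+ 2.
  pose m z := f z - df s * (z - s).
  have dm z : s <= z <= s' -> is_derive z 1 m (df z - df s).
    move=> hz; have h := fd z (sub _ hz); rewrite /m.
    by apply: is_derive_eq; rewrite /GRing.scale/=; ring.
  have mb z : s <= z <= s' -> `|df z - df s| <= K * (s' - s).
    move=> hz; apply: le_trans (dlip _ _ (sub _ hz) hs) _.
    exact/ler_wpM2l/dist.
  have := le_norm_MVT dm mb (x := s) (y := s'); rewrite !lexx ss' => /(_ isT isT).
  rewrite /m subrr mulr0 subr0 (ger0_norm (_ : 0 <= s' - s)) ?subr_ge0//.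
  rewrite -mulrA -expr2.
  by rewrite (_ : f s' - _ - f s = f s' - f s - df s * (s' - s))//; ring.
(* Since s' - s = t / (s' + s), replacing it by t / (2 s) costs t (s' - s) / ((s' + s) 2 s), which
   is again of order t^2. *)
have h2 : `|df s * (s' - s) - t * df s / (2 * s)| <= L * (c ^+ 3 * t ^+ 2).
  have -> : df s * (s' - s) - t * df s / (2 * s)
      = - (df s * (t * (s' - s) / ((s' + s) * (2 * s)))).
    rewrite [X in df s * X - _]de; field.
    by rewrite !gt_eqF ?addr_gt0.
  have p1 : 0 < (s' + s) * (2 * s) by rewrite !mulr_gt0// addr_gt0.
  rewrite normrN normrM ler_pM ?dL// ger0_norm; last first.
    by rewrite divr_ge0 ?(ltW p1)// mulr_ge0// subr_ge0.
  have e1 : ((s' + s) * (2 * s))^-1 <= b^-1 * b^-1.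
    rewrite -invfM lef_pV2 ?posrE ?mulr_gt0 ?addr_gt0//.
    by apply: ler_pM; rewrite ?(ltW b0)//; lra.
  apply: (@le_trans _ _ ((t * (t * b^-1)) * (b^-1 * b^-1))).
    have d0 : 0 <= s' - s by rewrite subr_ge0.
    apply: ler_pM => //; first exact: mulr_ge0.
      by rewrite invr_ge0 ltW.
    by rewrite ler_wpM2l.
  rewrite (_ : _ * (b^-1 * b^-1) = b^-1 ^+ 3 * t ^+ 2); last by ring.
  by rewrite ler_wpM2r ?sqr_ge0// lerXn2r ?nnegrE ?(ltW i0)// ltW.
have h3 : (s' - s) ^+ 2 <= c ^+ 3 * t ^+ 2.
  apply: (@le_trans _ _ ((t * b^-1) ^+ 2)).
    by rewrite lerXn2r ?nnegrE ?subr_ge0// mulr_ge0// ltW.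
  rewrite exprMn mulrC ler_wpM2r ?sqr_ge0//.
  apply: (@le_trans _ _ (c ^+ 2)); first by rewrite lerXn2r ?nnegrE ?(ltW i0)// ltW.
  by rewrite [leRHS]exprS ler_peMl ?exprn_ge0// ltW.
have -> : f s' - f s - t * df s / (2 * s) = (f s' - f s - df s * (s' - s)) +
   (df s * (s' - s) - t * df s / (2 * s)) by ring.
apply: le_trans (ler_normD _ _) _.
rewrite (_ : (K + L) * c ^+ 3 * t ^+ 2 = K * (c ^+ 3 * t ^+ 2) +
  L * (c ^+ 3 * t ^+ 2)); last by ring.
by rewrite lerD// (le_trans h1)// ler_wpM2l.
Qed.

End mean_value_bounds.

(** * One Lindeberg step for the normal distribution function *)

Section normal_expansion.
Context {R : realType}.
Implicit Types b s x h : R.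

Lemma is_derive_scaled s x : is_derive x 1 (fun y => y / s) s^-1.
Proof. apply: is_derive_eq; rewrite /GRing.scale/=. by ring. Qed.

Lemma is_derive_inv_scaled s x : 0 < s ->
  is_derive s 1 (fun r => x / r) (- (x / s) / s).
Proof.
move=> s0; have s0' : s != 0 by rewrite gt_eqF.
have h := @is_deriveV R id s 1 1 s0' (is_derive_id _ _).
rewrite /= in h.
by apply: is_derive_eq; rewrite /GRing.scale/=; field.
Qed.

Lemma cube_le_min h : `|h| <= 1 -> `|h| ^+ 3 <= h ^+ 2 * Num.min 1 `|h|.
Proof.
by move=> h1; rewrite (min_idPr h1) -(real_normK (num_real h)) -exprSr.
Qed.

(** Taylor's formula for |h| <= 1; beyond that, every term on the left is itself bounded by a
    multiple of h^2. The truncated remainder h^2 min(1, |h|) is integrable as soon as h^2 is. *)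
Lemma ncdf_taylor_le b s x h : 0 < b -> b <= s ->
  `|ncdf ((x + h) / s) - ncdf (x / s) - npdf (x / s) / s * h
    + (x / s * npdf (x / s)) / (2 * s ^+ 2) * h ^+ 2|
  <= 8 * (1 + b^-1) ^+ 3 * (h ^+ 2 * Num.min 1 `|h|).
Proof.
move=> b0 bs; have s0 : 0 < s by rewrite (lt_le_trans b0).
have s0' : s != 0 by rewrite gt_eqF.
pose z := x / s.
set c := 1 + b^-1.
have i0 : 0 < s^-1 by rewrite invr_gt0.
have ic : s^-1 <= c.
  by rewrite /c (@le_trans _ _ b^-1)// ?lef_pV2 ?posrE// lerDr.
have c1 : 1 <= c by rewrite /c lerDl invr_ge0 ltW.
have c0 : 0 < c by rewrite (lt_le_trans _ c1).
have cX j : (s^-1) ^+ j <= c ^+ j by rewrite lerXn2r ?nnegrE ?(ltW i0) ?(ltW c0).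
have c3 j : (j <= 3)%N -> c ^+ j <= c ^+ 3 by move=> hj; rewrite ler_weXn2l.
have ic3 : s^-1 <= c ^+ 3.
  by apply: le_trans ic _; have := c3 1%N isT; rewrite expr1.
have [h1|h1] := leP `|h| 1.
- have := @taylor2_le R (fun y => ncdf (y / s)) (fun y => npdf (y / s) / s)
    (fun y => - (y / s) * npdf (y / s) / s ^+ 2)
    (fun y => ((y / s) ^+ 2 - 1) * npdf (y / s) / s ^+ 3)
    (x - 1) (x + 1) (3 * c ^+ 3) x (x + h).
  have -> : x + h - x = h by ring.
  move=> H; rewrite (_ : _ + _ = ncdf ((x + h) / s) - ncdf (x / s)
    - npdf (x / s) / s * h
    - - (x / s) * npdf (x / s) / s ^+ 2 / 2 * h ^+ 2); last by field.
  apply: le_trans (H _ _ _ _ _ _) _.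
  + by move=> w _; apply/is_derive_ncdf/is_derive_scaled.
  + move=> w _; have h2 := is_derive_npdf (is_derive_scaled s w).
    by apply: is_derive_eq; rewrite /GRing.scale/=; field.
  + move=> w _; have h2 := is_derive_npdf (is_derive_scaled s w).
    have h3 := is_derive_scaled s w.
    by apply: is_derive_eq; rewrite /GRing.scale/=; field.
  + move=> w _; rewrite -exprVn normrM ler_pM//; last first.
      by rewrite ger0_norm ?cX ?exprn_ge0 ?ltW.
    have := npdf_sqr_le (w / s); have := npdf_le1 (w / s).
    have := npdf_ge0 (w / s); set p := npdf _; set q := _ ^+ 2 => p0 p1 pq.
    have q0 : 0 <= q * p by rewrite mulr_ge0 ?sqr_ge0.
    by rewrite ler_norml; nra.
  + lra.
  + by move: h1; rewrite ler_norml; lra.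
  + rewrite -mulrA; have := cube_le_min h1; have := c3 0%N isT.
    rewrite (min_idPr h1) expr0 => k1 k2.
    have c3p : 0 <= c ^+ 3 by rewrite exprn_ge0// ltW.
    by rewrite -mulrA; apply: ler_pM; rewrite ?mulr_ge0 ?exprn_ge0 ?(ltW c0)//;
      [lra|exact: ler_wpM2l].
- rewrite mulr1.
  have hh : `|h| <= h ^+ 2.
    by rewrite -(real_normK (num_real h)) expr2 ler_peMr// ltW.
  have k1 : `|ncdf ((x + h) / s) - ncdf (x / s)| <= c ^+ 3 * h ^+ 2.
    apply: le_trans (ncdf_lip _ _) _.
    rewrite (_ : (x + h) / s - x / s = s^-1 * h); last by field.
    by rewrite normrM ger0_norm ?(ltW i0)//; apply: ler_pM; rewrite ?(ltW i0).
  have k2 : `|npdf (x / s) / s * h| <= c ^+ 3 * h ^+ 2.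
    rewrite !normrM (ger0_norm (ltW i0)) ler_pM ?mulr_ge0 ?(ltW i0)//.
    rewrite ger0_norm ?npdf_ge0//.
    apply: (@le_trans _ _ (1 * s^-1)).
      by rewrite ler_wpM2r ?npdf_le1 ?ltW.
    by rewrite mul1r.
  have k3 : `|x / s * npdf (x / s) / (2 * s ^+ 2) * h ^+ 2| <= 2 * c ^+ 3 * h ^+ 2.
    rewrite normrM [X in _ * X]ger0_norm ?sqr_ge0// ler_wpM2r ?sqr_ge0//.
    rewrite normrM ler_pM//.
      by rewrite normrM (ger0_norm (npdf_ge0 _)) npdf_abs_le.
    rewrite ger0_norm ?invr_ge0 ?mulr_ge0 ?exprn_ge0 ?(ltW s0)// invfM -exprVn.
    apply: (@le_trans _ _ (1 * s^-1 ^+ 2)).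
      by rewrite ler_wpM2r ?exprn_ge0 ?(ltW i0)// invf_le1 ?ler1n.
    by rewrite mul1r (le_trans (cX 2%N))// c3.
  apply: le_trans (ler_normD _ _) _.
  apply: le_trans (lerD (ler_normB _ _) (lexx _)) _.
  have : 0 <= c ^+ 3 * h ^+ 2 by rewrite mulr_ge0 ?sqr_ge0 ?exprn_ge0 ?ltW.
  lra.
Qed.

Lemma ncdf_time_le b s s' x : 0 < b -> b <= s -> s <= s' ->
  `|ncdf (x / s') - ncdf (x / s)
    + (s' ^+ 2 - s ^+ 2) * (x / s * npdf (x / s)) / (2 * s ^+ 2)|
  <= 14 * (1 + b^-1) ^+ 5 * (s' ^+ 2 - s ^+ 2) ^+ 2.
Proof.
move=> b0 bs ss'; have s0 : 0 < s by rewrite (lt_le_trans b0).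
set c := 1 + b^-1.
have c1 : 1 <= c by rewrite /c lerDl invr_ge0 ltW.
have c0 : 0 < c by rewrite (lt_le_trans _ c1).
have cX j z : b <= z -> (z^-1) ^+ j <= c ^+ j.
  move=> bz; have z0 : 0 < z by rewrite (lt_le_trans b0).
  rewrite lerXn2r ?nnegrE ?invr_ge0 ?(ltW z0) ?(ltW c0)//.
  by rewrite /c (@le_trans _ _ b^-1)// ?lef_pV2 ?posrE// lerDr.
pose df z := - (x / z) * npdf (x / z) / z.
pose ddf z := ((2 * (x / z) - (x / z) ^+ 3) * npdf (x / z)) / z ^+ 2.
have d1 z : b <= z <= s' -> is_derive z 1 (fun r => ncdf (x / r)) (df z).
  move=> /andP[bz _]; have z0 : 0 < z by rewrite (lt_le_trans b0).
  have := is_derive_ncdf (is_derive_inv_scaled x z0).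
  by rewrite /df mulrA (mulrC (npdf _)).
have d2 z : b <= z <= s' -> is_derive z 1 df (ddf z).
  move=> /andP[bz _]; have z0 : 0 < z by rewrite (lt_le_trans b0).
  have z0' : z != 0 by rewrite gt_eqF.
  have h := is_derive_inv_scaled x z0.
  have h1 := is_derive_inv_scaled 1 z0.
  have h2 := is_derive_npdf h.
  rewrite /df; under eq_fun do rewrite -[X in _ * X]mul1r.
  by apply: is_derive_eq; rewrite /GRing.scale/= /ddf; field.
(* 12 = 2 * 2 + 8 from the bounds on |y| npdf y and |y|^3 npdf y. With the bound 2 c on [df] this
   gives 12 c^2 + 2 c <= 14 c^2, the origin of the 14 in the statement. *)
have b2 z : b <= z <= s' -> `|ddf z| <= 12 * c ^+ 2.
  move=> /andP[bz _]; have z0 : 0 < z by rewrite (lt_le_trans b0).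
  rewrite /ddf -exprVn normrM ler_pM//; last first.
    by rewrite ger0_norm ?cX ?exprn_ge0 ?invr_ge0 ?(ltW z0).
  rewrite normrM (ger0_norm (npdf_ge0 _)).
  apply: (@le_trans _ _ ((2 * `|x / z| + `|x / z| ^+ 3) * npdf (x / z))).
    rewrite ler_wpM2r ?npdf_ge0// (le_trans (ler_normB _ _))// normrM normrX.
    by rewrite (@ger0_norm _ 2).
  have := npdf_abs_le (x / z); have := npdf_cube_le (x / z); lra.
have := @sqr_param_le R (fun r => ncdf (x / r)) df b s' (12 * c ^+ 2) (2 * c)
  s s' b0 _ _ d1.
have -> : (s' ^+ 2 - s ^+ 2) * df s / (2 * s) =
    - ((s' ^+ 2 - s ^+ 2) * (x / s * npdf (x / s)) / (2 * s ^+ 2)).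
  by rewrite /df; field; rewrite gt_eqF.
rewrite opprK => H; apply: le_trans (H _ _ _ _ bs ss' (lexx _)) _.
- by rewrite mulr_ge0// exprn_ge0// ltW.
- by rewrite mulr_ge0// ltW.
- by move=> z w hz hw; exact: le_norm_MVT d2 b2 hw hz.
- move=> z /andP[bz _]; have z0 : 0 < z by rewrite (lt_le_trans b0).
  rewrite /df normrM ler_pM//.
    by rewrite normrM normrN (ger0_norm (npdf_ge0 _)) npdf_abs_le.
  by rewrite ger0_norm ?invr_ge0 ?(ltW z0)//; have := cX 1%N z bz; rewrite !expr1.
rewrite ler_wpM2r ?sqr_ge0// -/c (exprD _ 2 3) mulrA ler_wpM2r ?exprn_ge0 ?(ltW c0)//.
by have := ler_peMr (ltW c0) c1; rewrite -expr2; lra.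
Qed.

(* The heat equation: the second-order terms cancel when the variance
   [s^2] increases by [h^2]. *)
Lemma ncdf_step_le b s s' x h : 0 < b -> b <= s -> s <= s' ->
  `|ncdf ((x + h) / s) - ncdf (x / s') - npdf (x / s) / s * h
    + (x / s * npdf (x / s)) / (2 * s ^+ 2) * (h ^+ 2 - (s' ^+ 2 - s ^+ 2))|
  <= 14 * (1 + b^-1) ^+ 5 *
     (h ^+ 2 * Num.min 1 `|h| + (s' ^+ 2 - s ^+ 2) ^+ 2).
Proof.
move=> b0 bs ss'; have k1 := ncdf_taylor_le x h b0 bs.
have k2 := ncdf_time_le x b0 bs ss'.
set c := 1 + b^-1 in k1 k2 *.
have c1 : 1 <= c by rewrite /c lerDl invr_ge0 ltW.
have c0 : 0 < c by rewrite (lt_le_trans _ c1).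
have c35 : c ^+ 3 <= c ^+ 5 by rewrite ler_weXn2l.
set m := h ^+ 2 * _ in k1 *.
have m0 : 0 <= m by rewrite /m mulr_ge0 ?sqr_ge0// le_min ler01 normr_ge0.
rewrite (_ : _ + _ * _ = (ncdf ((x + h) / s) - ncdf (x / s) - npdf (x / s) / s * h
    + (x / s * npdf (x / s)) / (2 * s ^+ 2) * h ^+ 2) -
  (ncdf (x / s') - ncdf (x / s)
    + (s' ^+ 2 - s ^+ 2) * (x / s * npdf (x / s)) / (2 * s ^+ 2))); last by ring.
rewrite (le_trans (ler_normB _ _))// mulrDr lerD// (le_trans k1)//.
rewrite ler_wpM2r//; have := exprn_ge0 3 (ltW c0); lra.
Qed.

End normal_expansion.

(** * The Black-Scholes put *)

Section put_function.
Context {R : realType}.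
Implicit Types b s l w x : R.

Definition put_d1 s l := s / 2 - ln l / s.
Definition put_d2 s l := - (s / 2) - ln l / s.

(* The Black-Scholes price of a put with strike 1 and variance [s^2], that is
   [E (1 - l e^(s Z - s^2/2))^+] for a standard normal [Z]. *)
Definition put s l :=
  if 0 < l then ncdf (put_d1 s l) - l * ncdf (put_d2 s l) else 1.

Lemma putE s l : 0 < l -> put s l = ncdf (put_d1 s l) - l * ncdf (put_d2 s l).
Proof. by rewrite /put => ->. Qed.

(** Because d1^2 - d2^2 = - 2 ln l. This identity removes the density terms when [put] is
    differentiated, so that the vega is npdf(d1) and the delta is - ncdf(d2). *)
Lemma npdf_put_d s l : 0 < s -> 0 < l ->
  l * npdf (put_d2 s l) = npdf (put_d1 s l).
Proof.
move=> s0 l0; rewrite !npdfE mulrCA -{1}(lnK l0) -expRD.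
by congr (_ * expR _); rewrite /put_d1 /put_d2; field; rewrite gt_eqF.
Qed.

Lemma is_derive_put_d1 s l : 0 < s ->
  is_derive s 1 (put_d1 ^~ l) (1 - put_d1 s l / s).
Proof.
move=> s0; have s0' : s != 0 by rewrite gt_eqF.
have h := is_derive_inv_scaled (ln l) s0; rewrite /put_d1.
by apply: is_derive_eq; rewrite /GRing.scale/=; field.
Qed.

Lemma is_derive_put_d2 s l : 0 < s ->
  is_derive s 1 (put_d2 ^~ l) (- (put_d1 s l / s)).
Proof.
move=> s0; have s0' : s != 0 by rewrite gt_eqF.
have h := is_derive_inv_scaled (ln l) s0; rewrite /put_d1 /put_d2.
by apply: is_derive_eq; rewrite /GRing.scale/=; field.
Qed.

Lemma is_derive_put_sd s l : 0 < s -> 0 < l ->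
  is_derive s 1 (put ^~ l) (npdf (put_d1 s l)).
Proof.
move=> s0 l0; rewrite /put l0.
have h1 := is_derive_ncdf (is_derive_put_d1 l s0).
have h2 := is_derive_ncdf (is_derive_put_d2 l s0).
apply: is_derive_eq; rewrite /GRing.scale/= -(npdf_put_d s0 l0); ring.
Qed.

Lemma put_nd s s' l : 0 < s -> s <= s' -> 0 < l -> put s l <= put s' l.
Proof.
move=> s0 ss' l0.
have [z|z|c] := @MVT_segment R (put ^~ l) (fun z => npdf (put_d1 z l)) s s' ss'.
- rewrite in_itv/= => /andP[sz _].
  by apply: is_derive_put_sd => //; rewrite (lt_trans s0).
- apply: continuous_in_subspaceT => w; rewrite inE/= in_itv/= => /andP[sw _].
  apply/differentiable_continuous/derivable1_diffP.
  by case: (is_derive_put_sd (lt_le_trans s0 sw) l0).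
- by move=> _ e; rewrite -subr_ge0 e mulr_ge0 ?npdf_ge0 ?subr_ge0.
Qed.

Lemma ncdf_near1 (e : R) : 0 < e -> exists2 M : R, 0 < M &
  forall x, M <= x -> 1 - e <= ncdf x.
Proof.
move=> e0; have /cvgrPdist_le/(_ _ e0) := @ncdf_cvgy R.
move=> [M [_ hM]]; exists (Num.max 1 (M + 1)); first by rewrite lt_max ltr01.
move=> x; rewrite ge_max => /andP[_ Mx].
have := hM x; rewrite ler_norml => /(_ (lt_le_trans _ Mx)).
by rewrite ltrDl ltr01 => /(_ isT); lra.
Qed.

(** The payoff (1 - l)^+ is the limit of the price as the volatility tends to 0, and the price
    increases with the volatility; so it suffices to come within [e] of the payoff at some small
    volatility. *)
Lemma put_ge_payoff s l : 0 < s -> 0 < l -> 0 <= put s l /\ 1 - l <= put s l.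
Proof.
move=> s0 l0.
suff H (e : R) : 0 < e -> - e <= put s l /\ 1 - l - e <= put s l.
  split; apply/ler_addgt0Pl => e /H []; lra.
move=> e0.
have [->|l1] := eqVneq l 1.
  rewrite putE// /put_d1 /put_d2 ln1 mul0r !subr0 mul1r.
  by have := @ncdf_nd R (- (s / 2)) (s / 2) ltac:(lra); lra.
set e' := e / (1 + l).
have l1p : 0 < 1 + l by lra.
have e'0 : 0 < e' by rewrite divr_gt0.
have e'e : (1 + l) * e' = e by rewrite /e' mulrC divfK// gt_eqF.
have [M M0 hM] := ncdf_near1 e'0.
have ly0 : ln l != 0 by rewrite ln_eq0.
have N0 : 0 < `|ln l| by rewrite normr_gt0.
(* So small that |ln l| / r >= M + s. For l < 1 this gives d1 >= M and a price of at least 1 - e' -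
   l; for l > 1 it gives - d2 >= M and a price of at least - l e'. Both losses are at most (1 + l)
   e' = e. *)
pose r := Num.min s (`|ln l| / (M + s)).
have Ms : 0 < M + s by rewrite addr_gt0.
have r0 : 0 < r by rewrite lt_min s0 divr_gt0.
have rs : r <= s by rewrite ge_min lexx.
have rl : M + s <= `|ln l| / r.
  by rewrite ler_pdivlMr// mulrC -ler_pdivlMr// ge_min lexx orbT.
suff : - e <= put r l /\ 1 - l - e <= put r l.
  have := put_nd r0 rs l0; move=> h [h1 h2]; lra.
have := ncdf_ge0 (put_d1 r l); have := ncdf_ge0 (put_d2 r l).
have := ncdf_le1 (put_d1 r l); have := ncdf_le1 (put_d2 r l).
rewrite putE//; move: ly0; rewrite neq_lt => /orP[ln0|ln0].
- have ll : l < 1 by move: ln0; apply: contraTT; rewrite -!leNgt; exact: ln_ge0.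
  move: rl; rewrite ltr0_norm// mulNr => rl.
  have : 1 - e' <= ncdf (put_d1 r l) by apply: hM; rewrite /put_d1; lra.
  set p := ncdf _; set q := ncdf _; nra.
- have ll : 1 <= l by rewrite leNgt; move: ln0; apply: contraTN => /ltW/ln_le0; rewrite leNgt.
  move: rl; rewrite gtr0_norm// => rl.
  have : 1 - e' <= ncdf (- put_d2 r l).
    by apply: hM; rewrite /put_d2 opprD opprK; lra.
  rewrite ncdfN; set p := ncdf _; set q := ncdf _; nra.
Qed.

Lemma put_ge0 s l : 0 < s -> 0 <= put s l.
Proof.
move=> s0; have [l0|l0] := ltP 0 l; first by have [] := put_ge_payoff s0 l0.
by rewrite /put ltNge l0/=.
Qed.

Lemma put_le1 s l : put s l <= 1.
Proof.
rewrite /put; case: ifPn => // l0.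
by have := mulr_ge0 (ltW l0) (ncdf_ge0 (put_d2 s l)); have := ncdf_le1 (put_d1 s l); lra.
Qed.

(** The spot times the absolute delta is at most [ncdf (put_d1 s l)] because the price is
    nonnegative. The bound is uniform in [l], as it must be for a spot that changes with every
    observation. *)
Lemma put_delta_bound s l : 0 < s -> 0 < l -> 0 <= l * ncdf (put_d2 s l) <= 1.
Proof.
move=> s0 l0; rewrite mulr_ge0 ?ncdf_ge0 ?(ltW l0)//=.
have := put_ge0 l s0; rewrite putE//; have := ncdf_le1 (put_d1 s l); lra.
Qed.

(** The derivative of the vega in s involves d1 and d1^2, which are unbounded in [l]; the factor
    npdf(d1) bounds them, so the constant does not depend on [l]. *)
Lemma put_time_le b s s' l : 0 < b -> b <= s -> s <= s' -> 0 < l ->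
  `|put s' l - put s l
    - (s' ^+ 2 - s ^+ 2) * npdf (put_d1 s l) / (2 * s)|
  <= 3 * (1 + b^-1) ^+ 4 * (s' ^+ 2 - s ^+ 2) ^+ 2.
Proof.
move=> b0 bs ss' l0.
set c := 1 + b^-1.
have c1 : 1 <= c by rewrite /c lerDl invr_ge0 ltW.
have c0 : 0 < c by rewrite (lt_le_trans _ c1).
pose ddf z := - put_d1 z l * npdf (put_d1 z l) * (1 - put_d1 z l / z).
have d1 z : b <= z <= s' -> is_derive z 1 (put ^~ l) (npdf (put_d1 z l)).
  by move=> /andP[bz _]; apply: is_derive_put_sd => //; rewrite (lt_le_trans b0).
have d2 z : b <= z <= s' -> is_derive z 1 (fun z => npdf (put_d1 z l)) (ddf z).
  move=> /andP[bz _]; apply: is_derive_npdf.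
  by apply: is_derive_put_d1; rewrite (lt_le_trans b0).
have b2 z : b <= z <= s' -> `|ddf z| <= 2 * c.
  move=> /andP[bz _]; have z0 : 0 < z by rewrite (lt_le_trans b0).
  rewrite (_ : ddf z = (put_d1 z l) ^+ 2 * npdf (put_d1 z l) * z^-1 -
      put_d1 z l * npdf (put_d1 z l)); last by rewrite /ddf; ring.
  apply: le_trans (ler_normB _ _) _; rewrite mulrDr mulr1 [leRHS]addrC lerD//.
    rewrite normrM ler_pM//.
      by rewrite ger0_norm ?npdf_sqr_le// mulr_ge0 ?npdf_ge0 ?sqr_ge0.
    by rewrite ger0_norm ?invr_ge0 ?(ltW z0)// lef_pV2.
  by rewrite normrM (ger0_norm (npdf_ge0 _)) npdf_abs_le.
have := @sqr_param_le R (put ^~ l) (fun z => npdf (put_d1 z l)) b s' (2 * c) 1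
  s s' b0 _ _ d1.
move=> H; apply: le_trans (H _ _ _ _ bs ss' (lexx _)) _ => //.
- by rewrite mulr_ge0// ltW.
- by move=> z w hz hw; exact: le_norm_MVT d2 b2 hw hz.
- by move=> z _; rewrite ger0_norm ?npdf_ge0 ?npdf_le1.
rewrite ler_wpM2r ?sqr_ge0// -/c (exprD _ 1 3) mulrA ler_wpM2r ?exprn_ge0 ?(ltW c0)//.
by rewrite expr1; lra.
Qed.

Lemma is_derive_ln_mul l x : 0 < l -> 0 < x ->
  is_derive x 1 (fun z => ln (l * z)) x^-1.
Proof.
move=> l0 x0; have h0 : 0 < l * x by rewrite mulr_gt0.
have hm : is_derive x 1 (fun z : R => l * z) l.
  by apply: is_derive_eq; rewrite /GRing.scale/=; ring.
have h := @is_derive1_comp R (@ln R) (fun z => l * z) x _ _ (is_derive1_ln h0) hm.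
apply: is_derive_eq; rewrite /GRing.scale/=; field.
by rewrite !gt_eqF.
Qed.

(** The expansion is in the factor x = (1 + w)^2 of the spot, about x = 1. The condition on [w]
    keeps x in [1/4, 9/4], so that x^-3 <= 64; the other factors of the third derivative contribute
    4 c and c. *)
Lemma put_taylor_le b s l w : 0 < b -> b <= s -> 0 < l -> `|w| <= 1 / 2 ->
  `|put s (l * (1 + w) ^+ 2) - put s l + l * ncdf (put_d2 s l) * (2 * w + w ^+ 2)
    - npdf (put_d1 s l) / (2 * s) * (2 * w + w ^+ 2) ^+ 2|
  <= 256 * (1 + b^-1) ^+ 2 * `|2 * w + w ^+ 2| ^+ 3.
Proof.
move=> b0 bs l0 w2; have s0 : 0 < s by rewrite (lt_le_trans b0).
have s0' : s != 0 by rewrite gt_eqF.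
set c := 1 + b^-1.
have c1 : 1 <= c by rewrite /c lerDl invr_ge0 ltW.
have c0 : 0 < c by rewrite (lt_le_trans _ c1).
have i0 : 0 < s^-1 by rewrite invr_gt0.
have ic : s^-1 <= c.
  by rewrite /c (@le_trans _ _ b^-1)// ?lef_pV2 ?posrE// lerDr.
have dln x : 0 < x -> is_derive x 1 (fun z => ln (l * z) / s) (x^-1 / s).
  move=> x0; have h := is_derive_ln_mul l0 x0.
  by apply: is_derive_eq; rewrite /GRing.scale/=; ring.
have dd1 x : 0 < x -> is_derive x 1 (fun z => put_d1 s (l * z)) (- (x^-1 / s)).
  move=> x0; have h := dln _ x0; rewrite /put_d1.
  by apply: is_derive_eq; rewrite add0r mul1r.
have dd2 x : 0 < x -> is_derive x 1 (fun z => put_d2 s (l * z)) (- (x^-1 / s)).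
  move=> x0; have h := dln _ x0; rewrite /put_d2.
  by apply: is_derive_eq; rewrite add0r mul1r.
have pos x : 1 / 4 <= x <= 9 / 4 -> 0 < x by move=> /andP[? _]; lra.
have := @taylor2_le R
  (fun x => ncdf (put_d1 s (l * x)) - l * x * ncdf (put_d2 s (l * x)))
  (fun x => - (l * ncdf (put_d2 s (l * x))))
  (fun x => npdf (put_d1 s (l * x)) / (s * x ^+ 2))
  (fun x => npdf (put_d1 s (l * x)) * (put_d1 s (l * x) / s - 2) / (s * x ^+ 3))
  (1 / 4) (9 / 4) (256 * c ^+ 2) 1 ((1 + w) ^+ 2).
have hw : - (1 / 2) <= w <= 1 / 2 by rewrite -ler_norml.
have hw2 : 1 / 4 <= (1 + w) ^+ 2 <= 9 / 4 by nra.
have lw0 : 0 < l * (1 + w) ^+ 2 by rewrite mulr_gt0// pos.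
rewrite (putE s lw0) (putE s l0) !mulr1 => H.
have e1 : (1 + w) ^+ 2 - 1 = 2 * w + w ^+ 2 by ring.
rewrite e1 in H.
rewrite (_ : npdf (put_d1 s l) / (2 * s) =
  npdf (put_d1 s l) / (s * 1 ^+ 2) / 2); last by field.
rewrite mulNr opprK in H.
apply: H => //; last by lra.
- move=> x /pos x0; have x0' : x != 0 by rewrite gt_eqF.
  have h1 := is_derive_ncdf (dd1 _ x0); have h2 := is_derive_ncdf (dd2 _ x0).
  have lx0 : 0 < l * x by rewrite mulr_gt0.
  apply: is_derive_eq; rewrite /GRing.scale/= -(npdf_put_d s0 lx0); ring.
- move=> x /pos x0; have x0' : x != 0 by rewrite gt_eqF.
  have h2 := is_derive_ncdf (dd2 _ x0).
  have lx0 : 0 < l * x by rewrite mulr_gt0.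
  apply: is_derive_eq; rewrite /GRing.scale/= -(npdf_put_d s0 lx0); field.
  by rewrite x0'.
- move=> x /pos x0; have x0' : x != 0 by rewrite gt_eqF.
  have h1 := is_derive_npdf (dd1 _ x0).
  have sx0 : s * x ^+ 2 != 0 by rewrite gt_eqF// mulr_gt0// exprn_gt0.
  have h3 : is_derive x 1 (fun z => s * (z ^+ 2)) (s * (2 * x)).
    rewrite (_ : (fun z => _) = (fun z => s * (z * z))); last first.
      by apply/funext => z; rewrite expr2.
    by apply: is_derive_eq; rewrite /GRing.scale/=; ring.
  have h4 := @is_deriveV R (fun z => s * z ^+ 2) x _ 1 sx0 h3.
  apply: is_derive_eq; rewrite /GRing.scale/=; field.
  by rewrite x0'.
- move=> x hx; have x0 := pos _ hx.
  set p := npdf _; set d := put_d1 _ _.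
  rewrite (_ : _ / _ = (d * p * s^-1 - 2 * p) * (s^-1 * (x^-1 ^+ 3))); last first.
    by field; rewrite gt_eqF.
  rewrite (_ : 256 * c ^+ 2 = (4 * c) * (c * 64)); last by ring.
  rewrite normrM ler_pM//.
    rewrite (le_trans (ler_normB _ _))// (_ : 4 * c = 2 * c + 2 * c); last by ring.
    rewrite lerD//.
      rewrite normrM (ger0_norm (ltW i0)) ler_pM ?(ltW i0)//.
      by rewrite normrM (ger0_norm (npdf_ge0 _)) npdf_abs_le.
    rewrite normrM !ger0_norm ?npdf_ge0// ler_pM ?npdf_ge0//.
    by rewrite (le_trans (npdf_le1 _)).
  have x3 : 0 <= x^-1 ^+ 3 by rewrite exprn_ge0// invr_ge0 ltW.
  rewrite (ger0_norm (mulr_ge0 (ltW i0) x3)); apply: ler_pM; rewrite ?(ltW i0)//.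
  have -> : 64 = 4 ^+ 3 :> R by rewrite !exprS expr0; lra.
  rewrite lerXn2r ?nnegrE ?invr_ge0 ?(ltW x0)//.
  by rewrite -[leRHS]invrK lef_pV2 ?posrE ?invr_gt0//; lra.
Qed.

(* The Black-Scholes equation [d put / d(s^2) = l^2 put'' / 2] makes the
   second-order terms cancel when the variance [s^2] increases by [4 w^2]. *)
Definition put_step_bound b C :=
  forall s s' l w, b <= s -> s <= s' -> 0 < l -> -1 <= w ->
  `|put s (l * (1 + w) ^+ 2) - put s' l + l * ncdf (put_d2 s l) * (2 * w + w ^+ 2)
    - npdf (put_d1 s l) / (2 * s) * (4 * w ^+ 2 - (s' ^+ 2 - s ^+ 2))|
  <= C * (w ^+ 2 * Num.min 1 `|w| + (s' ^+ 2 - s ^+ 2) ^+ 2).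

Lemma put_step_le b : 0 < b -> exists2 C, 0 <= C & put_step_bound b C.
Proof.
(* The main part is 256 (5/2)^3 = 4000, from the Taylor remainder with |2 w + w^2| <= 5/2 |w|; the
   surplus absorbs the smaller terms. *)
move=> b0; have [K K4200] : exists K : R, K = 4200 by exists 4200.
have K0 : 0 <= K by lra.
exists (K * (1 + b^-1) ^+ 4).
  by rewrite mulr_ge0// exprn_ge0// addr_ge0// invr_ge0 ltW.
move=> s s' l w bs ss' l0 w1; have s0 : 0 < s by rewrite (lt_le_trans b0).
have k2 := put_time_le b0 bs ss' l0.
have [D0 D1] := andP (put_delta_bound s0 l0).
set D := l * ncdf _ in D0 D1 *.
set p := npdf _ in k2 *.
have p0 : 0 <= p by exact: npdf_ge0.
have p1 : p <= 1 by exact: npdf_le1.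
set c := 1 + b^-1 in k2 *.
have c1 : 1 <= c by rewrite /c lerDl invr_ge0 ltW.
have c0 : 0 < c by rewrite (lt_le_trans _ c1).
have i0 : 0 < s^-1 by rewrite invr_gt0.
have ic : s^-1 <= c.
  by rewrite /c (@le_trans _ _ b^-1)// ?lef_pV2 ?posrE// lerDr.
set q := p / (2 * s) in k2 *.
have q0 : 0 <= q by rewrite divr_ge0// mulr_ge0// ltW.
have qc : q <= c / 2.
  rewrite (_ : q = p * s^-1 / 2) ?ler_pM2r//; last by rewrite /q; field; rewrite gt_eqF.
  by rewrite (le_trans _ ic)// ler_piMl// ltW.
have c2 : c <= c ^+ 2 by rewrite expr2 ler_peMr// ltW.
have c24 : c ^+ 2 <= c ^+ 4 by rewrite ler_weXn2l.
set t := s' ^+ 2 - s ^+ 2 in k2 *.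
set m := w ^+ 2 * _.
suff k1 : `|put s (l * (1 + w) ^+ 2) - put s l + D * (2 * w + w ^+ 2)
    - q * (4 * w ^+ 2)| <= K * c ^+ 2 * m.
  have m0 : 0 <= m by rewrite /m mulr_ge0 ?sqr_ge0// le_min ler01 normr_ge0.
  rewrite (_ : _ - _ * _ = (put s (l * (1 + w) ^+ 2) - put s l
    + D * (2 * w + w ^+ 2) - q * (4 * w ^+ 2)) -
    (put s' l - put s l - t * p / (2 * s))); last by rewrite /q; ring.
  rewrite (le_trans (ler_normB _ _))// [leRHS]mulrDr lerD//.
    by rewrite (le_trans k1)// ler_wpM2r// ler_wpM2l.
  rewrite (le_trans k2)// ler_wpM2r ?sqr_ge0// ler_wpM2r ?exprn_ge0 ?(ltW c0)//.
  by lra.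
have wa : w ^+ 2 = `|w| ^+ 2 by rewrite real_normK ?num_real.
have [h|h] := leP `|w| (1 / 2).
- have k := put_taylor_le b0 bs l0 h.
  have mE : m = `|w| ^+ 3.
    by rewrite /m (min_idPr _) ?(le_trans h)//; [rewrite wa -exprSr|lra].
  rewrite -/D -/p -/q -/c in k.
  (* Here (2 w + w^2)^2 = 4 w^2 + w^3 (4 + w), and the cubic part joins the remainder. *)
  rewrite (_ : _ - _ * _ = (put s (l * (1 + w) ^+ 2) - put s l
      + D * (2 * w + w ^+ 2) - q * (2 * w + w ^+ 2) ^+ 2) +
      q * (w ^+ 3 * (4 + w))); last by ring.
  have a0 := normr_ge0 w.
  rewrite (le_trans (ler_normD _ _))//.
  apply: (@le_trans _ _ (256 * c ^+ 2 * (5 / 2 * `|w|) ^+ 3 + c / 2 * (`|w| ^+ 3 * 5))).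
    rewrite lerD//.
      have c256 : 0 <= 256 * c ^+ 2 by have := sqr_ge0 c; lra.
      apply: (le_trans k); apply: (ler_wpM2l c256).
      rewrite lerXn2r ?nnegrE ?mulr_ge0//.
      by rewrite expr2 -mulrDl normrM ler_wpM2r// ler_norml; move: h; rewrite ler_norml; lra.
    rewrite normrM (ger0_norm q0) ler_pM// normrM normrX ler_wpM2l ?exprn_ge0//.
    by rewrite ler_norml; move: h; rewrite ler_norml; lra.
  rewrite mE exprMn.
  have w3 : 0 <= `|w| ^+ 3 by rewrite exprn_ge0.
  have -> : (5 / 2) ^+ 3 = 125 / 8 :> R by rewrite !exprS expr0; lra.
  nra.
(* For |w| > 1/2 the factor min(1, |w|) exceeds 1/2, so [m] dominates w^2 / 2, and w^2 dominates
   every other term since prices lie in [0, 1]. This covers w = -1, where the spot drops to 0 and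
   [put] takes its default value 1. *)
- clear k2 c24.
  have mw : w ^+ 2 <= 2 * m.
    rewrite /m mulrCA ler_peMr ?sqr_ge0//.
    by rewrite -(@ler_pM2l _ 2^-1)// mulrA mulVf// mul1r mulr1 le_min; lra.
  have w4 : 1 <= 4 * w ^+ 2 by rewrite wa; nra.
  have w5 : `|w| <= 2 * w ^+ 2 by rewrite wa; nra.
  have := put_le1 s l; have := put_ge0 l s0.
  have := put_le1 s (l * (1 + w) ^+ 2); have := put_ge0 (l * (1 + w) ^+ 2) s0.
  move=> h1 h2 h3 h4.
  have h5 : `|D * (2 * w + w ^+ 2)| <= 5 * w ^+ 2.
    rewrite normrM (ger0_norm D0).
    apply: (@le_trans _ _ `|2 * w + w ^+ 2|); first by rewrite ler_piMl.
    rewrite (le_trans (ler_normD _ _))// normrM normrX (@ger0_norm _ 2)// -wa; lra.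
  have h6 : 0 <= q * (4 * w ^+ 2) <= 2 * c ^+ 2 * w ^+ 2.
    have w2 := sqr_ge0 w.
    have w24 : 0 <= 4 * w ^+ 2 by lra.
    rewrite (mulr_ge0 q0 w24)/=.
    have qc2 : q <= c ^+ 2 / 2 by lra.
    by have := ler_wpM2r w24 qc2; lra.
  have c21 : 1 <= c ^+ 2 by exact: le_trans c1 c2.
  have m20 : 0 <= 2 * m by exact: le_trans (sqr_ge0 _) mw.
  have h7 : w ^+ 2 <= c ^+ 2 * (2 * m) by rewrite (le_trans mw)// ler_peMl.
  have h8 : c ^+ 2 * w ^+ 2 <= c ^+ 2 * (2 * m) by rewrite ler_wpM2l// sqr_ge0.
  move: h5 h6; rewrite ler_norml => /andP[h5a h5b] /andP[h6a h6b].
  rewrite ler_norml.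
  move: (D * (2 * w + w ^+ 2)) (q * (4 * w ^+ 2)) h5a h5b h6a h6b => x1 x2 *.
  have cm0 : 0 <= c ^+ 2 * m by rewrite mulr_ge0 ?sqr_ge0//; lra.
  have K22 : 22 <= K by lra.
  have := ler_wpM2r cm0 K22; clear K4200 K0 K22.
  lra.
Qed.

End put_function.

(** * Expectations of integrable and square integrable functions *)

Section expectation.
Context {d : measure_display} {X : measurableType d} {R : realType}.
Variable P : probability X R.
Implicit Types (f g h : X -> R) (c M : R).

Definition integ f := P.-integrable setT (EFin \o f).

Lemma integ_meas f : integ f -> measurable_fun setT f.
Proof. by move=> /measurable_int/measurable_EFinP. Qed.

Lemma integ_le f g : measurable_fun setT f -> integ g ->
  (forall x, `|f x| <= g x) -> integ f.
Proof.
move=> mf ig fg; apply: le_integrable ig => //; first exact/measurable_EFinP.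
by move=> x _ /=; rewrite lee_fin (le_trans (fg x))// ler_norm.
Qed.

Lemma integ_cst c : integ (fun=> c).
Proof.
exact: finite_measure_integrable_cst.
Qed.

Lemma integ_bdd f M : measurable_fun setT f -> (forall x, `|f x| <= M) -> integ f.
Proof. by move=> mf fM; apply: integ_le (integ_cst M) fM. Qed.

Lemma integD f g : integ f -> integ g -> integ (fun x => f x + g x).
Proof. exact: integrableD. Qed.

Lemma integB f g : integ f -> integ g -> integ (fun x => f x - g x).
Proof. exact: integrableB. Qed.

Lemma integZ c f : integ f -> integ (fun x => c * f x).
Proof. exact: integrableZl. Qed.

Lemma integ_abs f : integ f -> integ (fun x => `|f x|).
Proof. by move=> /integrable_abse. Qed.

Lemma ED f g : integ f -> integ g ->
  \int[P]_x (f x + g x) = \int[P]_x f x + \int[P]_x g x.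
Proof. exact: RintegralD. Qed.

Lemma EB f g : integ f -> integ g ->
  \int[P]_x (f x - g x) = \int[P]_x f x - \int[P]_x g x.
Proof. exact: RintegralB. Qed.

Lemma EZ c f : integ f -> \int[P]_x (c * f x) = c * \int[P]_x f x.
Proof. by move=> ?; rewrite RintegralZl. Qed.

Lemma Ecst c : \int[P]_x c = c.
Proof.
rewrite Rintegral_cst// [X in fine X](_ : _ = 1%E) ?mulr1//.
exact: probability_setT.
Qed.

Lemma Ele f g : integ f -> integ g -> (forall x, f x <= g x) ->
  \int[P]_x f x <= \int[P]_x g x.
Proof. by move=> *; exact: le_Rintegral. Qed.

Lemma Ege0 f : (forall x, 0 <= f x) -> 0 <= \int[P]_x f x.
Proof. by move=> ?; apply: Rintegral_ge0. Qed.

Definition sqi f := measurable_fun setT f /\ integ (fun x => f x ^+ 2).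

Lemma sqi_mul f g : sqi f -> sqi g -> integ (fun x => f x * g x).
Proof.
move=> [mf f2] [mg g2]; apply: integ_le (integD f2 g2) _.
  exact: measurable_funM.
move=> x; rewrite normrM -(real_normK (num_real (f x))).
rewrite -(real_normK (num_real (g x))).
have := sqr_ge0 (`|f x| - `|g x|); have := sqr_ge0 (`|f x| + `|g x|).
by rewrite !expr2; lra.
Qed.

Lemma sqi_bdd f M : measurable_fun setT f -> (forall x, `|f x| <= M) -> sqi f.
Proof.
move=> mf fM; split => //; apply: (@integ_bdd _ (M ^+ 2)).
  exact: measurable_funX.
by move=> x; rewrite normrX lerXn2r ?nnegrE// (le_trans _ (fM x)).
Qed.

Lemma sqi_cst c : sqi (fun=> c).
Proof. exact: (@sqi_bdd _ `|c|). Qed.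

Lemma sqi_integ f : sqi f -> integ f.
Proof.
move=> sf; have := sqi_mul (sqi_cst 1) sf.
by rewrite (_ : (fun _ => _) = f)//; apply/funext => x; rewrite mul1r.
Qed.

Lemma sqiZ c f : sqi f -> sqi (fun x => c * f x).
Proof.
move=> [mf f2]; split; first exact: measurable_funM.
rewrite (_ : (fun _ => _) = (fun x => c ^+ 2 * f x ^+ 2)); first exact: integZ.
by apply/funext => x; rewrite exprMn.
Qed.

Lemma sqiD f g : sqi f -> sqi g -> sqi (fun x => f x + g x).
Proof.
move=> sf sg; case: (sf) (sg) => [mf f2] [mg g2]; split.
  exact: measurable_funD.
rewrite (_ : (fun _ => _) = (fun x => f x ^+ 2 + (2 * (f x * g x) + g x ^+ 2))).
  by apply: integD => //; apply: integD => //; apply: integZ; exact: sqi_mul.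
by apply/funext => x; ring.
Qed.

Lemma sqiN f : sqi f -> sqi (fun x => - f x).
Proof.
move=> /(sqiZ (-1)); rewrite (_ : (fun _ => _) = (fun x => - f x))//.
by apply/funext => x; rewrite mulN1r.
Qed.

Lemma sqiB f g : sqi f -> sqi g -> sqi (fun x => f x - g x).
Proof. by move=> sf sg; apply: sqiD => //; exact: sqiN. Qed.

Lemma E_CauchySchwarz f g : sqi f -> sqi g ->
  (\int[P]_x (f x * g x)) ^+ 2 <= \int[P]_x f x ^+ 2 * \int[P]_x g x ^+ 2.
Proof.
move=> sf sg.
set a := \int[P]_x f x ^+ 2; set b := \int[P]_x g x ^+ 2.
set m := \int[P]_x (f x * g x).
have a0 : 0 <= a by apply: Ege0 => x; exact: sqr_ge0.
have b0 : 0 <= b by apply: Ege0 => x; exact: sqr_ge0.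
have H (u v : R) : 0 <= u ^+ 2 * a + 2 * u * v * m + v ^+ 2 * b.
  have : 0 <= \int[P]_x (u * f x + v * g x) ^+ 2 by apply: Ege0 => x; exact: sqr_ge0.
  rewrite (_ : (fun x => _) = (fun x => u ^+ 2 * f x ^+ 2 +
     (2 * u * v * (f x * g x) + v ^+ 2 * g x ^+ 2))); last first.
    by apply/funext => x; ring.
  have i1 := sqi_mul sf sg; have i2 := sf.2; have i3 := sg.2.
  rewrite ED ?ED//; do ?[exact: integZ | apply: integD].
  by rewrite !EZ// addrA.
have [b00|bn0] := eqVneq b 0.
  have [->|m0] := eqVneq m 0; first by rewrite expr0n mulr_ge0.
  (* With b = 0 the form is affine in its second argument, and this argument makes it equal to
     -1. *)
  have := H 1 (- (a + 1) / (2 * m)); rewrite b00.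
  have -> : 1 ^+ 2 * a + 2 * 1 * (- (a + 1) / (2 * m)) * m +
    (- (a + 1) / (2 * m)) ^+ 2 * 0 = -1 by field.
  lra.
have bp : 0 < b by rewrite lt_def bn0.
have := H b (- m); rewrite -(@ler_pM2l _ b)//.
have -> : b ^+ 2 * a + 2 * b * - m * m + (- m) ^+ 2 * b = b * (a * b - m ^+ 2) by ring.
by rewrite pmulr_rge0// subr_ge0 ler_pM2l.
Qed.

Lemma E_abs_le f : sqi f -> (\int[P]_x `|f x|) ^+ 2 <= \int[P]_x f x ^+ 2.
Proof.
move=> sf; have sa : sqi (fun x => `|f x|).
  split; first by apply: measurableT_comp => //; exact: sf.1.
  rewrite (_ : (fun _ => _) = (fun x => f x ^+ 2)); first exact: sf.2.
  by apply/funext => x; rewrite real_normK ?num_real.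
have := E_CauchySchwarz sa (sqi_cst 1).
rewrite expr1n Ecst mulr1; under [X in X ^+ 2 <= _]eq_Rintegral do rewrite mulr1.
by under [leRHS]eq_Rintegral do rewrite real_normK ?num_real//.
Qed.

(** The integral of f^2 over |f| > n tends to 0 by dominated convergence, so [f] may be set to 0
    where it is large. *)
Lemma sqi_truncate f (e : R) : sqi f -> 0 < e ->
  exists2 M, 0 < M & exists g, [/\ measurable_fun setT g,
    forall x, `|g x| <= M & \int[P]_x (f x - g x) ^+ 2 <= e].
Proof.
move=> [mf f2] e0.
pose B (n : nat) := [set x | (n%:R < `|f x|)].
have mB n : measurable (B n).
  have mn : measurable_fun setT (fun x => `|f x|) by exact: measurableT_comp.
  have := mn measurableT _ (measurable_itv `]n%:R, +oo[); rewrite setTI.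
  by congr measurable; apply/seteqP; split=> x /=; rewrite in_itv/= andbT.
pose F n x := (f x ^+ 2 * \1_(B n) x)%:E.
have mF n : measurable_fun setT (F n).
  apply/measurable_EFinP; apply: measurable_funM; first exact: measurable_funX.
  exact: measurable_indic.
have := @dominated_convergence _ X R P setT measurableT F (cst 0%E)
  (fun x => (f x ^+ 2)%:E).
have domF : {ae P, forall x n, setT x -> (`|F n x| <= (f x ^+ 2)%:E)%E}.
  apply/nearW => x n _; rewrite /F /= lee_fin normrM ger0_norm ?sqr_ge0//.
  rewrite ler_piMr ?sqr_ge0// indicE; case: (x \in _); rewrite ?normr1 ?normr0//.
have cvgF : {ae P, forall x, setT x -> F ^~ x @ \oo --> (cst 0%E x : \bar R)}.
  apply/nearW => x _; apply: cvg_near_cst; near=> n.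
  rewrite /F indicE memNset ?mulr0// /B /=.
  apply/negP; rewrite -leNgt; near: n; exact: nbhs_infty_ger.
move=> /(_ mF (measurable_cst _) cvgF f2 domF) [_ _].
rewrite integral0_eq//.
move=> /fine_cvgP[_] /cvgrPdist_le /(_ _ e0) [N _ /(_ N (leqnn N))].
rewrite sub0r normrN => hN.
exists N.+1%:R; first by rewrite ltr0n.
exists (fun x => f x * \1_(~` B N) x); split.
- by apply: measurable_funM => //; apply: measurable_indic; exact: measurableC.
- move=> x; rewrite indicE; case: (boolP (x \in _)).
    rewrite inE /B /= => /negP; rewrite -leNgt mulr1 => /le_trans; apply.
    by rewrite ler_nat.
  by rewrite mulr0 normr0.
- apply: le_trans hN; rewrite le_eqVlt; apply/orP; left; apply/eqP.
  rewrite ger0_norm; last first.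
    rewrite fine_ge0// integral_ge0// => x _; rewrite /F lee_fin mulr_ge0 ?sqr_ge0//.
  congr fine; apply: eq_integral => x _; rewrite /F; congr EFin.
  rewrite !indicE in_setC; case: (x \in _) => /=; first by rewrite mulr0 subr0 mulr1.
  by rewrite mulr1 subrr expr0n mulr0.
Unshelve. all: by end_near. Qed.

Lemma measurable_min1 h : measurable_fun setT h ->
  measurable_fun setT (fun x => Num.min 1 `|h x|).
Proof. by move=> mh; apply: measurable_minr => //; exact: measurableT_comp. Qed.

Lemma min1_ge0 (x : R) : 0 <= Num.min 1 `|x|.
Proof. by rewrite le_min ler01 normr_ge0. Qed.

Lemma min1_le1 (x : R) : Num.min 1 `|x| <= 1.
Proof. by rewrite ge_min lexx. Qed.

Lemma min1_le (x : R) : Num.min 1 `|x| <= `|x|.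
Proof. by rewrite ge_min lexx orbT. Qed.

Lemma integ_sqr_min f h : sqi f -> measurable_fun setT h ->
  integ (fun x => f x ^+ 2 * Num.min 1 `|h x|).
Proof.
move=> [mf f2] mh; apply: integ_le f2 _.
  by apply: measurable_funM; [exact: measurable_funX|exact: measurable_min1].
move=> x; rewrite normrM (ger0_norm (sqr_ge0 _)) (ger0_norm (min1_ge0 _)).
by rewrite ler_piMr ?sqr_ge0 ?min1_le1.
Qed.

(** Split f^2 <= 2 (f - g)^2 + 2 g^2 and bound the minimum by 1 on the first part, by |h| on the
    second. With [g] a truncation of the limit of a sequence [f], this shows that truncated
    remainders are negligible. *)
Lemma E_sqr_min_le f g h M : sqi f -> measurable_fun setT g ->
  (forall x, `|g x| <= M) -> integ h ->
  \int[P]_x (f x ^+ 2 * Num.min 1 `|h x|)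
    <= 2 * \int[P]_x (f x - g x) ^+ 2 + 2 * M ^+ 2 * \int[P]_x `|h x|.
Proof.
move=> sf mg gM ih; have mh := integ_meas ih.
have ia := integ_abs ih.
have sg := sqi_bdd mg gM; have i2 := (sqiB sf sg).2.
rewrite -!EZ// -ED//; try exact: integZ.
apply: Ele; [exact: integ_sqr_min|by apply: integD; exact: integZ|move=> x].
have := min1_ge0 (h x); have := min1_le1 (h x); have := min1_le (h x).
set m := Num.min _ _ => m1 m2 m0.
have g2 : g x ^+ 2 <= M ^+ 2.
  by rewrite -(real_normK (num_real (g x))) lerXn2r ?nnegrE// (le_trans _ (gM x)).
have : f x ^+ 2 <= 2 * (f x - g x) ^+ 2 + 2 * g x ^+ 2.
  by have := sqr_ge0 (f x - 2 * g x); rewrite !expr2; lra.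
move=> /(ler_wpM2r m0)/le_trans; apply; rewrite mulrDl lerD//.
  by rewrite ler_piMr// mulr_ge0 ?sqr_ge0.
rewrite -[leLHS]mulrA -[leRHS]mulrA ler_pM2l//; apply: le_trans (ler_wpM2l (sqr_ge0 (g x)) m1) _.
by rewrite ler_wpM2r.
Qed.

End expectation.
Arguments integ {d X R} P f.
Arguments sqi {d X R} P f.

(** * Recursion on the sample size *)

Section iid_power_recursion.
Context {d : measure_display} {X : measurableType d} {R : realType}.
Implicit Types P Q : probability X R.

Definition iid_pr P n (A : set (n.-tuple X)) : R := fine (iid_power P n A).

Definition tsection n (A : set (n.+1.-tuple X)) (x : X) : set (n.-tuple X) :=
  [set y | A (tuple_cons (x, y))].

Lemma iid_prE P n (A : set (n.-tuple X)) : measurable A ->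
  iid_power P n A = (iid_pr P A)%:E.
Proof. by move=> mA; rewrite fineK// fin_num_measure. Qed.

Lemma iid_pr_ge0 P n (A : set (n.-tuple X)) : 0 <= iid_pr P A.
Proof. exact: fine_ge0. Qed.

Lemma iid_pr_le1 P n (A : set (n.-tuple X)) : measurable A -> iid_pr P A <= 1.
Proof. by move=> mA; rewrite -lee_fin -iid_prE// probability_le1. Qed.

Lemma iid_prC P n (A : set (n.-tuple X)) : measurable A ->
  iid_pr P (~` A) = 1 - iid_pr P A.
Proof.
move=> mA; have mCA := measurableC mA; apply: EFin_inj.
by rewrite -iid_prE// probability_setC// iid_prE.
Qed.

Lemma le_iid_pr P n (A B : set (n.-tuple X)) : measurable A -> measurable B ->
  A `<=` B -> iid_pr P A <= iid_pr P B.
Proof.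
by move=> mA mB AB; rewrite -lee_fin -!iid_prE// le_measure// inE.
Qed.

Lemma iid_prU_le P n (A B : set (n.-tuple X)) : measurable A -> measurable B ->
  iid_pr P (A `|` B) <= iid_pr P A + iid_pr P B.
Proof.
move=> mA mB; have mAB := measurableU _ _ mA mB.
by rewrite -lee_fin EFinD -!iid_prE// measureU2.
Qed.

Lemma iid_pr0 P (A : set (0.-tuple X)) : iid_pr P A = \1_A [tuple].
Proof.
have -> : iid_pr P A = fine (dirac (R := R) [tuple] A) by [].
by rewrite diracE indicE.
Qed.

Lemma measurable_tuple_cons_preimage n (A : set (n.+1.-tuple X)) :
  measurable A -> measurable (@tuple_cons d X n @^-1` A).
Proof.
by move=> mA; rewrite -[X in measurable X]setTI; exact: measurable_tuple_cons.
Qed.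

Lemma tsectionE n (A : set (n.+1.-tuple X)) x :
  tsection A x = xsection (@tuple_cons d X n @^-1` A) x.
Proof. by apply/seteqP; split=> y; rewrite /xsection/= inE. Qed.

Lemma measurable_tsection n (A : set (n.+1.-tuple X)) x : measurable A ->
  measurable (tsection A x).
Proof.
move=> mA; rewrite tsectionE; apply: measurable_xsection.
exact: measurable_tuple_cons_preimage.
Qed.

Lemma measurable_iid_pr_tsection P n (A : set (n.+1.-tuple X)) : measurable A ->
  measurable_fun setT (fun x => iid_pr P (tsection A x)).
Proof.
move=> mA; have mA' := measurable_tuple_cons_preimage mA.
apply/measurable_EFinP.
rewrite (_ : _ \o _ = iid_power P n \o xsection (@tuple_cons d X n @^-1` A)).
  exact: measurable_fun_xsection.
apply/funext => x /=; rewrite -tsectionE -iid_prE//.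
exact: measurable_tsection.
Qed.

(** Conditioning on the first observation; each induction on the sample size takes its step here. *)
Lemma iid_prS P n (A : set (n.+1.-tuple X)) : measurable A ->
  iid_pr P A = \int[P]_x iid_pr P (tsection A x).
Proof.
move=> mA; rewrite /iid_pr /= /distribution /pushforward /product_measure1.
congr fine; apply: eq_integral => x _ /=.
by rewrite -tsectionE -iid_prE//; exact: measurable_tsection.
Qed.

Lemma iid_pr_tsection_bounds P n (A : set (n.+1.-tuple X)) x : measurable A ->
  0 <= iid_pr P (tsection A x) <= 1.
Proof.
by move=> mA; rewrite iid_pr_ge0 iid_pr_le1//; exact: measurable_tsection.
Qed.

Lemma integ_iid_pr_tsection P Q n (A : set (n.+1.-tuple X)) : measurable A ->
  integ P (fun x => iid_pr Q (tsection A x)).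
Proof.
move=> mA; apply: (@integ_bdd _ _ _ _ _ 1).
  exact: measurable_iid_pr_tsection.
move=> x; have /andP[h1 h2] := iid_pr_tsection_bounds Q x mA.
by rewrite ger0_norm.
Qed.

End iid_power_recursion.

(** * Test bounds by the Black-Scholes recursion *)

Section quasi_density.
Context {d : measure_display} {X : measurableType d} {R : realType}.
Implicit Types (P Q : probability X R) (W f : X -> R) (e : R).

(* [(1 + W)^2] is, up to mass [e], the density of [Q] with respect to [P]. *)
Definition quasi_density P Q W e := [/\ sqi P W, forall x, -1 <= W x &
  forall f, measurable_fun setT f -> (forall x, 0 <= f x <= 1) ->
    \int[P]_x (f x * (1 + W x) ^+ 2) <= \int[Q]_x f x
      <= \int[P]_x (f x * (1 + W x) ^+ 2) + e].

Lemma quasi_density_self P : quasi_density P P (fun=> 0) 0.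
Proof.
split; first exact: sqi_cst.
  by move=> x; rewrite oppr_le0.
move=> f mf f01; under eq_Rintegral do rewrite addr0 expr1n mulr1.
by rewrite addr0 lexx.
Qed.

(** Testing with f = 1 shows that (1 + W)^2 has mass between 1 - e and 1. This controls the
    first-order terms of the recursions: the mean of [W] is of the order of its second moment and
    [e]. *)
Lemma quasi_density_mass P Q W e : quasi_density P Q W e ->
  - e <= \int[P]_x (2 * W x + W x ^+ 2) <= 0.
Proof.
move=> [sW _ /(_ (fun=> 1) (measurable_cst _))].
rewrite ler01 lexx => /(_ (fun=> isT)).
rewrite Ecst (_ : (fun x => 1 * _) = (fun x => 1 + (2 * W x + W x ^+ 2))); last first.
  by apply/funext => x; ring.
have i1 := integZ 2 (sqi_integ sW); have i2 := sW.2.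
rewrite ED ?Ecst//; [|exact: integ_cst|exact: integD].
by move=> /andP[h1 h2]; apply/andP; split; lra.
Qed.

Lemma measurable_ncdf_comp f : measurable_fun setT f ->
  measurable_fun setT (fun x => ncdf (f x)).
Proof.
move=> mf; apply: (measurableT_comp _ mf).
apply: continuous_measurable_fun; exact: ncdf_continuous.
Qed.

Lemma measurable_put s f : measurable_fun setT f ->
  measurable_fun setT (fun x => put s (f x)).
Proof.
move=> mf; rewrite /put.
have mln : measurable_fun setT (fun x => ln (f x)) by exact: measurableT_comp.
apply: measurable_fun_ifT.
- by apply: measurable_fun_ltr.
- apply: measurable_funB; last apply: measurable_funM => //;
  apply: measurable_ncdf_comp; apply: measurable_funB => //;
  exact: measurable_funM.
- exact: measurable_cst.
Qed.

(* One step of the Black-Scholes recursion: the variance grows by [4 E W^2]. *)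
Lemma put_recursion_le P Q W e (b C s s' l : R) : 0 < b -> 0 <= C ->
  put_step_bound b C ->
  quasi_density P Q W e -> b <= s -> s <= s' ->
  s' ^+ 2 = s ^+ 2 + 4 * \int[P]_x W x ^+ 2 -> 0 <= l ->
  \int[P]_x put s (l * (1 + W x) ^+ 2) <= put s' l +
    (e + C * (\int[P]_x (W x ^+ 2 * Num.min 1 `|W x|)
              + (4 * \int[P]_x W x ^+ 2) ^+ 2)).
Proof.
move=> b0 C0 hC qd bs ss' es; have [sW W1 _] := qd.
have /andP[mass _] := quasi_density_mass qd.
have mW := sW.1; have W2 := sW.2.
have e0 : 0 <= e.
  by have := quasi_density_mass qd => /andP[]; lra.
have im := integ_sqr_min sW mW.
have m0 : 0 <= \int[P]_x (W x ^+ 2 * Num.min 1 `|W x|).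
  by apply: Ege0 => x; rewrite mulr_ge0 ?sqr_ge0 ?min1_ge0.
have s0 : 0 < s by rewrite (lt_le_trans b0).
(* A spot of 0 stays at 0 and the price stays at 1, so the claim reduces to the nonnegativity of the
   error term. *)
rewrite le_eqVlt => /predU1P[<-|l0].
  under eq_Rintegral do rewrite mul0r /put ltxx.
  by rewrite /put ltxx Ecst lerDl addr_ge0// mulr_ge0// addr_ge0// sqr_ge0.
have et : s' ^+ 2 - s ^+ 2 = 4 * \int[P]_x W x ^+ 2 by rewrite es; ring.
have := fun w => hC s s' l w bs ss' l0; rewrite et.
set t := 4 * \int[P]_x W x ^+ 2.
set D := l * _; set q := npdf _ / _ => hC'.
have [D0 D1] := andP (put_delta_bound s0 l0).
have i1 := integZ 2 (sqi_integ sW).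
have i12 := integD i1 W2.
have i3 : integ P (fun x => put s (l * (1 + W x) ^+ 2)).
  apply: (@integ_bdd _ _ _ _ _ 1); last first.
    by move=> x; rewrite ger0_norm ?put_ge0 ?put_le1.
  apply: measurable_put; apply: measurable_funM => //; apply: measurable_funX.
  exact: measurable_funD.
apply: (@le_trans _ _ (\int[P]_x (((put s' l - D * (2 * W x + W x ^+ 2))
    + q * (4 * W x ^+ 2 - t)) + C * (W x ^+ 2 * Num.min 1 `|W x| + t ^+ 2)))).
  apply: Ele => //.
    apply: integD; first apply: integD.
    - by apply: integB; [exact: integ_cst|exact: integZ].
    - by apply/integZ/integB; [exact: integZ|exact: integ_cst].
    - by apply/integZ/integD; [|exact: integ_cst].
  move=> x; have := hC' (W x) (W1 x); rewrite ler_norml => /andP[_]; lra.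
have ic c : integ P (fun=> c) by exact: integ_cst.
have j1 := integZ D i12; have j2 := integB (integZ 4 W2) (ic t).
have j3 := integD im (ic (t ^+ 2)).
rewrite ED; [|by apply: integD; [exact: integB|exact: integZ]|exact: integZ].
rewrite ED; [|exact: integB|exact: integZ].
rewrite EB// !EZ// EB//; last exact: integZ.
rewrite (ED im (ic (t ^+ 2))) (EZ 4 W2) !Ecst subrr mulr0 addr0.
rewrite [in leRHS]addrA lerD2r lerD2l.
rewrite -/t.
(* The second-order term has integrated to 0 by the choice of [s']; what is left is the delta term,
   at most D e <= e because the lost mass is at most [e]. *)
have : D * (- e) <= D * \int[P]_x (2 * W x + W x ^+ 2) by rewrite ler_wpM2l.
have : D * e <= e by rewrite ler_piMl.
lra.
Qed.

(** Given the first observation x, the problem for the remaining ones is the same with [l] replaced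
    by l (1 + W x)^2, hence the induction for all [l]. The probability under [Q] enters with the
    factor - l, so its lower bound by (1 + W)^2 is the right one, and a singular part of [Q] does no
    harm. *)
Lemma Neyman_Pearson_put P Q W e (b C tau eps : R) : 0 < b -> 0 <= C ->
  put_step_bound b C ->
  quasi_density P Q W e ->
  tau = 4 * \int[P]_x W x ^+ 2 ->
  eps = e + C * (\int[P]_x (W x ^+ 2 * Num.min 1 `|W x|) + tau ^+ 2) ->
  forall n (A : set (n.-tuple X)) l, measurable A -> 0 <= l ->
  iid_pr P A - l * iid_pr Q A <= put (Num.sqrt (b ^+ 2 + n%:R * tau)) l + n%:R * eps.
Proof.
move=> b0 C0 hC qd et ee; have [sW W1 hf] := qd.
have tau0 : 0 <= tau by rewrite et mulr_ge0// Ege0// => x; exact: sqr_ge0.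
have bsn n : b <= Num.sqrt (b ^+ 2 + n%:R * tau).
  rewrite -[leLHS]ger0_norm ?(ltW b0)// -sqrtr_sqr ler_wsqrtr//.
  by rewrite lerDl mulr_ge0.
elim=> [|n IHn] A l mA l0.
  (* Without observations the left side is 0 or 1 - l, both below the price at volatility [b]. *)
  rewrite !mul0r !addr0 sqrtr_sqr ger0_norm ?(ltW b0)// !iid_pr0.
  rewrite -[X in X - _]mul1r -mulrBl.
  have [h1 h2] : 0 <= put b l /\ 1 - l <= put b l.
    split; first exact: put_ge0.
    move: l0; rewrite le_eqVlt => /predU1P[<-|l0]; first by rewrite /put ltxx subr0.
    by have [] := put_ge_payoff b0 l0.
  by rewrite indicE; case: (_ \in _); rewrite ?mulr1 ?mulr0.
rewrite !iid_prS//.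
set p := fun x => iid_pr P (tsection A x); set q := fun x => iid_pr Q (tsection A x).
have mq : measurable_fun setT q by exact: measurable_iid_pr_tsection.
have q01 x : 0 <= q x <= 1 by exact: iid_pr_tsection_bounds.
have /andP[hq _] := hf q mq q01.
have ip : integ P p by exact: integ_iid_pr_tsection.
have s1W : sqi P (fun x => 1 + W x) by apply: sqiD => //; exact: sqi_cst.
have iq : integ P (fun x => q x * (1 + W x) ^+ 2).
  apply: integ_le s1W.2 _.
    by apply: measurable_funM => //; apply: measurable_funX; exact: s1W.1.
  move=> x; have /andP[q0 q1] := q01 x.
  by rewrite (ger0_norm (mulr_ge0 q0 (sqr_ge0 _))) ler_piMl ?sqr_ge0.
set s := Num.sqrt (b ^+ 2 + n%:R * tau).
set s' := Num.sqrt (b ^+ 2 + n.+1%:R * tau).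
have ss' : s <= s'.
  by rewrite ler_wsqrtr// lerD2l ler_wpM2r// ler_nat.
have es : s' ^+ 2 = s ^+ 2 + tau.
  rewrite !sqr_sqrtr ?addr_ge0 ?sqr_ge0 ?mulr_ge0//.
  by rewrite -natr1; ring.
have i3 : integ P (fun x => put s (l * (1 + W x) ^+ 2)).
  apply: (@integ_bdd _ _ _ _ _ 1); last first.
    by move=> x; rewrite ger0_norm ?put_ge0 ?put_le1// (lt_le_trans b0 (bsn n)).
  apply: measurable_put; apply: measurable_funM => //; apply: measurable_funX.
  exact: s1W.1.
have rec := put_recursion_le b0 C0 hC qd (bsn n) ss' _ l0.
rewrite -et -ee in rec; have {}rec := rec es.
apply: (@le_trans _ _ (\int[P]_x (p x - l * (q x * (1 + W x) ^+ 2)))).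
  rewrite EB//; last exact: integZ.
  by rewrite EZ// lerB// ler_wpM2l.
apply: (@le_trans _ _ (\int[P]_x (put s (l * (1 + W x) ^+ 2) + n%:R * eps))).
  apply: Ele.
  - by apply: integB => //; exact: integZ.
  - by apply: integD => //; exact: integ_cst.
  - move=> x; rewrite mulrA mulrAC; apply: IHn; first exact: measurable_tsection.
    by rewrite mulr_ge0// sqr_ge0.
rewrite ED ?Ecst//; last exact: integ_cst.
rewrite -natr1 mulrDl mul1r; lra.
Qed.

End quasi_density.

(** * Sums under the alternative: the heat equation recursion *)

Section normal_recursion.
Context {d : measure_display} {X : measurableType d} {R : realType}.
Implicit Types (P Q : probability X R) (W h : X -> R).

(** A Lindeberg step with increment [u] of the sum, weighted by the density (1 + w)^2. The cross
    term in u w is kept exactly, as it produces the drift. A lower bound is enough, since upper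
    bounds come from reversing signs. *)
Definition ncdf_step_bound (b C : R) :=
  forall s s' y u w : R, b <= s -> s <= s' ->
  ncdf (y / s') + npdf (y / s) / s * u
    - (y / s * npdf (y / s)) / (2 * s ^+ 2) * (u ^+ 2 - (s' ^+ 2 - s ^+ 2))
    + ncdf (y / s) * (2 * w + w ^+ 2) + 2 * (npdf (y / s) / s) * (u * w)
    - C * (u ^+ 2 * Num.min 1 `|u| + (s' ^+ 2 - s ^+ 2) ^+ 2
           + `|w * (u * Num.min 1 `|u|)| + w ^+ 2 * Num.min 1 `|u|)
  <= ncdf ((y + u) / s) * (1 + w) ^+ 2 /\
  `|npdf (y / s) / s| <= C /\ `|(y / s * npdf (y / s)) / (2 * s ^+ 2)| <= C.

Lemma ncdf_density_step_le (b : R) : 0 < b -> exists2 C, 0 <= C &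
  ncdf_step_bound b C.
Proof.
move=> b0; set c := 1 + b^-1.
(* 18 = 2 (8 + 1): the cross term carries a 2, and its error the 8 of [ncdf_taylor_le] plus 1 for
   the quadratic term. It also exceeds the 14 of [ncdf_step_le]. *)
have [K K18] : exists K : R, K = 18 by exists 18.
have K0 : 0 <= K by lra.
have c1 : 1 <= c by rewrite /c lerDl invr_ge0 ltW.
have c0 : 0 < c by rewrite (lt_le_trans _ c1).
have cc j k : (j <= k)%N -> c ^+ j <= c ^+ k by move=> jk; rewrite ler_weXn2l.
exists (K * c ^+ 5); first by rewrite mulr_ge0// exprn_ge0// ltW.
move=> s s' y u w bs ss'; have s0 : 0 < s by rewrite (lt_le_trans b0).
have i0 : 0 < s^-1 by rewrite invr_gt0.
have ic : s^-1 <= c.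
  by rewrite /c (@le_trans _ _ b^-1)// ?lef_pV2 ?posrE// lerDr.
have k1 := ncdf_step_le y u b0 bs ss'.
have k2 := ncdf_taylor_le y u b0 bs.
rewrite -/c in k1 k2.
set p := npdf (y / s) / s in k1 k2 *.
set q := y / s * _ / _ in k1 k2 *.
set t := s' ^+ 2 - s ^+ 2 in k1 *.
have pc : `|p| <= c.
  rewrite ger0_norm ?divr_ge0 ?npdf_ge0 ?(ltW s0)//.
  by rewrite (le_trans _ ic)// ler_piMl ?npdf_le1// ltW.
have qc : `|q| <= c ^+ 2.
  rewrite /q (_ : _ / _ = (y / s * npdf (y / s) / 2) * s^-1 ^+ 2); last first.
    by field; rewrite gt_eqF.
  rewrite normrM [X in _ * X]ger0_norm ?exprn_ge0 ?(ltW i0)//.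
  rewrite -[leRHS]mul1r ler_pM ?exprn_ge0 ?(ltW i0)//.
    rewrite normrM (@ger0_norm _ 2^-1)// normrM (ger0_norm (npdf_ge0 _)).
    by have := npdf_abs_le (y / s); lra.
  by rewrite lerXn2r ?nnegrE ?(ltW i0) ?(ltW c0).
have c15 := cc 1%N 5%N isT; have c25 := cc 2%N 5%N isT; have c35 := cc 3%N 5%N isT.
rewrite expr1 in c15.
have C5 : c ^+ 5 <= K * c ^+ 5.
  by rewrite ler_peMl ?exprn_ge0 ?(ltW c0)//; lra.
split; last by split; [exact/(le_trans pc)/(le_trans c15)|exact/(le_trans qc)/(le_trans c25)].
set m := Num.min 1 `|u| in k1 k2 *.
have m0 : 0 <= m by exact: min1_ge0.
set psi := ncdf ((y + u) / s) - ncdf (y / s).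
have psi1 : `|psi| <= c * m.
  rewrite /m; case: (leP 1 `|u|) => u1.
    rewrite mulr1 (le_trans _ c1)// ler_norml /psi.
    have := ncdf_ge0 ((y + u) / s); have := ncdf_ge0 (y / s).
    by have := ncdf_le1 ((y + u) / s); have := ncdf_le1 (y / s); lra.
  apply: le_trans (ncdf_lip _ _) _.
  rewrite (_ : (y + u) / s - y / s = s^-1 * u); last by field; rewrite gt_eqF.
  by rewrite normrM ger0_norm ?(ltW i0)// ler_wpM2r.
(* Against the factor [w] a first-order expansion suffices, and against w^2 the bound [psi1]; both
   keep a factor min(1, |u|), which makes them negligible. *)
have psi2 : `|psi - p * u| <= 9 * c ^+ 3 * `|u * m|.
  rewrite [`|u * m|]normrM (ger0_norm m0).
  have um0 : 0 <= `|u| * m by rewrite mulr_ge0.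
  have c13 := cc 1%N 3%N isT; have c23 := cc 2%N 3%N isT; rewrite expr1 in c13.
  have [u1|u1] := leP `|u| 1.
    have mu : m = `|u| by rewrite /m; apply/min_idPr.
    have uu : u ^+ 2 = `|u| * m by rewrite mu -expr2 real_normK ?num_real.
    have m1 : m <= 1 by exact: min1_le1.
    rewrite (_ : psi - p * u = (psi - p * u + q * u ^+ 2) - q * u ^+ 2); last by ring.
    apply: le_trans (ler_normB _ _) _.
    have h1 : `|q * u ^+ 2| <= c ^+ 3 * (`|u| * m).
      rewrite normrM (ger0_norm (sqr_ge0 u)) uu ler_wpM2r//.
      exact: le_trans c23.
    have h2 : 8 * c ^+ 3 * (u ^+ 2 * m) <= 8 * c ^+ 3 * (`|u| * m).
      rewrite uu ler_wpM2l ?ler_piMr//.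
      by have := exprn_ge0 3 (ltW c0); lra.
    by have := le_trans k2 h2; rewrite -/psi; lra.
  have mu : m = 1 by rewrite /m; apply/min_idPl/ltW.
  apply: le_trans (ler_normB _ _) _; rewrite normrM mu mulr1.
  have := ler_wpM2r (normr_ge0 u) pc; move: psi1; rewrite mu mulr1.
  have := ler_wpM2r (normr_ge0 u) c13; have := exprn_ge0 3 (ltW c0).
  move: (c ^+ 3) => c3 c30 h1 h2 h3.
  have : c <= c * `|u| by rewrite ler_peMr ?(ltW c0)// ltW.
  have : 0 <= c3 * `|u| by rewrite mulr_ge0.
  lra.
have e1 : ncdf ((y + u) / s) * (1 + w) ^+ 2 = ncdf ((y + u) / s) +
    ncdf (y / s) * (2 * w + w ^+ 2) + 2 * p * (u * w) + 2 * ((psi - p * u) * w)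
    + psi * w ^+ 2 by rewrite /psi; ring.
rewrite e1.
have h2 : `|2 * ((psi - p * u) * w)| <= 18 * c ^+ 5 * `|w * (u * m)|.
  rewrite normrM [`|2|]ger0_norm// normrM [`|w * _|]normrM.
  have := ler_wpM2r (normr_ge0 w) psi2.
  have : c ^+ 3 * (`|u * m| * `|w|) <= c ^+ 5 * (`|u * m| * `|w|).
    by rewrite ler_wpM2r// mulr_ge0.
  lra.
have h3 : `|psi * w ^+ 2| <= c ^+ 5 * (w ^+ 2 * m).
  rewrite normrM (ger0_norm (sqr_ge0 w)).
  have := ler_wpM2r (sqr_ge0 w) psi1.
  have : c * (w ^+ 2 * m) <= c ^+ 5 * (w ^+ 2 * m).
    by rewrite ler_wpM2r// mulr_ge0// sqr_ge0.
  lra.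
have wm0 : 0 <= c ^+ 5 * (w ^+ 2 * m).
  by rewrite mulr_ge0 ?exprn_ge0 ?(ltW c0)// mulr_ge0 ?sqr_ge0.
have um0 : 0 <= c ^+ 5 * (u ^+ 2 * m + t ^+ 2).
  rewrite mulr_ge0 ?exprn_ge0 ?(ltW c0)// addr_ge0 ?sqr_ge0//.
  by rewrite mulr_ge0 ?sqr_ge0.
move: h2 h3 k1; rewrite !ler_norml => /andP[h2 _] /andP[h3 _] /andP[h4 _].
rewrite K18; move: (ncdf ((y + u) / s)) (ncdf (y / s')) (c ^+ 5) h2 h3 h4 wm0 um0.
move: (psi * w ^+ 2) ((psi - p * u) * w) `|w * (u * m)| => x1 x2 x3.
move=> {k2 psi2 e1 c25 c35 c15 qc pc cc C5} x4 x5 x6 *; lra.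
Qed.

(** To first order [a] is the mean of [h] under (1 + W)^2 dP. Expanding about z + a, the linear term
    has mean - p a under [P], and the cross term 2 p E(u W) = p a - 2 p a E W cancels it; only a^2
    and a E W survive, as errors. *)
Lemma normal_recursion_ge P Q W e h (b C s s' : R) : 0 < b -> 0 <= C ->
  ncdf_step_bound b C ->
  quasi_density P Q W e -> sqi P h -> \int[P]_x h x = 0 ->
  b <= s -> s <= s' -> s' ^+ 2 = s ^+ 2 + \int[P]_x h x ^+ 2 ->
  let a := 2 * \int[P]_x (h x * W x) in
  let u x := h x - a in
  forall z, ncdf ((z + a) / s') -
    (e + C * (\int[P]_x (u x ^+ 2 * Num.min 1 `|u x|)
       + (\int[P]_x h x ^+ 2) ^+ 2
       + \int[P]_x `|W x * (u x * Num.min 1 `|u x|)|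
       + \int[P]_x (W x ^+ 2 * Num.min 1 `|u x|)
       + a ^+ 2 + 2 * `|a * \int[P]_x W x|))
  <= \int[Q]_x ncdf ((z + h x) / s).
Proof.
move=> b0 C0 hC qd sh h0 bs ss' es a u z; have [sW W1 hf] := qd.
have /andP[mass _] := quasi_density_mass qd.
have s0 : 0 < s by rewrite (lt_le_trans b0).
have mh := sh.1; have h2 := sh.2; have W2 := sW.2.
have ic c : integ P (fun=> c) by exact: integ_cst.
have su : sqi P u by apply: sqiB => //; exact: sqi_cst.
have mF : measurable_fun setT (fun x => ncdf ((z + h x) / s)).
  apply: measurable_ncdf_comp; apply: measurable_funM => //.
  exact: measurable_funD.
have F01 x : 0 <= ncdf ((z + h x) / s) <= 1 by rewrite ncdf_ge0 ncdf_le1.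
have /andP[+ _] := hf _ mF F01; apply: le_trans.
pose y := z + a.
have et : s' ^+ 2 - s ^+ 2 = \int[P]_x h x ^+ 2 by rewrite es; ring.
have pw := fun u w => hC s s' y u w bs ss'; rewrite et in pw.
set t := \int[P]_x h x ^+ 2 in pw et *.
set p := npdf (y / s) / s in pw; set q := _ / (2 * s ^+ 2) in pw.
have [_ [pC qC]] := pw 0 0.
have s1W : sqi P (fun x => 1 + W x) by apply: sqiD => //; exact: sqi_cst.
have iF : integ P (fun x => ncdf ((z + h x) / s) * (1 + W x) ^+ 2).
  apply: integ_le s1W.2 _.
    by apply: measurable_funM => //; apply: measurable_funX; exact: s1W.1.
  move=> x; have /andP[q0 q1] := F01 x.
  by rewrite (ger0_norm (mulr_ge0 q0 (sqr_ge0 _))) ler_piMl ?sqr_ge0.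
have iu := sqi_integ su; have iW := sqi_integ sW; have ih := sqi_integ sh.
have i1 : integ P (fun x => u x ^+ 2 * Num.min 1 `|u x|).
  exact: integ_sqr_min su su.1.
have i2 : integ P (fun x => W x ^+ 2 * Num.min 1 `|u x|).
  exact: integ_sqr_min sW su.1.
have sum : sqi P (fun x => u x * Num.min 1 `|u x|).
  split; first by apply: measurable_funM; [exact: su.1|exact/measurable_min1/su.1].
  apply: integ_le su.2 _.
    apply: measurable_funX.
    by apply: measurable_funM; [exact: su.1|exact/measurable_min1/su.1].
  move=> x; rewrite (ger0_norm (sqr_ge0 _)) exprMn ler_piMr ?sqr_ge0//.
have i3 : integ P (fun x => `|W x * (u x * Num.min 1 `|u x|)|).
  exact/integ_abs/sqi_mul.
have iuW := sqi_mul su sW.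
have iWW : integ P (fun x => 2 * W x + W x ^+ 2) by apply: integD => //; exact: integZ.
have := @Ele _ _ _ P (fun x => ((((ncdf (y / s') + p * u x) - q * (u x ^+ 2 - t))
  + ncdf (y / s) * (2 * W x + W x ^+ 2)) + 2 * p * (u x * W x))
  - C * (((u x ^+ 2 * Num.min 1 `|u x| + t ^+ 2)
           + `|W x * (u x * Num.min 1 `|u x|)|) + W x ^+ 2 * Num.min 1 `|u x|))
  (fun x => ncdf ((z + h x) / s) * (1 + W x) ^+ 2).
have j1 := integZ p iu; have j2 := integB su.2 (ic t); have j3 := integZ q j2.
have j4 := integZ (ncdf (y / s)) iWW; have j5 := integZ (2 * p) iuW.
have j6 := integD i1 (ic (t ^+ 2)); have j7 := integD j6 i3; have j8 := integD j7 i2.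
have j9 := integZ C j8.
have l1 := integD (ic (ncdf (y / s'))) j1; have l2 := integB l1 j3.
have l3 := integD l2 j4; have l4 := integD l3 j5; have l5 := integB l4 j9.
move=> /(_ l5 iF).
have zy x : z + h x = y + u x by rewrite /y /u; ring.
have pwx x := (pw (u x) (W x)).1.
move=> /(_ (fun x => _)) H; apply: le_trans (H _); last first.
  by move=> x; rewrite zy; exact: pwx.
rewrite (EB l4 j9) (ED l3 j5) (ED l2 j4) (EB l1 j3) (ED (ic _) j1).
rewrite (EZ _ j8) (ED j7 i2) (ED j6 i3) (ED i1 (ic _)).
rewrite (EZ _ iuW) (EZ _ iWW) (EZ _ j2) (EB su.2 (ic _)) (EZ _ iu) !Ecst.
have Eu : \int[P]_x u x = - a.
  by rewrite /u (EB ih (ic _)) h0 Ecst sub0r.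
have Eu2 : \int[P]_x u x ^+ 2 = t + a ^+ 2.
  rewrite (_ : (fun x => u x ^+ 2) = (fun x => (h x ^+ 2 - 2 * a * h x) + a ^+ 2)).
    by rewrite ED ?EB ?EZ ?Ecst ?h0 ?mulr0 ?subr0//;
       [exact: integZ|apply: integB => //; exact: integZ].
  by apply/funext => x; rewrite /u; ring.
have EuW : \int[P]_x (u x * W x) = a / 2 - a * \int[P]_x W x.
  rewrite (_ : (fun x => u x * W x) = (fun x => h x * W x - a * W x)).
    rewrite EB ?EZ//; [by rewrite /a; lra|exact: sqi_mul|exact: integZ].
  by apply/funext => x; rewrite /u; ring.
rewrite Eu Eu2 EuW.
have e0 : 0 <= e by have := quasi_density_mass qd => /andP[]; lra.
have m1 : - e <= ncdf (y / s) * \int[P]_x (2 * W x + W x ^+ 2).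
  have := ler_wpM2l (ncdf_ge0 (y / s)) mass.
  by have := ler_piMl e0 (ncdf_le1 (y / s)); lra.
have m2 : q * a ^+ 2 <= C * a ^+ 2.
  by rewrite ler_wpM2r ?sqr_ge0// (le_trans (ler_norm _)).
have m3 : p * (a * \int[P]_x W x) <= C * `|a * \int[P]_x W x|.
  by rewrite (le_trans (ler_norm _))// normrM ler_wpM2r.
rewrite -/y; lra.
Qed.

Definition tsum n h (x : n.-tuple X) : R := \sum_(i < n) h (tnth x i).

Lemma tsum_cons n h x (y : n.-tuple X) :
  tsum h (tuple_cons (x, y)) = h x + tsum h y.
Proof.
rewrite /tsum big_ord_recl tnth0; congr (_ + _).
by apply: eq_bigr => i _; rewrite tnthS.
Qed.

Lemma measurable_tsum n h : measurable_fun setT h ->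
  measurable_fun setT (@tsum n h).
Proof.
move=> mh; apply: measurable_sum => i.
exact: (measurableT_comp mh (measurable_tnth i)).
Qed.

Lemma measurable_tsum_gt n h (z c : R) : measurable_fun setT h ->
  measurable [set x : n.-tuple X | c < z + tsum h x].
Proof.
move=> mh.
have mf : measurable_fun setT (fun x : n.-tuple X => z + tsum h x).
  by apply: measurable_funD => //; exact: measurable_tsum.
have := mf measurableT _ (measurable_itv `]c, +oo[); rewrite setTI.
by congr measurable; apply/seteqP; split=> x /=; rewrite in_itv/= andbT.
Qed.

(** For n = 0 the indicator of c < z has to dominate a smooth function: [ncdf ((z - c - delta) / b)]
    is at most 1, and for z <= c at most [ncdf (- delta / b)], which is subtracted. The offset [z]
    carries the part of the sum already observed. *)
Lemma iid_sum_gt_ge P Q W e h (b C delta tau a eps : R) : 0 < b -> 0 <= C ->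
  ncdf_step_bound b C ->
  quasi_density P Q W e -> sqi P h -> \int[P]_x h x = 0 ->
  tau = \int[P]_x h x ^+ 2 ->
  a = 2 * \int[P]_x (h x * W x) ->
  eps = e + C * (\int[P]_x ((h x - a) ^+ 2 * Num.min 1 `|h x - a|)
       + tau ^+ 2
       + \int[P]_x `|W x * ((h x - a) * Num.min 1 `|h x - a|)|
       + \int[P]_x (W x ^+ 2 * Num.min 1 `|h x - a|)
       + a ^+ 2 + 2 * `|a * \int[P]_x W x|) ->
  forall n c z,
  ncdf ((z + n%:R * a - c - delta) / Num.sqrt (b ^+ 2 + n%:R * tau))
    - ncdf (- delta / b) - n%:R * eps
  <= iid_pr Q [set x : n.-tuple X | c < z + tsum h x].
Proof.
move=> b0 C0 hC qd sh h0 et ea ee n c.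
have tau0 : 0 <= tau by rewrite et Ege0// => x; exact: sqr_ge0.
have bsn k : b <= Num.sqrt (b ^+ 2 + k%:R * tau).
  rewrite -[leLHS]ger0_norm ?(ltW b0)// -sqrtr_sqr ler_wsqrtr//.
  by rewrite lerDl mulr_ge0.
elim: n => [|n IHn] z.
  rewrite !mul0r !addr0 subr0 sqrtr_sqr ger0_norm ?(ltW b0)// iid_pr0 indicE.
  case: (boolP (_ \in _)) => [_|].
    rewrite mulr1n; have := ncdf_le1 ((z - c - delta) / b); have := ncdf_ge0 (- delta / b); lra.
  rewrite notin_setE /= /tsum big_ord0 addr0 => /negP; rewrite -leNgt => zc.
  rewrite subr_le0 ncdf_nd// ler_pM2r ?invr_gt0//; lra.
have mh := sh.1.
rewrite iid_prS; last exact: measurable_tsum_gt.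
have sec x : tsection [set x : n.+1.-tuple X | c < z + tsum h x] x =
    [set y | c < (z + h x) + tsum h y].
  by apply/seteqP; split=> y; rewrite /tsection/= tsum_cons addrA.
under eq_Rintegral do rewrite sec.
set s := Num.sqrt (b ^+ 2 + n%:R * tau).
set s' := Num.sqrt (b ^+ 2 + n.+1%:R * tau).
have ss' : s <= s'.
  by rewrite ler_wsqrtr// lerD2l ler_wpM2r// ler_nat.
have es : s' ^+ 2 = s ^+ 2 + tau.
  rewrite !sqr_sqrtr ?addr_ge0 ?sqr_ge0 ?mulr_ge0//.
  by rewrite -natr1; ring.
rewrite et in es.
have := normal_recursion_ge b0 C0 hC qd sh h0 (bsn n) ss' es.
rewrite /= -ea -et -ee => /(_ (z + n%:R * a - c - delta)) rec.
have e1 : z + n.+1%:R * a - c - delta = z + n%:R * a - c - delta + a.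
  by rewrite -natr1; ring.
rewrite e1.
apply: (@le_trans _ _ (\int[Q]_x (ncdf ((z + n%:R * a - c - delta + h x) / s)
    - (ncdf (- delta / b) + n%:R * eps)))).
  have iF : integ Q (fun x => ncdf ((z + n%:R * a - c - delta + h x) / s)).
    apply: (@integ_bdd _ _ _ _ _ 1).
      apply: measurable_ncdf_comp; apply: measurable_funM => //.
      exact: measurable_funD.
    by move=> x; rewrite ger0_norm ?ncdf_ge0 ?ncdf_le1.
  rewrite EB// ?Ecst; last exact: integ_cst.
  rewrite -natr1; lra.
apply: Ele.
- apply: integB; last exact: integ_cst.
  apply: (@integ_bdd _ _ _ _ _ 1).
    apply: measurable_ncdf_comp; apply: measurable_funM => //.
    exact: measurable_funD.
  by move=> x; rewrite ger0_norm ?ncdf_ge0 ?ncdf_le1.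
- have := integ_iid_pr_tsection Q Q (@measurable_tsum_gt n.+1 h z c mh).
  by under [X in integ _ X]eq_fun do rewrite sec.
- move=> x; have := IHn (z + h x).
  rewrite (_ : z + h x + n%:R * a - c - delta = z + n%:R * a - c - delta + h x).
    by rewrite opprD addrA.
  by ring.
Qed.

End normal_recursion.

(** * Lebesgue norms as real expectations *)

Section L2_bridge.
Context {d : measure_display} {X : measurableType d} {R : realType}.
Implicit Types (P Q : probability X R) (f g : X -> R).

Lemma EFin_E P f : integ P f -> (\int[P]_x (f x)%:E)%E = (\int[P]_x f x)%:E.
Proof. by move=> fi; rewrite fineK//; exact: integrable_fin_num. Qed.

Lemma ge0_integ P f (r : R) : measurable_fun setT f -> (forall x, 0 <= f x) ->
  (\int[P]_x (f x)%:E <= r%:E)%E -> integ P f /\ \int[P]_x f x <= r.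
Proof.
move=> mf f0 fr; have fi : integ P f.
  apply/integrableP; split; first exact/measurable_EFinP.
  under eq_integral do rewrite /= ger0_norm//.
  by rewrite (le_lt_trans fr)// ltry.
by split => //; rewrite -lee_fin -EFin_E.
Qed.

Lemma Lnorm2_sqr (mu : {measure set X -> \bar R}) f :
  ('N[mu]_2%:E [EFin \o f] `^ 2 = \int[mu]_x (f x ^+ 2)%:E)%E.
Proof.
rewrite poweR_Lnorm//; apply: eq_integral => x _ /=.
by rewrite powR_mulrn// real_normK ?num_real.
Qed.

Lemma L2norm_ge0 P f : 0 <= L2norm P f.
Proof. by rewrite fine_ge0// Lnorm_ge0. Qed.

Lemma L2norm_sqr P f : sqi P f -> L2norm P f ^+ 2 = \int[P]_x f x ^+ 2.
Proof.
move=> sf; apply: EFin_inj; rewrite -(EFin_E sf.2) -Lnorm2_sqr /L2norm.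
rewrite -powR_mulrn ?fine_ge0 ?Lnorm_ge0// -poweR_EFin fineK//.
rewrite ge0_fin_numE ?Lnorm_ge0//; apply: (@lty_poweRy _ _ 2) => //.
by rewrite Lnorm2_sqr (EFin_E sf.2) ltry.
Qed.

Lemma L2_sqi P (f : L2 P) : sqi P f.
Proof.
split; first exact: measurable_funPT.
exact/Lfun2_integrable_sqr/LfunP.
Qed.

Lemma L2nonzero_norm P f : sqi P f -> L2nonzero P f -> 0 < L2norm P f.
Proof.
move=> sf nz; rewrite lt_def L2norm_ge0 andbT; apply/eqP => n0; apply: nz.
pose F x := f x ^+ 2.
have mF : measurable_fun setT (EFin \o F).
  by apply/measurable_EFinP; apply: measurable_funX; exact: sf.1.
have [h _] := ae_eq_integral_abs P measurableT mF.
have /h : (\int[P]_x `|(EFin \o F) x| = 0)%E.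
  under eq_integral do rewrite /= ger0_norm ?sqr_ge0//.
  by rewrite (EFin_E sf.2) -(L2norm_sqr sf) n0 expr0n.
apply: filterS => x /(_ I) /= [] /eqP; rewrite sqrf_eq0; exact: eqP.
Qed.

End L2_bridge.

(** * From square root densities to quasi-densities *)

Section sqrt_densities.
Context {d : measure_display} {X : measurableType d} {R : realType}.
Implicit Types (P Q : probability X R) (f g : X -> R).

Lemma sum_measure_dominatesl P Q : P `<< sum_measure P Q.
Proof.
apply/null_content_dominatesP => A mA.
rewrite (_ : _ A = P A + Q A)%E; last exact: measure_addE.
by move=> /eqP; rewrite padde_eq0 ?measure_ge0// => /andP[/eqP].
Qed.

Lemma sum_measure_dominatesr P Q : Q `<< sum_measure P Q.
Proof.
apply/null_content_dominatesP => A mA.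
rewrite (_ : _ A = P A + Q A)%E; last exact: measure_addE.
by move=> /eqP; rewrite padde_eq0 ?measure_ge0// => /andP[_ /eqP].
Qed.

Section dominated.
Variables (P : probability X R) (mu : {sigma_finite_measure set X -> \bar R}).
Hypothesis Pmu : P `<< mu.

Lemma sqrt_density_ge0 x : 0 <= sqrt_density P mu x.
Proof. exact: sqrtr_ge0. Qed.

Lemma measurable_sqrt_density : measurable_fun setT (sqrt_density P mu).
Proof.
apply: (measurableT_comp (continuous_measurable_fun (@sqrt_continuous R))).
by apply: measurableT_comp => //; apply: measurable_int.
Qed.

Lemma integral_sqrt_density f : measurable_fun setT f -> (forall x, 0 <= f x) ->
  (\int[mu]_x (f x * sqrt_density P mu x ^+ 2)%:E = \int[P]_x (f x)%:E)%E.
Proof.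
move=> mf f0.
rewrite -(Radon_Nikodym_SigmaFinite.change_of_variables Pmu) //;
  last exact/measurable_EFinP.
apply: ae_eq_integral => //.
- apply/measurable_EFinP/measurable_funM => //.
  by apply: measurable_funX; exact: measurable_sqrt_density.
- apply: emeasurable_funM; first exact/measurable_EFinP.
  exact: measurable_int (Radon_Nikodym_SigmaFinite.f_integrable Pmu).
have := ae_eq_Radon_Nikodym_SigmaFinite Pmu measurableT.
apply: filterS => x /(_ I) e _; rewrite EFinM; congr (_ * _)%E.
have ge := Radon_Nikodym_SigmaFinite.f_ge0 Pmu x.
have fi := Radon_Nikodym_SigmaFinite.f_fin_num Pmu x.
by rewrite /sqrt_density -e sqr_sqrtr ?fine_ge0// fineK.
Qed.

End dominated.

(* [W + 1] is the ratio of the root densities; it is [0] where [dP = 0],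
   since [x / 0 = 0]. *)
Lemma path_remainder_quasi_density P Q g (s r : R) : sqi P g -> 0 <= r ->
  (path_remainder P g s Q <= r%:E)%E ->
  exists W, quasi_density P Q W (r ^+ 2) /\
    \int[P]_x (W x - 2^-1 * s * g x) ^+ 2 <= r ^+ 2.
Proof.
move=> sg r0 hr.
pose mu : {sigma_finite_measure set X -> \bar R} := sum_measure P Q.
have Pmu : P `<< mu by exact: sum_measure_dominatesl.
have Qmu : Q `<< mu by exact: sum_measure_dominatesr.
pose p := sqrt_density P mu; pose q := sqrt_density Q mu.
have mp : measurable_fun setT p by exact: measurable_sqrt_density.
have mq : measurable_fun setT q by exact: measurable_sqrt_density.
pose D x := q x - (1 + 2^-1 * s * g x) * p x.
have mg := sg.1.
have mD : measurable_fun setT D.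
  apply: measurable_funB => //; apply: measurable_funM => //.
  by apply: measurable_funD => //; exact: measurable_funM.
have D2 : (\int[mu]_x (D x ^+ 2)%:E <= (r ^+ 2)%:E)%E.
  rewrite -Lnorm2_sqr -powR_mulrn// -poweR_EFin gt0_ler_poweR//.
    by rewrite in_itv/= Lnorm_ge0 leey.
  by rewrite in_itv/= lee_fin r0 leey.
pose W x := q x / p x - 1.
have mpV : measurable_fun setT (fun x => (p x)^-1).
  rewrite (_ : (fun x => _) = (fun x => p x `^ (-1))).
    exact: (measurableT_comp (measurable_powR _)).
  by apply/funext => x; rewrite powR_inv1// sqrt_density_ge0.
have mW : measurable_fun setT W.
  by apply: measurable_funB => //; apply: measurable_funM.
have mWg : measurable_fun setT (fun x => W x - 2^-1 * s * g x).
  by apply: measurable_funB => //; exact: measurable_funM.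
(* Integrating against [P] multiplies by p^2, which turns the integrand into D^2 where p is not 0
   and into 0 elsewhere. *)
have [iWg eWg] : integ P (fun x => (W x - 2^-1 * s * g x) ^+ 2) /\
    \int[P]_x (W x - 2^-1 * s * g x) ^+ 2 <= r ^+ 2.
  apply: ge0_integ; first exact: measurable_funX.
    by move=> x; exact: sqr_ge0.
  apply: le_trans D2.
  rewrite -(integral_sqrt_density Pmu); [|exact: measurable_funX|
    by move=> x; exact: sqr_ge0].
  apply: ge0_le_integral => //.
  - by move=> x _; rewrite lee_fin mulr_ge0 ?sqr_ge0.
  - apply/measurable_EFinP; apply: measurable_funM; exact: measurable_funX.
  - apply/measurable_EFinP; exact: measurable_funX.
  move=> x _; rewrite lee_fin -/mu -/p -exprMn.
  have [p0|p0] := eqVneq (p x) 0; first by rewrite p0 mulr0 expr0n sqr_ge0.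
  by rewrite /D /W mulrBl mulrBl mul1r divfK// mulrDl mul1r opprD addrA.
have sW : sqi P W.
  have -> : W = (fun x => (W x - 2^-1 * s * g x) + 2^-1 * s * g x).
    by apply/funext => x; rewrite subrK.
  by apply: sqiD; [split|exact: sqiZ].
exists W; split => //; split => //.
  move=> x; rewrite /W lerBrDr addNr divr_ge0// ?sqrt_density_ge0//.
move=> f mf f01.
have f0 x : 0 <= f x by have /andP[] := f01 x.
have f1 x : f x <= 1 by have /andP[] := f01 x.
have mfW : measurable_fun setT (fun x => f x * (1 + W x) ^+ 2).
  apply: measurable_funM => //; apply: measurable_funX; exact: measurable_funD.
have fW0 x : 0 <= f x * (1 + W x) ^+ 2 by rewrite mulr_ge0// sqr_ge0.
have s1W : sqi P (fun x => 1 + W x) by apply: sqiD => //; exact: sqi_cst.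
have ifW : integ P (fun x => f x * (1 + W x) ^+ 2).
  apply: integ_le s1W.2 _ => // x.
  by rewrite ger0_norm// ler_piMl ?sqr_ge0.
have iQ : integ Q f.
  by apply: (@integ_bdd _ _ _ _ _ 1) => // x; rewrite ger0_norm.
have mfp : measurable_fun setT (fun x => (f x * (1 + W x) ^+ 2 * p x ^+ 2)%:E).
  by apply/measurable_EFinP; apply: measurable_funM => //; exact: measurable_funX.
have mfq : measurable_fun setT (fun x => (f x * q x ^+ 2)%:E).
  by apply/measurable_EFinP; apply: measurable_funM => //; exact: measurable_funX.
have mD2 : measurable_fun setT (fun x => (D x ^+ 2)%:E).
  by apply/measurable_EFinP; exact: measurable_funX.
have key x : p x != 0 -> (1 + W x) ^+ 2 * p x ^+ 2 = q x ^+ 2.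
  by move=> p0; rewrite -exprMn /W addrC subrK divfK.
apply/andP; split.
  rewrite -lee_fin -!EFin_E//.
  rewrite -(integral_sqrt_density Pmu)// -(integral_sqrt_density Qmu)//.
  apply: ge0_le_integral => //.
  - by move=> x _; rewrite lee_fin mulr_ge0 ?sqr_ge0.
  move=> x _; rewrite lee_fin -mulrA ler_wpM2l//.
  rewrite -/mu -/p -/q; have [p0|p0] := eqVneq (p x) 0; last by rewrite key.
  by rewrite p0 expr0n mulr0 sqr_ge0.
rewrite -lee_fin EFinD -!EFin_E//.
rewrite -(integral_sqrt_density Pmu)// -(integral_sqrt_density Qmu)//.
(* Where p = 0 the remainder [D] equals q, so the mass of [Q] not seen by [P] is at most the
   integral of D^2, hence at most r^2. *)
apply: (@le_trans _ _ (\int[mu]_x ((f x * (1 + W x) ^+ 2 * p x ^+ 2)%:E +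
   (D x ^+ 2)%:E))%E).
  apply: ge0_le_integral => //.
  - by move=> x _; rewrite lee_fin mulr_ge0 ?sqr_ge0.
  - exact: emeasurable_funD.
  move=> x _; rewrite -EFinD lee_fin -mulrA -/mu -/q.
  have [p0|p0] := eqVneq (p x) 0; last by rewrite key// lerDl sqr_ge0.
  by rewrite /D p0 mulr0 subr0 expr0n mulr0 mulr0 add0r ler_piMl ?sqr_ge0.
rewrite ge0_integralD//; first by rewrite leeD2l.
- by move=> x _; rewrite lee_fin mulr_ge0 ?sqr_ge0.
- by move=> x _; rewrite lee_fin sqr_ge0.
Qed.

End sqrt_densities.

(** * Convergence in the space of square integrable functions *)

Section L2_limits.
Context {d : measure_display} {X : measurableType d} {R : realType}.
Variable P : probability X R.
Implicit Types (f g h k : X -> R) (F G H : nat -> X -> R).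

Definition l2lim F f := [/\ forall n, sqi P (F n), sqi P f &
  \int[P]_x (F n x - f x) ^+ 2 @[n --> \oo] --> (0 : R)].

Lemma l2lim_cst f : sqi P f -> l2lim (fun=> f) f.
Proof.
move=> sf; split => //.
rewrite (_ : (fun _ => _) = fun=> 0); first exact: cvg_cst.
apply/funext => n; rewrite (_ : (fun x => _) = fun=> 0) ?Ecst//.
by apply/funext => x; rewrite subrr expr0n.
Qed.

Lemma cvg_sqr0 (u : nat -> R) : u n ^+ 2 @[n --> \oo] --> (0 : R) ->
  u n @[n --> \oo] --> (0 : R).
Proof.
move=> h; apply/cvgr0Pnorm_lt => e e0.
have /cvgr0Pnorm_lt/(_ (e ^+ 2) (exprn_gt0 _ e0)) := h.
apply: filterS => n; by rewrite normrX ltr_pXn2r ?nnegrE ?(ltW e0).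
Qed.

Lemma cvg_dot_sqr F f g : l2lim F f -> sqi P g ->
  \int[P]_x ((F n x - f x) * g x) @[n --> \oo] --> (0 : R).
Proof.
move=> [sF sf cF] sg; apply: cvg_sqr0.
have cFg : \int[P]_x (F n x - f x) ^+ 2 * \int[P]_x g x ^+ 2 @[n --> \oo] --> (0 : R).
  by rewrite -[X in _ --> X](mul0r (\int[P]_x g x ^+ 2)); apply: cvgMr_tmp.
apply: (squeeze_cvgr _ (cvg_cst 0) cFg); apply: nearW => n.
by rewrite sqr_ge0 E_CauchySchwarz//; exact: sqiB.
Qed.

Lemma l2lim_dot F f G g : l2lim F f -> l2lim G g ->
  \int[P]_x (F n x * G n x) @[n --> \oo] --> \int[P]_x (f x * g x).
Proof.
move=> lF lG; have [sF sf cF] := lF; have [sG sg cG] := lG.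
have cFG : \int[P]_x ((F n x - f x) * (G n x - g x)) @[n --> \oo] --> (0 : R).
  apply: cvg_sqr0.
  have c : \int[P]_x (F n x - f x) ^+ 2 * \int[P]_x (G n x - g x) ^+ 2
      @[n --> \oo] --> (0 : R).
    by rewrite -[X in _ --> X](mul0r 0); exact: cvgM.
  apply: (squeeze_cvgr _ (cvg_cst 0) c); apply: nearW => n.
  by rewrite sqr_ge0 E_CauchySchwarz//; exact: sqiB.
have -> : (fun n => \int[P]_x (F n x * G n x)) = (fun n =>
   \int[P]_x (f x * g x) + (\int[P]_x ((F n x - f x) * g x) +
   (\int[P]_x ((G n x - g x) * f x) +
    \int[P]_x ((F n x - f x) * (G n x - g x))))).
  apply/funext => n.
  have sFf := sqiB (sF n) sf; have sGg := sqiB (sG n) sg.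
  have i1 := sqi_mul sf sg; have i2 := sqi_mul sFf sg.
  have i3 := sqi_mul sGg sf; have i4 := sqi_mul sFf sGg.
  rewrite -(ED i3 i4) -(ED i2 (integD i3 i4)) -(ED i1 (integD i2 (integD i3 i4))).
  by apply: eq_Rintegral => x _; ring.
rewrite -[X in _ --> X]addr0 -[X in _ + X]addr0 -[X in _ + (_ + X)]addr0.
apply: cvgD; first exact: cvg_cst.
apply: cvgD; first exact: cvg_dot_sqr.
by apply: cvgD => //; exact: cvg_dot_sqr.
Qed.

Lemma l2lim_sqr F f : l2lim F f ->
  \int[P]_x F n x ^+ 2 @[n --> \oo] --> \int[P]_x f x ^+ 2.
Proof. by move=> lF; exact: (l2lim_dot lF lF). Qed.

Lemma l2lim_E F f : l2lim F f ->
  \int[P]_x F n x @[n --> \oo] --> \int[P]_x f x.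
Proof.
move=> lF; have := l2lim_dot lF (l2lim_cst (sqi_cst P 1)).
under eq_fun do under eq_Rintegral do rewrite mulr1.
by under [in X in _ --> X]eq_Rintegral do rewrite mulr1.
Qed.

Lemma l2lim_addc F f (a : nat -> R) : l2lim F f ->
  a n @[n --> \oo] --> (0 : R) -> l2lim (fun n x => F n x + a n) f.
Proof.
move=> lF ca; have [sF sf cF] := lF; split => //.
  by move=> n; apply: sqiD => //; exact: sqi_cst.
have -> : (fun n => \int[P]_x (F n x + a n - f x) ^+ 2) = (fun n =>
   \int[P]_x (F n x - f x) ^+ 2 + (2 * a n * \int[P]_x (F n x - f x) + a n ^+ 2)).
  apply/funext => n; have sFf := sqiB (sF n) sf.
  rewrite -(EZ _ (sqi_integ sFf)) -[X in _ + (_ + X)](Ecst P).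
  rewrite -(ED (integZ _ (sqi_integ sFf)) (integ_cst _ _)).
  rewrite -(ED sFf.2 (integD (integZ _ (sqi_integ sFf)) (integ_cst _ _))).
  by apply: eq_Rintegral => x _; ring.
rewrite -[X in _ --> X]addr0 -[X in _ + X]addr0.
apply: cvgD => //; apply: cvgD.
  rewrite -[X in _ --> X](mul0r 0) -[X in X * _](mulr0 2).
  apply: cvgM; first exact: cvgMl_tmp.
  have := cvg_dot_sqr lF (sqi_cst P 1).
  by under eq_fun do under eq_Rintegral do rewrite mulr1.
by rewrite -[X in _ --> X](mul0r 0); apply: cvgM.
Qed.

Lemma sqrtn_sqr n : Num.sqrt n%:R ^+ 2 = n%:R :> R.
Proof. by rewrite sqr_sqrtr. Qed.

Lemma cvg_invn : n%:R^-1 @[n --> \oo] --> (0 : R).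
Proof.
apply/gtr0_cvgV0; last exact: cvgr_idn.
by exists 1%N => // n /=; rewrite ltr0n.
Qed.

Lemma cvg_sqrtn_inv : (Num.sqrt n%:R)^-1 @[n --> \oo] --> (0 : R).
Proof.
apply: cvg_sqr0; under eq_fun do rewrite exprVn sqrtn_sqr.
exact: cvg_invn.
Qed.

(* Uniform integrability of [F n ^ 2], by truncating its limit. *)
Lemma l2lim_min F f H h : l2lim F f -> l2lim H h ->
  \int[P]_x (F n x ^+ 2 * Num.min 1 `|(Num.sqrt n%:R)^-1 * H n x|)
    @[n --> \oo] --> (0 : R).
Proof.
move=> lF lH; have [sF sf cF] := lF; have [sH sh cH] := lH.
apply/cvgrPdist_le => e e0.
(* The two quadratic distances [F n] to [f] and [f] to [g] enter with factor 4 each, giving e/2; the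
   term with the truncation level [M] adds at most e/4. *)
have e8 : 0 < e / 16 by rewrite divr_gt0.
have [M M0 [g [mg gM fg]]] := sqi_truncate sf e8.
have sg := sqi_bdd P mg gM.
have cH2 : 2 * M ^+ 2 * ((Num.sqrt n%:R)^-1 * Num.sqrt (\int[P]_x H n x ^+ 2))
    @[n --> \oo] --> (0 : R).
  rewrite -[X in _ --> X](mulr0 (2 * M ^+ 2)); apply: cvgMl_tmp.
  rewrite -[X in _ --> X](mul0r (Num.sqrt (\int[P]_x h x ^+ 2))).
  apply: cvgM; first exact: cvg_sqrtn_inv.
  by apply: cvg_comp (l2lim_sqr lH) _; exact: sqrt_continuous.
have e4 : 0 < e / 4 by rewrite divr_gt0.
have /cvgrPdist_le/(_ _ e4) := cH2.
have /cvgrPdist_le/(_ _ e8) := cF.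
apply: filterS2 => n; rewrite !sub0r !normrN => h1 h2.
rewrite ger0_norm; last by apply: Ege0 => x; rewrite mulr_ge0 ?sqr_ge0 ?min1_ge0.
have := E_sqr_min_le (sF n) mg gM (integZ (Num.sqrt n%:R)^-1 (sqi_integ (sH n))).
move=> /le_trans; apply.
have {}h1 := le_trans (ler_norm _) h1; have {}h2 := le_trans (ler_norm _) h2.
have h3 : \int[P]_x (F n x - g x) ^+ 2 <= 2 * \int[P]_x (F n x - f x) ^+ 2 +
    2 * \int[P]_x (f x - g x) ^+ 2.
  have s1 := sqiB (sF n) sf; have s2 := sqiB sf sg.
  rewrite -(EZ _ s1.2) -(EZ _ s2.2) -(ED (integZ _ s1.2) (integZ _ s2.2)).
  apply: Ele; [exact: (sqiB (sF n) sg).2| |].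
    by apply: integD; apply: integZ; [exact: s1.2|exact: s2.2].
  move=> x; have := sqr_ge0 ((F n x - f x) - (f x - g x)).
  by rewrite !expr2; lra.
have h4 : \int[P]_x `|(Num.sqrt n%:R)^-1 * H n x| <=
    (Num.sqrt n%:R)^-1 * Num.sqrt (\int[P]_x H n x ^+ 2).
  under eq_Rintegral do rewrite normrM (@ger0_norm _ (Num.sqrt n%:R)^-1) ?invr_ge0//.
  rewrite (EZ _ (integ_abs (sqi_integ (sH n)))) ler_wpM2l ?invr_ge0//.
  rewrite -[leLHS]ger0_norm ?Ege0//.
  by rewrite -sqrtr_sqr ler_wsqrtr// E_abs_le.
have h5 : 2 * M ^+ 2 * \int[P]_x `|(Num.sqrt n%:R)^-1 * H n x| <=
    2 * M ^+ 2 * ((Num.sqrt n%:R)^-1 * Num.sqrt (\int[P]_x H n x ^+ 2)).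
  by rewrite ler_wpM2l// mulr_ge0 ?sqr_ge0.
lra.
Qed.

End L2_limits.

(** * Local alternatives: asymptotic test bounds and contiguity *)

Section local_sequences.
Context {d : measure_display} {X : measurableType d} {R : realType}.
Implicit Types (P : probability X R) (g k h f W : X -> R).

(* [Q n] has tangent [g] at [P] and local parameter [t / sqrt n]. *)
Definition local_seq P (Q : nat -> probability X R) g (t : R) :=
  exists (W : nat -> X -> R) (e : nat -> R),
  [/\ forall n, sqi P (W n),
      l2lim P (fun n x => Num.sqrt n%:R * W n x) (fun x => 2^-1 * t * g x),
      n%:R * e n @[n --> \oo] --> (0 : R) &
      \forall n \near \oo, quasi_density P (Q n) (W n) (e n)].

(** Treating [P] as an alternative to itself lets the limit theorems under alternatives serve under
    [P] as well. *)
Lemma local_seq_self P : local_seq P (fun=> P) (fun=> 0) 0.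
Proof.
exists (fun _ _ => 0), (fun=> 0); split.
- by move=> n; exact: sqi_cst.
- rewrite (_ : (fun n x => _) = (fun=> (fun=> 0))); last first.
    by apply/funext => n; apply/funext => x; rewrite mulr0.
  rewrite (_ : (fun x => _) = (fun=> 0)); last first.
    by apply/funext => x; rewrite mulr0.
  exact/l2lim_cst/sqi_cst.
- by under eq_fun do rewrite mulr0; exact: cvg_cst.
- by apply: nearW => n; exact: quasi_density_self.
Qed.

Lemma sqrtn_gt0 n : (0 < n)%N -> 0 < Num.sqrt n%:R :> R.
Proof. by move=> n0; rewrite sqrtr_gt0 ltr0n. Qed.

Lemma sqrtnVK n (x : R) : (0 < n)%N -> (Num.sqrt n%:R)^-1 * (Num.sqrt n%:R * x) = x.
Proof. by move=> n0; rewrite mulKf// gt_eqF// sqrtn_gt0. Qed.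

Lemma scaled_E_sqr P n W : sqi P W ->
  n%:R * \int[P]_x W x ^+ 2 = \int[P]_x (Num.sqrt n%:R * W x) ^+ 2.
Proof.
move=> sW; rewrite -(EZ _ sW.2); apply: eq_Rintegral => x _.
by rewrite exprMn sqrtn_sqr.
Qed.

Lemma scaled_E_sqr_min P n W h : sqi P W -> measurable_fun setT h ->
  n%:R * \int[P]_x (W x ^+ 2 * Num.min 1 `|h x|) =
  \int[P]_x ((Num.sqrt n%:R * W x) ^+ 2 * Num.min 1 `|(Num.sqrt n%:R)^-1 * (Num.sqrt n%:R * h x)|).
Proof.
move=> sW mh; rewrite -(EZ _ (integ_sqr_min sW mh)); apply: eq_Rintegral => x _.
rewrite exprMn sqrtn_sqr; case: n => [|n]; first by rewrite !mul0r.
by rewrite sqrtnVK// mulrA.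
Qed.

Lemma cvg_scaled_E_sqr P f (W : nat -> X -> R) : (forall n, sqi P (W n)) ->
  l2lim P (fun n x => Num.sqrt n%:R * W n x) f ->
  n%:R * \int[P]_x W n x ^+ 2 @[n --> \oo] --> \int[P]_x f x ^+ 2.
Proof.
move=> sW lW; under eq_fun do rewrite scaled_E_sqr//.
exact: l2lim_sqr lW.
Qed.

Lemma cvg_scaled_sqr (u : nat -> R) (l : R) : n%:R * u n @[n --> \oo] --> l ->
  n%:R * u n ^+ 2 @[n --> \oo] --> (0 : R).
Proof.
move=> cu; have -> : (fun n => n%:R * u n ^+ 2) =
    (fun n => (n%:R * u n) * (n%:R * u n) * n%:R^-1).
  apply/funext => -[|n]; first by rewrite !mul0r.
  have : n.+1%:R != 0 :> R by rewrite pnatr_eq0.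
  by move: (n.+1%:R) => N N0; field.
rewrite -[X in _ --> X](mulr0 (l * l)); apply: cvgM; last exact: cvg_invn.
exact: cvgM.
Qed.

(** The total variance n tau tends to t^2 E g^2, as sqrt n W tends to t g / 2 and 4 (t/2)^2 = t^2.
    The total error n eps vanishes by [l2lim_min]. *)
Lemma testing_bound P Q g t (b l eta : R) : local_seq P Q g t -> sqi P g ->
  0 < b -> 0 < l -> 0 < eta -> \forall n \near \oo,
  forall A : set (n.-tuple X), measurable A ->
  iid_pr P A - l * iid_pr (Q n) A <=
  put (Num.sqrt (b ^+ 2 + t ^+ 2 * \int[P]_x g x ^+ 2)) l + eta.
Proof.
move=> [W [e [sW lW ce nq]]] sg b0 l0 eta0.
have [C C0 hC] := put_step_le b0.
set sig := Num.sqrt _.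
pose tau n := 4 * \int[P]_x W n x ^+ 2.
pose m n := \int[P]_x (W n x ^+ 2 * Num.min 1 `|W n x|).
have Ig : \int[P]_x (2^-1 * t * g x) ^+ 2 = t ^+ 2 * \int[P]_x g x ^+ 2 / 4.
  rewrite mulrAC -(EZ _ sg.2); apply: eq_Rintegral => x _.
  by field.
have ctau : n%:R * tau n @[n --> \oo] --> t ^+ 2 * \int[P]_x g x ^+ 2.
  have := cvg_scaled_E_sqr sW lW; rewrite Ig => h.
  have -> : (fun n => n%:R * tau n) = (fun n => 4 * (n%:R * \int[P]_x W n x ^+ 2)).
    by apply/funext => n; rewrite /tau mulrCA.
  rewrite (_ : t ^+ 2 * _ = 4 * (t ^+ 2 * \int[P]_x g x ^+ 2 / 4)).
    exact: cvgMl_tmp.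
  by field.
have cm : n%:R * m n @[n --> \oo] --> (0 : R).
  under eq_fun do rewrite (scaled_E_sqr_min _ (sW _) (sW _).1).
  exact: (l2lim_min lW lW).
have cs : put (Num.sqrt (b ^+ 2 + n%:R * tau n)) l @[n --> \oo] --> put sig l.
  have sig0 : 0 < sig.
    rewrite sqrtr_gt0 ltr_wpDr ?exprn_gt0// mulr_ge0 ?sqr_ge0// Ege0// => x.
    exact: sqr_ge0.
  have cput : {for sig, continuous (put ^~ l)}.
    apply/differentiable_continuous/derivable1_diffP.
    by case: (is_derive_put_sd sig0 l0).
  apply: (cvg_comp (fun n => Num.sqrt (b ^+ 2 + n%:R * tau n)) (put ^~ l)); last exact: cput.
  apply: (cvg_comp (fun n => b ^+ 2 + n%:R * tau n) (@Num.sqrt R)); last exact: sqrt_continuous.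
  by apply: cvgD => //; exact: cvg_cst.
have ceps : n%:R * (e n + C * (m n + tau n ^+ 2)) @[n --> \oo] --> (0 : R).
  rewrite (_ : (fun n => n%:R * (e n + _)) = (fun n => n%:R * e n +
      C * (n%:R * m n + n%:R * tau n ^+ 2))); last first.
    by apply/funext => n; ring.
  rewrite -[X in _ --> X]addr0 -[X in _ + X](mulr0 C) -[X in C * X]addr0.
  apply: cvgD => //; apply: cvgMl_tmp; apply: cvgD => //.
  exact: cvg_scaled_sqr ctau.
have eta2 : 0 < eta / 2 by rewrite divr_gt0.
have /cvgrPdist_le/(_ _ eta2) := cs; have /cvgrPdist_le/(_ _ eta2) := ceps.
move: nq; apply: filterS3 => n qd; rewrite sub0r normrN => /(le_trans (ler_norm _)) h1.
rewrite distrC => /(le_trans (ler_norm _)) h2 A mA.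
have := Neyman_Pearson_put b0 C0 hC qd erefl erefl mA (ltW l0).
rewrite -/(tau n) -/(m n); lra.
Qed.

Lemma testing_half P Q g t (b eta : R) : local_seq P Q g t -> sqi P g ->
  0 < b -> 0 < eta -> \forall n \near \oo,
  forall A : set (n.-tuple X), measurable A ->
  iid_pr (Q n) A <= 2^-1 + eta ->
  iid_pr P A <= ncdf (Num.sqrt (b ^+ 2 + t ^+ 2 * \int[P]_x g x ^+ 2)) + 2 * eta.
Proof.
move=> lQ sg b0 eta0; set sig := Num.sqrt _.
have sig0 : 0 < sig.
  rewrite sqrtr_gt0 ltr_wpDr ?exprn_gt0// mulr_ge0 ?sqr_ge0// Ege0// => x.
  exact: sqr_ge0.
(* This spot makes d2 = 0 and d1 = sig: the term l ncdf(d2) = l / 2 of the price cancels the bound l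
   / 2 on l Q(A), and ncdf(sig) remains. *)
pose l := expR (- (sig ^+ 2 / 2)).
have l0 : 0 < l by exact: expR_gt0.
have l1 : l <= 1.
  by rewrite -expR0 ler_expR oppr_le0 divr_ge0 ?sqr_ge0.
have := testing_bound lQ sg b0 l0 eta0; apply: filterS => n H A mA hA.
have := H A mA; rewrite -/sig putE//.
have -> : put_d1 sig l = sig by rewrite /put_d1 expRK; field; rewrite gt_eqF.
have -> : put_d2 sig l = 0 by rewrite /put_d2 expRK; field; rewrite gt_eqF.
rewrite ncdf0; have := ler_wpM2l (ltW l0) hA.
have := ler_wpM2r (ltW eta0) l1; lra.
Qed.

(** Applied to the complement of [A n], the test bound becomes an upper bound for l Q(A) by P(A) + l
    (1 - ncdf(d2)) and a small error. *)
Lemma contiguity P Q g t (A : forall n, set (n.-tuple X)) :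
  local_seq P Q g t -> sqi P g -> (forall n, measurable (A n)) ->
  iid_pr P (A n) @[n --> \oo] --> (0 : R) ->
  iid_pr (Q n) (A n) @[n --> \oo] --> (0 : R).
Proof.
move=> lQ sg mA cA; apply/cvgrPdist_le => eta eta0.
set sig := Num.sqrt (1 ^+ 2 + t ^+ 2 * \int[P]_x g x ^+ 2).
have sig0 : 0 < sig.
  rewrite sqrtr_gt0 ltr_wpDr ?exprn_gt0// mulr_ge0 ?sqr_ge0// Ege0// => x.
  exact: sqr_ge0.
have eta2 : 0 < eta / 2 by rewrite divr_gt0.
have [M M0 hM] := ncdf_near1 eta2.
(* Chosen so that d2 = M. The tolerances are multiples of [l] because the inequality is finally
   divided by [l]. *)
pose l := expR (- (sig * (M + sig / 2))).
have l0 : 0 < l by exact: expR_gt0.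
have le0 : 0 < l * (eta / 4) by rewrite mulr_gt0// divr_gt0.
have := testing_bound lQ sg ltr01 l0 le0.
have /cvgrPdist_le/(_ _ le0) := cA.
apply: filterS2 => n; rewrite !sub0r !normrN !ger0_norm ?iid_pr_ge0// => h1.
move=> /(_ _ (measurableC (mA n))); rewrite !iid_prC// -/sig putE//.
have h2 : 1 - eta / 2 <= ncdf (put_d2 sig l).
  apply: hM; rewrite /put_d2 expRK (_ : _ - _ = M)//.
  by field; rewrite gt_eqF.
have := ncdf_le1 (put_d1 sig l); have := ler_wpM2l (ltW l0) h2 => h3 h4 h5.
rewrite -(ler_pM2l l0); lra.
Qed.

End local_sequences.

(** * Central limit theorem under local alternatives *)

Section local_clt.
Context {d : measure_display} {X : measurableType d} {R : realType}.
Implicit Types (P : probability X R) (g k h : X -> R).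

Lemma l2lim_near P (F G : nat -> X -> R) f : l2lim P F f ->
  (forall n, sqi P (G n)) -> (\forall n \near \oo, F n = G n) -> l2lim P G f.
Proof.
move=> [sF sf cF] sG FG; split => //; apply: cvg_trans cF.
by apply: near_eq_cvg; near=> n; rewrite (near FG n).
Unshelve. all: by end_near. Qed.

Lemma cvg_scaled_inv_sqrt (u : nat -> R) (l : R) : n%:R * u n @[n --> \oo] --> l ->
  Num.sqrt n%:R * u n @[n --> \oo] --> (0 : R).
Proof.
move=> cu; have -> : (fun n => Num.sqrt n%:R * u n) =
    (fun n => (Num.sqrt n%:R)^-1 * (n%:R * u n)).
  apply/funext => -[|n]; first by rewrite sqrtr0 !mul0r mulr0.
  rewrite (_ : n.+1%:R * _ = Num.sqrt n.+1%:R * (Num.sqrt n.+1%:R * u n.+1)).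
    by rewrite sqrtnVK.
  by rewrite mulrA -expr2 sqrtn_sqr.
rewrite -[X in _ --> X](mul0r l); apply: cvgM => //; exact: cvg_sqrtn_inv.
Qed.

(** The mass of (1 + W)^2 is 1 up to o(1/n), so sqrt n E(2 W + W^2) tends to 0; its limit is also t
    E g. *)
Lemma tangent_mean0 P Q g (t : R) : local_seq P Q g t -> sqi P g -> t != 0 ->
  \int[P]_x g x = 0.
Proof.
move=> [W [e [sW lW ce nq]]] sg t0.
pose F n x := Num.sqrt n%:R * W n x.
have c1 : Num.sqrt n%:R * \int[P]_x (2 * W n x + W n x ^+ 2) @[n --> \oo]
    --> t * \int[P]_x g x.
  rewrite (_ : (fun n => _ * \int[P]_x (2 * W n x + W n x ^+ 2)) = (fun n =>
    2 * \int[P]_x F n x + Num.sqrt n%:R * \int[P]_x W n x ^+ 2)); last first.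
    apply/funext => n; have i1 := sqi_integ (sW n).
    by rewrite (ED (integZ _ i1) (sW n).2) !EZ//; ring.
  rewrite -[X in _ --> X]addr0; apply: cvgD; last first.
    exact: cvg_scaled_inv_sqrt (cvg_scaled_E_sqr sW lW).
  rewrite (_ : t * _ = 2 * \int[P]_x (2^-1 * t * g x)).
    by apply: cvgMl_tmp; exact: l2lim_E lW.
  by rewrite EZ ?mulrA ?divff ?mul1r//; exact: sqi_integ.
have c2 : - (Num.sqrt n%:R * e n) @[n --> \oo] --> (0 : R).
  by rewrite -oppr0; apply: cvgN; exact: cvg_scaled_inv_sqrt ce.
have c3 : Num.sqrt n%:R * \int[P]_x (2 * W n x + W n x ^+ 2) @[n --> \oo]
    --> (0 : R).
  apply: (squeeze_cvgr _ c2 (cvg_cst 0)).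
  apply: filterS nq => n /quasi_density_mass /andP[h1 h2].
  by rewrite -mulrN ler_wpM2l//= mulr_ge0_le0.
have /eqP : t * \int[P]_x g x = 0 by exact: cvg_unique c1 c3.
by rewrite mulf_eq0 (negbTE t0) => /eqP.
Qed.

Lemma local_clt P Q g k (t b delta eta : R) : local_seq P Q g t -> sqi P g ->
  sqi P k -> \int[P]_x k x = 0 -> 0 < b -> 0 < eta ->
  \forall n \near \oo, forall c : R,
  ncdf ((t * \int[P]_x (k x * g x) - c - delta) /
        Num.sqrt (b ^+ 2 + \int[P]_x k x ^+ 2)) - ncdf (- delta / b) - eta
  <= iid_pr (Q n) [set x : n.-tuple X | c < (Num.sqrt n%:R)^-1 * tsum k x].
Proof.
move=> [W [e [sW lW ce nq]]] sg sk k0 b0 eta0.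
have [C C0 hC] := ncdf_density_step_le b0.
pose h n x := (Num.sqrt n%:R)^-1 * k x.
pose a n := 2 * \int[P]_x (h n x * W n x).
pose u n x := h n x - a n.
pose F n x := Num.sqrt n%:R * W n x.
pose U n x := Num.sqrt n%:R * u n x.
have sh n : sqi P (h n) by exact: sqiZ.
have h0 n : \int[P]_x h n x = 0 by rewrite EZ ?k0 ?mulr0//; exact: sqi_integ.
have su n : sqi P (u n) by apply: sqiB => //; exact: sqi_cst.
have ca : n%:R * a n @[n --> \oo] --> t * \int[P]_x (k x * g x).
  rewrite (_ : (fun n => n%:R * a n) = (fun n => 2 * \int[P]_x (k x * F n x))).
    rewrite (_ : t * _ = 2 * \int[P]_x (k x * (2^-1 * t * g x))).
      by apply: cvgMl_tmp; exact: (l2lim_dot (l2lim_cst sk) lW).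
    under [in RHS]eq_Rintegral do rewrite mulrCA.
    by rewrite EZ ?mulrA ?divff ?mul1r//; exact: sqi_mul.
  apply/funext => -[|n].
    rewrite mul0r /F; under eq_Rintegral do rewrite sqrtr0 mul0r mulr0.
    by rewrite Ecst mulr0.
  rewrite /a mulrCA; congr (_ * _).
  rewrite -EZ; last exact: sqi_mul.
  apply: eq_Rintegral => x _; rewrite /h /F.
  set s := Num.sqrt _; have s0 : s != 0 by rewrite gt_eqF// sqrtn_gt0.
  have -> : n.+1%:R = s ^+ 2 by rewrite sqrtn_sqr.
  by field.
(* Centring at the drift is harmless: n a converges, so sqrt n a tends to 0. *)
have lU : l2lim P U k.
  have ca0 : - (Num.sqrt n%:R * a n) @[n --> \oo] --> (0 : R).
    by rewrite -oppr0; apply: cvgN; exact: cvg_scaled_inv_sqrt ca.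
  apply: l2lim_near (l2lim_addc (l2lim_cst sk) ca0) _ _.
    by move=> n; exact: sqiZ.
  exists 1%N => // n /= n0; apply/funext => x; rewrite /U /u /h mulrBr mulVKf//.
  by rewrite gt_eqF// sqrtn_gt0.
pose tau n := \int[P]_x h n x ^+ 2.
have etau n : (0 < n)%N -> n%:R * tau n = \int[P]_x k x ^+ 2.
  move=> n0; rewrite /tau -(EZ _ (sh n).2); apply: eq_Rintegral => x _.
  by rewrite /h exprMn exprVn sqrtn_sqr mulVKf// pnatr_eq0 -lt0n.
pose m1 n := \int[P]_x (u n x ^+ 2 * Num.min 1 `|u n x|).
pose m2 n := \int[P]_x `|W n x * (u n x * Num.min 1 `|u n x|)|.
pose m3 n := \int[P]_x (W n x ^+ 2 * Num.min 1 `|u n x|).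
have cm1 : n%:R * m1 n @[n --> \oo] --> (0 : R).
  under eq_fun do rewrite (scaled_E_sqr_min _ (su _) (su _).1).
  exact: (l2lim_min lU lU).
have cm3 : n%:R * m3 n @[n --> \oo] --> (0 : R).
  under eq_fun do rewrite (scaled_E_sqr_min _ (sW _) (su _).1).
  exact: (l2lim_min lW lU).
(* By Cauchy-Schwarz (n m2)^2 <= (n E W^2) (n m1), since the square of min(1, |u|) is at most min(1,
   |u|); the first factor converges and the second vanishes. *)
have cm2 : n%:R * m2 n @[n --> \oo] --> (0 : R).
  apply: cvg_sqr0.
  have cc : (n%:R * \int[P]_x W n x ^+ 2) * (n%:R * m1 n) @[n --> \oo] --> (0 : R).
    rewrite -[X in _ --> X](mulr0 (\int[P]_x (2^-1 * t * g x) ^+ 2)).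
    by apply: cvgM => //; exact: (cvg_scaled_E_sqr sW lW).
  apply: (squeeze_cvgr _ (cvg_cst 0) cc); apply: nearW => n.
  rewrite sqr_ge0/= exprMn [leRHS]mulrACA -expr2 ler_wpM2l ?sqr_ge0//.
  have mm := measurable_min1 (su n).1.
  have sWa : sqi P (fun x => `|W n x|).
    split; first by apply: measurableT_comp => //; exact: (sW n).1.
    rewrite (_ : (fun _ => _) = (fun x => W n x ^+ 2)); first exact: (sW n).2.
    by apply/funext => x; rewrite real_normK ?num_real.
  have sua : sqi P (fun x => `|u n x * Num.min 1 `|u n x| |).
    split.
      apply: measurableT_comp => //; apply: measurable_funM => //; exact: (su n).1.
    apply: integ_le (su n).2 _.
      apply: measurable_funX; apply: measurableT_comp => //.
      by apply: measurable_funM => //; exact: (su n).1.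
    move=> x; rewrite (ger0_norm (sqr_ge0 _)) real_normK ?num_real//.
    rewrite exprMn ler_piMr ?sqr_ge0// exprn_ile1 ?min1_ge0 ?min1_le1//.
  rewrite /m2; under eq_Rintegral do rewrite normrM.
  apply: le_trans (E_CauchySchwarz sWa sua) _.
  rewrite (_ : \int[P]_x `|W n x| ^+ 2 = \int[P]_x W n x ^+ 2); last first.
    by apply: eq_Rintegral => x _; rewrite real_normK ?num_real.
  rewrite ler_wpM2l//; first by apply: Ege0 => x; exact: sqr_ge0.
  apply: Ele; [exact: sua.2|exact: integ_sqr_min (su n) (su n).1|move=> x].
  rewrite real_normK ?num_real// exprMn ler_wpM2l ?sqr_ge0//.
  by rewrite expr2 ler_piMl ?min1_ge0 ?min1_le1.
have cW : \int[P]_x W n x @[n --> \oo] --> (0 : R).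
  have cF : (Num.sqrt n%:R)^-1 * \int[P]_x F n x @[n --> \oo] --> (0 : R).
    rewrite -[X in _ --> X](mul0r (\int[P]_x (2^-1 * t * g x))).
    by apply: cvgM; [exact: cvg_sqrtn_inv|exact: l2lim_E lW].
  apply: cvg_trans cF; apply: near_eq_cvg; exists 1%N => // n /= n0.
  by rewrite /F EZ ?sqrtnVK//; exact: sqi_integ.
have ctau : n%:R * tau n @[n --> \oo] --> \int[P]_x k x ^+ 2.
  by apply: cvg_near_cst; exists 1%N => // n /= n0; exact: etau.
pose eps n := e n + C * (m1 n + tau n ^+ 2 + m2 n + m3 n + a n ^+ 2 +
  2 * `|a n * \int[P]_x W n x|).
have ceps : n%:R * eps n @[n --> \oo] --> (0 : R).
  rewrite (_ : (fun n => n%:R * eps n) = (fun n => n%:R * e n + C *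
    (n%:R * m1 n + n%:R * tau n ^+ 2 + n%:R * m2 n + n%:R * m3 n +
     n%:R * a n ^+ 2 + 2 * `|(n%:R * a n) * \int[P]_x W n x|))); last first.
    apply/funext => n; rewrite /eps.
    rewrite -[n%:R * a n * _]mulrA [`|n%:R * _|]normrM (@ger0_norm _ n%:R)//.
    ring.
  have c0 : 2 * `|(n%:R * a n) * \int[P]_x W n x| @[n --> \oo] --> (0 : R).
    rewrite -[X in _ --> X](mulr0 2) -[X in 2 * X](normr0 R).
    rewrite -[X in `|X| ](mulr0 (t * \int[P]_x (k x * g x))).
    by apply: cvgMl_tmp; apply: cvg_norm; exact: cvgM.
  rewrite (_ : 0 = 0 + C * (0 + 0 + 0 + 0 + 0 + 0)); last by ring.
  apply: cvgD => //; apply: cvgMl_tmp; apply: cvgD => //.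
  apply: cvgD; last exact: cvg_scaled_sqr ca.
  apply: cvgD => //; apply: cvgD => //; apply: cvgD => //.
  exact: cvg_scaled_sqr ctau.
have eta2 : 0 < eta / 2 by rewrite divr_gt0.
(* The drift error is divided by a standard deviation of at least [b], and [ncdf] is 1-Lipschitz.
   The threshold [c] drops out of the difference, whence the uniformity in [c]. *)
have etab : 0 < eta / 2 * b by rewrite mulr_gt0.
have nq1 : \forall n \near \oo, (0 < n)%N /\ quasi_density P (Q n) (W n) (e n).
  have n1 : \forall n \near \oo, (0 < n)%N by exists 1%N.
  by apply: filterS2 n1 nq => n.
have /cvgrPdist_le/(_ _ eta2) := ceps; have /cvgrPdist_le/(_ _ etab) := ca.
move: nq1; apply: filterS3 => n [n0 qd] h1.
rewrite sub0r normrN => /(le_trans (ler_norm _)) h2 c.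
have := @iid_sum_gt_ge _ _ _ P (Q n) (W n) (e n) (h n) b C delta (tau n) (a n)
  (eps n) b0 C0 hC qd (sh n) (h0 n) erefl erefl erefl n c 0.
rewrite etau// add0r.
set sig := Num.sqrt _ => h3.
have bsig : b <= sig.
  rewrite -[leLHS]ger0_norm ?(ltW b0)// -sqrtr_sqr ler_wsqrtr//.
  by rewrite lerDl Ege0// => x; exact: sqr_ge0.
have sig0 : 0 < sig by rewrite (lt_le_trans b0).
have h4 : `|ncdf ((t * \int[P]_x (k x * g x) - c - delta) / sig) -
   ncdf ((n%:R * a n - c - delta) / sig)| <= eta / 2.
  apply: le_trans (ncdf_lip _ _) _.
  rewrite -mulrBl normrM [`|sig^-1|]ger0_norm ?invr_ge0 ?(ltW sig0)//.
  rewrite ler_pdivrMr// (_ : _ - _ = t * \int[P]_x (k x * g x) - n%:R * a n).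
    by rewrite (le_trans h1)// ler_wpM2l// ltW.
  by ring.
have -> : [set x : n.-tuple X | c < (Num.sqrt n%:R)^-1 * tsum k x] =
    [set x | c < 0 + tsum (h n) x].
  by apply/seteqP; split=> x /=; rewrite add0r /tsum /h -mulr_sumr.
move: h4; rewrite ler_norml => /andP[_]; lra.
Qed.

End local_clt.

(** * Limits inferior and superior through eventual bounds *)

Section liminf_limsup.
Context {R : realType}.
Implicit Types (u : nat -> \bar R) (c eta : R).

Lemma limn_einf_near u c eta : (c%:E <= limn_einf u)%E -> 0 < eta ->
  \forall n \near \oo, ((c - eta)%:E <= u n)%E.
Proof.
move=> cu eta0.
have e : limn_einf u = ereal_sup (range (einfs u)).
  by rewrite limn_einf_lim; apply/cvg_lim => //; exact: cvg_einfs_sup.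
have : ((c - eta)%:E < ereal_sup (range (einfs u)))%E.
  by rewrite -e (lt_le_trans _ cu)// lte_fin ltrBlDr ltrDl.
move=> /ereal_sup_gt[_ [N _ <-] h]; exists N => // n /= Nn.
apply/ltW/(lt_le_trans h)/ereal_inf_lbound.
by exists n.
Qed.

Lemma near_limn_einf u c :
  (forall eta, 0 < eta -> \forall n \near \oo, ((c - eta)%:E <= u n)%E) ->
  (c%:E <= limn_einf u)%E.
Proof.
move=> h; have e : limn_einf u = ereal_sup (range (einfs u)).
  by rewrite limn_einf_lim; apply/cvg_lim => //; exact: cvg_einfs_sup.
rewrite e; apply/lee_subgt0Pr => eta eta0.
have [N _ hN] := h _ eta0.
apply: (@le_trans _ _ (einfs u N)); last by apply: ereal_sup_ubound; exists N.
apply: le_ereal_inf_tmp => _ [n /= Nn <-]; exact: hN.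
Qed.

Lemma near_limn_esup u c :
  (forall eta, 0 < eta -> \forall n \near \oo, (u n <= (c + eta)%:E)%E) ->
  (limn_esup u <= c%:E)%E.
Proof.
move=> h; rewrite -leeN2 -limn_einfN -EFinN; apply: near_limn_einf => eta eta0.
apply: filterS (h _ eta0) => n; rewrite /= -opprD EFinN leeN2//.
Qed.

End liminf_limsup.

(** * Unsmoothed limit bounds, and alternatives along a path *)

Section local_alternatives.
Context {d : measure_display} {X : measurableType d} {R : realType}.
Implicit Types (P : probability X R) (g k : X -> R).

Lemma local_clt_uniform P Q g k (t eta : R) : local_seq P Q g t -> sqi P g ->
  sqi P k -> \int[P]_x k x = 0 -> 0 < \int[P]_x k x ^+ 2 -> 0 < eta ->
  \forall n \near \oo, forall c : R,
  ncdf ((t * \int[P]_x (k x * g x) - c) / Num.sqrt (\int[P]_x k x ^+ 2)) - eta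
  <= iid_pr (Q n) [set x : n.-tuple X | c < (Num.sqrt n%:R)^-1 * tsum k x].
Proof.
move=> lQ sg sk k0 v0 eta0; set v := \int[P]_x k x ^+ 2 in v0 *.
set s := Num.sqrt v; have s0 : 0 < s by rewrite sqrtr_gt0.
have es : s ^+ 2 = v by rewrite sqr_sqrtr// ltW.
have eta4 : 0 < eta / 4 by rewrite divr_gt0.
have [M M0 hM] := ncdf_near1 eta4.
(* Four losses of eta/4: the tolerance in [local_clt], the shift by [delta], the term ncdf(- delta /
   b) since b <= delta / M, and the variance b^2 since b <= eta / (4 D). The constant [C] is taken
   at the fixed scale [s], so [D] does not depend on [b]. *)
pose delta := s * (eta / 4).
have delta0 : 0 < delta by rewrite mulr_gt0.
have [C [C0 hC]] : exists C : R, 0 <= C /\ forall y s' : R, s <= s' ->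
    `|ncdf (y / s') - ncdf (y / s)
     + (s' ^+ 2 - s ^+ 2) * (y / s * npdf (y / s)) / (2 * s ^+ 2)|
    <= C * (s' ^+ 2 - s ^+ 2) ^+ 2.
  exists (14 * (1 + s^-1) ^+ 5); split.
    by rewrite mulr_ge0// exprn_ge0// addr_ge0// invr_ge0 ltW.
  by move=> y s' ss'; exact: ncdf_time_le.
pose D := v^-1 + C.
have D0 : 0 < D by rewrite ltr_wpDr// invr_gt0.
pose b := Num.min 1 (Num.min (delta / M) (eta / 4 / D)).
have b0 : 0 < b by rewrite !lt_min ltr01 !divr_gt0.
have b1 : b <= 1 by rewrite ge_min lexx.
have bM : b <= delta / M by rewrite !ge_min lexx !orbT.
have bD : b <= eta / 4 / D by rewrite !ge_min lexx !orbT.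
have := local_clt delta lQ sg sk k0 b0 eta4; apply: filterS => n H c.
apply: le_trans (H c); rewrite -/v -/s.
have h1 : ncdf (- delta / b) <= eta / 4.
  rewrite mulNr ncdfN.
  have : 1 - eta / 4 <= ncdf (delta / b).
    by apply: hM; rewrite ler_pdivlMr// mulrC -ler_pdivlMr.
  lra.
set x := t * _ - c.
set s' := Num.sqrt (b ^+ 2 + v).
have es' : s' ^+ 2 - s ^+ 2 = b ^+ 2.
  by rewrite es sqr_sqrtr ?addr_ge0 ?sqr_ge0 ?(ltW v0)//; ring.
have ss' : s <= s' by rewrite ler_wsqrtr// lerDr sqr_ge0.
have h2 : ncdf ((x - delta) / s) - eta / 4 <= ncdf ((x - delta) / s').
  have := hC (x - delta) s' ss'; rewrite es' es.
  set q := (x - delta) / s * _ => h.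
  have q2 : `|q| <= 2 by rewrite normrM (ger0_norm (npdf_ge0 _)) npdf_abs_le.
  have h3 : b ^+ 2 * q / (2 * v) <= b ^+ 2 * v^-1.
    rewrite (_ : b ^+ 2 * q / (2 * v) = b ^+ 2 * v^-1 * (q / 2)); last first.
      by field; rewrite gt_eqF.
    have bv : 0 <= b ^+ 2 * v^-1.
      by apply: mulr_ge0; [exact: sqr_ge0|rewrite invr_ge0 ltW].
    apply: (ler_piMr bv).
    by move: q2; rewrite ler_norml; lra.
  have b2 : b ^+ 2 <= b by rewrite expr2 ler_piMr// ltW.
  have b4 : (b ^+ 2) ^+ 2 <= b.
    by rewrite expr2 (le_trans _ b2)// ler_piMr ?sqr_ge0// (le_trans b2).
  have h4 : b * D <= eta / 4 by rewrite -ler_pdivlMr.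
  have h5 : b ^+ 2 * v^-1 <= b * v^-1 by rewrite ler_wpM2r ?invr_ge0 ?(ltW v0).
  have h6 : C * (b ^+ 2) ^+ 2 <= C * b by rewrite ler_wpM2l.
  have h7 : b * D = b * v^-1 + C * b by rewrite /D; ring.
  by move: h; rewrite ler_norml => /andP[h _]; lra.
have h8 : ncdf (x / s) - eta / 4 <= ncdf ((x - delta) / s).
  have := ncdf_lip (x / s) ((x - delta) / s).
  rewrite (_ : x / s - (x - delta) / s = eta / 4); last first.
    by rewrite /delta; field; rewrite gt_eqF.
  by rewrite (ger0_norm (ltW eta4)) ler_norml => /andP[_]; lra.
lra.
Qed.

Lemma measurable_mfun_gt n (f : n.-tuple X -> R) (c : R) :
  measurable_fun setT f -> measurable [set x | c < f x].
Proof.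
move=> mf; have := mf measurableT _ (measurable_itv `]c, +oo[); rewrite setTI.
by congr measurable; apply/seteqP; split=> x /=; rewrite in_itv/= andbT.
Qed.

Lemma measurable_mfun_le n (f : n.-tuple X -> R) (c : R) :
  measurable_fun setT f -> measurable [set x | f x <= c].
Proof.
move=> mf; have := mf measurableT _ (measurable_itv `]-oo, c]); rewrite setTI.
by congr measurable; apply/seteqP; split=> x /=; rewrite in_itv/=.
Qed.

(* By contiguity the linearization holds under the local alternatives too. *)
Lemma asymp_linear_gt P Q g k (Y : forall n, n.-tuple X -> R) (t eta : R) :
  local_seq P Q g t -> sqi P g ->
  sqi P k -> \int[P]_x k x = 0 -> 0 < \int[P]_x k x ^+ 2 ->
  (forall n, measurable_fun setT (Y n)) ->
  (forall e : R, 0 < e -> iid_pr P [set x : n.-tuple X |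
     e < `|Y n x - (Num.sqrt n%:R)^-1 * tsum k x| ] @[n --> \oo] --> (0 : R)) ->
  0 < eta ->
  \forall n \near \oo, forall c : R,
  ncdf ((t * \int[P]_x (k x * g x) - c) / Num.sqrt (\int[P]_x k x ^+ 2)) - eta
  <= iid_pr (Q n) [set x : n.-tuple X | c < Y n x].
Proof.
move=> lQ sg sk k0 v0 mY lY eta0.
set s := Num.sqrt _; have s0 : 0 < s by rewrite sqrtr_gt0.
have eta3 : 0 < eta / 3 by rewrite divr_gt0.
pose e := s * (eta / 3).
have e0 : 0 < e by rewrite mulr_gt0.
pose Delta n (x : n.-tuple X) := (Num.sqrt n%:R)^-1 * tsum k x.
have mDelta n : measurable_fun setT (@Delta n).
  by apply: measurable_funM => //; apply: measurable_tsum; exact: sk.1.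
pose A n := [set x : n.-tuple X | e < `|Y n x - Delta n x| ].
have mA n : measurable (A n).
  have mYD : measurable_fun setT (fun x => Y n x - Delta n x).
    by apply: measurable_funB; [exact: mY|exact: mDelta].
  by apply: measurable_mfun_gt; exact: measurableT_comp mYD.
have := contiguity lQ sg mA (lY _ e0).
move=> /cvgrPdist_le/(_ _ eta3).
apply: filterS2 (local_clt_uniform lQ sg sk k0 v0 eta3) => n H.
rewrite sub0r normrN (ger0_norm (iid_pr_ge0 _ _)) => hA c.
have := H (c + e).
have mB : measurable [set x | c + e < Delta n x] by exact: measurable_mfun_gt.
have mC : measurable [set x | c < Y n x] by exact: measurable_mfun_gt.
have : iid_pr (Q n) [set x | c + e < Delta n x] <=
    iid_pr (Q n) [set x | c < Y n x] + iid_pr (Q n) (A n).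
  apply: le_trans (iid_prU_le _ mC (mA n)).
  apply: (le_iid_pr _ mB (measurableU _ _ mC (mA n))).
  move=> x /= h; have [?|h1] := ltP c (Y n x); [by left|right].
  rewrite /A /= distrC; apply: lt_le_trans (ler_norm _); lra.
rewrite -/s -/(Delta n).
have := ncdf_lip ((t * \int[P]_x (k x * g x) - c) / s)
  ((t * \int[P]_x (k x * g x) - (c + e)) / s).
rewrite (_ : _ / s - _ / s = eta / 3); last by rewrite /e; field; rewrite gt_eqF.
rewrite (ger0_norm (ltW eta3)) ler_norml => /andP[_]; rewrite /Delta; lra.
Qed.

Lemma cvg_local_param (tn : nat -> R) (t : R) : cvg_in_pos tn t ->
  tn n / Num.sqrt n%:R @[n --> \oo] --> 0^'+.
Proof.
move=> [tn0 t0 ctn].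
have cs0 : tn n / Num.sqrt n%:R @[n --> \oo] --> (0 : R).
  by rewrite -[X in _ --> X](mulr0 t); apply: cvgM => //; exact: cvg_sqrtn_inv.
move=> A [e /= e0 hA].
have /cvgrPdist_lt/(_ _ e0) := cs0.
have n1 : \forall n \near \oo, (0 < n)%N by exists 1%N.
apply: filterS2 n1 => n n0 hs; apply: hA => //.
by rewrite divr_gt0// sqrtn_gt0.
Qed.

(** With s = t_n / sqrt n, a remainder rho = o(s) gives the lost mass e = rho^2, and n e = t_n^2
    (rho / s)^2 tends to 0. Passing from t_n to t costs (t_n - t)^2 E g^2. *)
Lemma path_local_seq (Pm : set (probability X R)) P (g : X -> R) Q (tn : nat -> R) (t : R) :
  sqi P g -> path_with_tangent Pm P g Q -> cvg_in_pos tn t ->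
  local_seq P (fun n => local_alt Q n (tn n)) g t.
Proof.
move=> sg [_ cQ] htn; have [tn0 t0 ctn] := htn.
pose s n := tn n / Num.sqrt n%:R.
have s0 n : (0 < n)%N -> 0 < s n by move=> n0; rewrite divr_gt0// sqrtn_gt0.
have cs : s n @[n --> \oo] --> 0^'+ by exact: (cvg_local_param htn).
pose rho n := path_remainder P g (s n) (Q (s n)).
have : ((s n)^-1%:E * rho n)%E @[n --> \oo] --> 0%E.
  exact: (cvg_comp s (fun s => s^-1%:E * path_remainder P g s (Q s))%E cs cQ).
move=> /fine_cvgP[fin crho].
pose r n := s n * fine ((s n)^-1%:E * rho n)%E.
have rhoE : \forall n \near \oo, [/\ (0 < n)%N, 0 <= r n & (rho n <= (r n)%:E)%E].
  have n1 : \forall n \near \oo, (0 < n)%N by exists 1%N.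
  apply: filterS2 n1 fin => n n0 fn; split => //.
    rewrite mulr_ge0 ?(ltW (s0 _ n0))// fine_ge0// mule_ge0 ?Lnorm_ge0//.
    by rewrite lee_fin invr_ge0 ltW// s0.
  rewrite EFinM fineK// muleA -EFinM divff ?mul1e//.
  by rewrite gt_eqF// s0.
pose e n := r n ^+ 2.
have /choice[W hW] : forall n, exists W, sqi P W /\
    ([/\ (0 < n)%N, 0 <= r n & (rho n <= (r n)%:E)%E] ->
     quasi_density P (Q (s n)) W (e n) /\
     \int[P]_x (W x - 2^-1 * s n * g x) ^+ 2 <= e n).
  move=> n; have [[n0 r0 hr]|h] :=
      pselect [/\ (0 < n)%N, 0 <= r n & (rho n <= (r n)%:E)%E].
    have [W [qd hW]] := path_remainder_quasi_density sg r0 hr.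
    by exists W; split => //; case: qd.
  by exists (fun=> 0); split; [exact: sqi_cst|move=> /h].
have ce : n%:R * e n @[n --> \oo] --> (0 : R).
  have c : tn n ^+ 2 * fine ((s n)^-1%:E * rho n)%E ^+ 2 @[n --> \oo] --> (0 : R).
    rewrite -[X in _ --> X](mulr0 (t ^+ 2)) -[X in _ * X](mul0r 0).
    by apply: cvgM; [exact: cvgM|exact: cvgM].
  apply: cvg_trans c; apply: near_eq_cvg; exists 1%N => // n /= n0.
  rewrite /e /r exprMn [in RHS]mulrA; congr (_ * _).
  rewrite /s expr_div_n sqrtn_sqr mulrCA divff ?mulr1//.
  by rewrite pnatr_eq0 -lt0n.
exists W, e; split => //.
- by move=> n; case: (hW n).
- split; [by move=> n; apply: sqiZ; case: (hW n)|exact: sqiZ|].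
  have c : 2 * (n%:R * e n) + (tn n - t) ^+ 2 * \int[P]_x g x ^+ 2
      @[n --> \oo] --> (0 : R).
    rewrite -[X in _ --> X](addr0 0) -[X in X + _](mulr0 2).
    rewrite -[X in _ + X](mul0r (\int[P]_x g x ^+ 2)).
    apply: cvgD; first exact: cvgMl_tmp.
    apply: cvgMr_tmp; rewrite -[X in _ --> X](mul0r 0).
    have ct0 : tn n - t @[n --> \oo] --> (0 : R).
      by rewrite -[X in _ --> X](subrr t); apply: cvgB => //; exact: cvg_cst.
    exact: cvgM.
  apply: (squeeze_cvgr _ (cvg_cst 0) c).
  apply: filterS rhoE => n hn; have [sW /(_ hn)[_ hWn]] := hW n.
  have [n0 _ _] := hn.
  rewrite Ege0/=; last by move=> x; exact: sqr_ge0.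
  have sD : sqi P (fun x => W n x - 2^-1 * s n * g x) by apply: sqiB => //; exact: sqiZ.
  apply: (@le_trans _ _ (2 * (n%:R * \int[P]_x (W n x - 2^-1 * s n * g x) ^+ 2) +
    (tn n - t) ^+ 2 * \int[P]_x g x ^+ 2)); last first.
    by rewrite lerD2r !ler_wpM2l.
  rewrite mulrA -(EZ _ sD.2) -(EZ _ sg.2) -(ED (integZ _ sD.2) (integZ _ sg.2)).
  apply: Ele.
  + have : sqi P (fun x => Num.sqrt n%:R * W n x - 2^-1 * t * g x).
      by apply: sqiB; exact: sqiZ.
    by case.
  + by apply: integD; apply: integZ; [exact: sD.2|exact: sg.2].
  move=> x; have es : Num.sqrt n%:R * s n = tn n.
    by rewrite /s mulrC divfK// gt_eqF// sqrtn_gt0.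
  have -> : Num.sqrt n%:R * W n x - 2^-1 * t * g x =
     Num.sqrt n%:R * (W n x - 2^-1 * s n * g x) + (tn n - t) * g x / 2.
    by rewrite -es; field.
  rewrite -[in leRHS](sqrtn_sqr n).
  set y := Num.sqrt n%:R; set z := W n x - _; set v := (tn n - t) * g x.
  rewrite -exprMn -/v (_ : 2 * y ^+ 2 * z ^+ 2 = 2 * (y * z) ^+ 2); last by ring.
  by have := sqr_ge0 (y * z - v / 2); have := sqr_ge0 v; rewrite !expr2; lra.
- by apply: filterS rhoE => n hn; have [_ /(_ hn)[]] := hW n.
Qed.

(* Only the inclusion of [A n] in the complement of [B m n] matters, so that this
   serves for both sides. *)
Lemma local_test_le P (k0 : R) (g : nat -> X -> R) (Q : nat -> nat -> probability X R)
    (A : forall n, set (n.-tuple X)) (B : nat -> forall n, set (n.-tuple X))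
    (t eta : R) :
  (forall m, sqi P (g m)) ->
  (\forall m \near \oo, local_seq P (Q m) (g m) t) ->
  \int[P]_x (g m x) ^+ 2 @[m --> \oo] --> k0 ^+ 2 -> 0 <= t -> 0 <= k0 ->
  (forall n, measurable (A n)) -> (forall m n, measurable (B m n)) ->
  (\forall m \near \oo, \forall n \near \oo, A n `<=` ~` B m n) ->
  ((2^-1)%:E <= limn_einf (fun m => limn_einf (fun n =>
     iid_power (Q m n) n (B m n))))%E ->
  0 < eta ->
  \forall n \near \oo, iid_pr P (A n) <= ncdf (t * k0) + eta.
Proof.
move=> sg lQ cg t0 k00 mA mB AB hB eta0.
have eta4 : 0 < eta / 4 by rewrite divr_gt0.
have eta8 : 0 < eta / 16 by rewrite divr_gt0.
have csq : Num.sqrt (t ^+ 2 * \int[P]_x g m x ^+ 2) @[m --> \oo] --> t * k0.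
  rewrite -[X in _ --> X]ger0_norm ?mulr_ge0// -sqrtr_sqr exprMn.
  apply: (cvg_comp (fun m => t ^+ 2 * \int[P]_x g m x ^+ 2) (@Num.sqrt R));
    last exact: sqrt_continuous.
  exact: cvgMl_tmp.
have /cvgrPdist_le/(_ _ eta4) h1 := csq.
have h2 := limn_einf_near hB eta8.
(* The limit in m is the outer one: a single good m is fixed, and only then does n grow. *)
have [m [lm ABm hm1 hm2]] : exists m, [/\ local_seq P (Q m) (g m) t,
    \forall n \near \oo, A n `<=` ~` B m n,
    `|t * k0 - Num.sqrt (t ^+ 2 * \int[P]_x g m x ^+ 2)| <= eta / 4 &
    ((2^-1 - eta / 16)%:E <= limn_einf (fun n =>
     iid_power (Q m n) n (B m n)))%E].
  by near \oo => m; exists m; split; near: m.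
have h3 := limn_einf_near hm2 eta8.
have eta8' : 0 < eta / 8 by rewrite divr_gt0.
(* The level 1/2 + eta/8 costs eta/4. The smoothing b = eta/4 costs another eta/4, as the root of
   b^2 + v is at most b plus the root of v, and so does replacing that root by t k0. *)
have := testing_half lm (sg m) eta4 eta8'.
move: ABm h3; apply: filterS3 => n ABn h3 /(_ _ (mA n)) H.
apply: le_trans (H _) _.
  have : iid_pr (Q m n) (A n) <= 1 - iid_pr (Q m n) (B m n).
    by rewrite -iid_prC//; exact: (le_iid_pr _ (mA n) (measurableC (mB m n)) ABn).
  move: h3; rewrite iid_prE// lee_fin; lra.
set v := t ^+ 2 * _ in hm1 *.
have v0 : 0 <= v.
  by rewrite mulr_ge0 ?sqr_ge0// Ege0// => x; exact: sqr_ge0.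
have h4 : Num.sqrt ((eta / 4) ^+ 2 + v) <= eta / 4 + Num.sqrt v.
  rewrite -[leRHS]ger0_norm ?addr_ge0 ?(ltW eta4)// -sqrtr_sqr ler_wsqrtr//.
  have vv : Num.sqrt v ^+ 2 = v by rewrite sqr_sqrtr.
  rewrite sqrrD vv; have := mulr_ge0 (ltW eta4) (sqrtr_ge0 v).
  by rewrite -mulr_natl; lra.
have := ncdf_nd h4; have := ncdf_lip (eta / 4 + Num.sqrt v) (t * k0).
move: hm1; rewrite !ler_norml => /andP[h5 h6].
have h7 : `|eta / 4 + Num.sqrt v - t * k0| <= eta / 2.
  by rewrite ler_norml; lra.
move=> /andP[_ h8] h9; lra.
Unshelve. all: by end_near. Qed.

End local_alternatives.

(** * Projections on a cone and on a linear space *)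

Section projections.
Context {d : measure_display} {X : measurableType d} {R : realType}.
Variable P : probability X R.
Implicit Types (f g h k : L2 P) (G : set (L2 P)).

Lemma L2_scaleE (c : R) f x : (c *: f) x = c * f x.
Proof. by []. Qed.

Lemma L2_lincombE (c1 c2 : R) f g x : (c1 *: f + c2 *: g) x = c1 * f x + c2 * g x.
Proof. by []. Qed.

Lemma L2cvgP (u : nat -> L2 P) f : L2cvg u f <-> l2lim P u f.
Proof.
have sD m : sqi P (fun x => u m x - f x) by apply: sqiB; exact: L2_sqi.
rewrite /L2cvg; split=> [h|[_ _ h]].
  split; [by move=> m; exact: L2_sqi|exact: L2_sqi|].
  have hh : L2norm P (u m \- f) * L2norm P (u m \- f) @[m --> \oo] --> (0 : R).
    by rewrite -[X in _ --> X](mul0r 0); exact: cvgM.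
  apply: cvg_trans hh; apply: near_eq_cvg; apply: nearW => m.
  by rewrite -expr2 (L2norm_sqr (sD m)).
apply: cvg_sqr0.
apply: cvg_trans h; apply: near_eq_cvg; apply: nearW => m.
by rewrite (L2norm_sqr (sD m)).
Qed.

(** The ray through [k] lies in the closed cone, so c = 1 minimises the quadratic c^2 v - 2 c w over
    c >= 0. Comparison with c = 0 gives w >= 0, which admits c = w / v, and this choice forces (w -
    v)^2 <= 0. *)
Lemma closest_element_cone_dot G (kappa k : L2 P) : convex_cone G ->
  closest_element (L2closure G) kappa k -> 0 < \int[P]_x k x ^+ 2 ->
  L2dot P kappa k = \int[P]_x k x ^+ 2.
Proof.
move=> cG [[u [Gu uk]] hk]; set v := \int[P]_x k x ^+ 2 => v0.
set w := L2dot P kappa k.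
have sk := L2_sqi k; have skp := L2_sqi kappa; have ikk := sqi_mul skp sk.
have expand (c : R) : \int[P]_x (kappa x - c * k x) ^+ 2 =
    \int[P]_x kappa x ^+ 2 - 2 * c * w + c ^+ 2 * v.
  rewrite (_ : (fun x => _) = (fun x => kappa x ^+ 2 -
     2 * c * (kappa x * k x) + c ^+ 2 * k x ^+ 2)); last first.
    by apply/funext => x; ring.
  have i2 := integZ (2 * c) ikk; have i3 := integZ (c ^+ 2) sk.2.
  by rewrite (ED (integB skp.2 i2) i3) (EB skp.2 i2) (EZ _ ikk) (EZ _ sk.2).
have H (c : R) : 0 <= c -> - 2 * w + v <= - 2 * c * w + c ^+ 2 * v.
  move=> c0; have ck : L2closure G (c *: k).
    exists (fun m => c *: u m + 0 *: u m); split; first by move=> m; exact: cG.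
    apply/L2cvgP; split; [by move=> m; exact: L2_sqi|exact: L2_sqi|].
    have /L2cvgP[_ _ cu] := uk.
    have sD m : sqi P (fun x => u m x - k x) by apply: sqiB; exact: L2_sqi.
    rewrite (_ : (fun m => _) = (fun m => c ^+ 2 * \int[P]_x (u m x - k x) ^+ 2)).
      by rewrite -[X in _ --> X](mulr0 (c ^+ 2)); exact: cvgMl_tmp.
    apply/funext => m; rewrite -(EZ _ (sD m).2); apply: eq_Rintegral => x _.
    by rewrite L2_lincombE L2_scaleE; ring.
  have := hk _ ck.
  have s1 : sqi P (kappa \- k) by exact: sqiB.
  have s2 : sqi P (kappa \- (c *: k)) by apply: sqiB => //; exact: L2_sqi.
  rewrite -(@ler_pXn2r _ 2) ?nnegrE ?L2norm_ge0// (L2norm_sqr s1) (L2norm_sqr s2).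
  have -> : \int[P]_x (kappa \- k) x ^+ 2 = \int[P]_x (kappa x - 1 * k x) ^+ 2.
    by apply: eq_Rintegral => x _; rewrite mul1r.
  have -> : \int[P]_x (kappa \- (c *: k)) x ^+ 2 = \int[P]_x (kappa x - c * k x) ^+ 2.
    by [].
  rewrite !expand; lra.
have w0 : 0 <= w by have := H 0 (lexx _); lra.
have := H (w / v) (divr_ge0 w0 (ltW v0)).
have -> : - 2 * (w / v) * w + (w / v) ^+ 2 * v = - (w ^+ 2 / v).
  by field; rewrite gt_eqF.
have e : w ^+ 2 / v * v = w ^+ 2 by rewrite divfK ?gt_eqF.
move: (w ^+ 2 / v) e => q e /(ler_wpM2r (ltW v0)) h.
have : (w - v) ^+ 2 <= 0 by lra.
by rewrite le_eqVlt ltNge sqr_ge0 orbF sqrf_eq0 subr_eq0 => /eqP.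
Qed.

Lemma orthogonal_projection_dot G (kappa k : L2 P) :
  orthogonal_projection (L2closure G) kappa k ->
  L2dot P kappa k = \int[P]_x k x ^+ 2.
Proof.
move=> [Gk /(_ k Gk)]; rewrite /L2dot.
have sk := L2_sqi k; have skp := L2_sqi kappa; have ikk := sqi_mul skp sk.
under eq_Rintegral do rewrite /= mulrBl -expr2.
by rewrite (EB ikk sk.2) => /eqP; rewrite subr_eq0 => /eqP.
Qed.

End projections.

(** * Bounds for one tail and their attainment *)

Section concentration.
Context {d : measure_display} {X : measurableType d} {R : realType}.
Variables (Pm : set (probability X R)) (P : probability X R).
Variables (T : probability X R -> R) (kappa : L2 P).
Hypothesis hT : influence_curve Pm T kappa.
Variable path : L2 P -> R -> probability X R.
Hypothesis hpath : forall g : L2 P, tangent_set Pm P g ->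
  path_with_tangent Pm P g (path g).
Implicit Types (g k : L2 P) (tn : nat -> R) (t : R).

Local Notation G := (tangent_set Pm P).
Local Notation alt g n t := (local_alt (path g) n t).

Lemma tangent_local_seq g tn t : G g -> cvg_in_pos tn t ->
  local_seq P (fun n => alt g n (tn n)) g t.
Proof.
by move=> Gg htn; apply: path_local_seq (hpath Gg) htn; exact: L2_sqi.
Qed.

Lemma tangent_E0 g : G g -> \int[P]_x g x = 0.
Proof.
move=> Gg; have h1 : cvg_in_pos (fun=> 1 : R) 1 by split => //; exact: cvg_cst.
exact: tangent_mean0 (tangent_local_seq Gg h1) (L2_sqi g) (oner_neq0 R).
Qed.

Lemma closure_E0 k : L2closure G k -> \int[P]_x k x = 0.
Proof.
move=> [u [Gu /L2cvgP uk]]; have := l2lim_E uk.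
under eq_fun do rewrite tangent_E0//.
by move=> h; apply: cvg_unique h (cvg_cst _).
Qed.

Lemma functional_expansion g tn t : G g -> cvg_in_pos tn t ->
  Num.sqrt n%:R * (T (alt g n (tn n)) - T P) @[n --> \oo] --> t * L2dot P kappa g.
Proof.
move=> Gg htn; have [tn0 t0 ctn] := htn.
have c := cvg_comp _ _ (cvg_local_param htn) (hT Gg (hpath Gg)).
have c2 : tn n * ((T (path g (tn n / Num.sqrt n%:R)) - T P
    - tn n / Num.sqrt n%:R * L2dot P kappa g) / (tn n / Num.sqrt n%:R))
    + tn n * L2dot P kappa g @[n --> \oo] --> t * L2dot P kappa g.
  rewrite -[X in _ --> X]add0r -[X in X + _](mulr0 t).
  by apply: cvgD; [exact: cvgM|exact: cvgMr_tmp].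
apply: cvg_trans c2; apply: near_eq_cvg.
exists 1%N => // n /= n0; rewrite /local_alt.
have s0 : Num.sqrt n%:R != 0 :> R by rewrite gt_eqF// sqrtn_gt0.
have tn_neq0 : tn n != 0 by rewrite gt_eqF.
by field; rewrite s0 tn_neq0.
Qed.

Lemma measurable_rescaled_error (S : estimator_seq X R) (th : R) n :
  measurable_fun setT (rescaled_error S th (n := n)).
Proof. by apply: measurable_funM => //; apply: measurable_funB. Qed.

Variable k : L2 P.
Hypothesis k0 : L2nonzero P k.
(** This identity holds for the cone and for the linear projection alike, so both cases can share
    the arguments below. *)
Hypothesis kdot : L2dot P kappa k = \int[P]_x k x ^+ 2.

Let nk : 0 < L2norm P k. Proof. exact: L2nonzero_norm (L2_sqi k) k0. Qed.

Let nk2 : L2norm P k ^+ 2 = \int[P]_x k x ^+ 2.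
Proof. exact: L2norm_sqr (L2_sqi k). Qed.

(* The two signs [sg] give the two tails. *)
Lemma sided_bound (sg : R) (S : estimator_seq X R) (g : nat -> L2 P)
    (B : R -> nat -> forall n, set (n.-tuple X)) tn t (eta : R) :
  sg ^+ 2 = 1 -> (forall m, G (g m)) -> L2cvg g (sg *: k) ->
  (forall s m n, measurable (B s m n)) ->
  (forall s m n x, B s m n x -> sg * (Num.sqrt n%:R * (T (alt (g m) n s) - T P)) <=
    sg * rescaled_error S (T P) x) ->
  (forall s, 0 < s -> ((2^-1)%:E <= limn_einf (fun m => limn_einf (fun n =>
     iid_power (alt (g m) n s) n (B s m n))))%E) ->
  cvg_in_pos tn t -> 0 < eta ->
  \forall n \near \oo, iid_pr P [set x : n.-tuple X |
    sg * rescaled_error S (T P) x < tn n] <= ncdf (t / L2norm P k) + eta.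
Proof.
move=> sg2 Gg /L2cvgP gk mB hB h12 [tn0 t0 ctn] eta0.
have Np := nk; have NE := nk2; set N := L2norm P k in Np NE *.
pose rho := eta * N / 8; have rho0 : 0 < rho by rewrite divr_gt0// mulr_gt0.
(* The excess over t / N^2 moves the rescaled functional to t + 4 rho. The errors from g_m, from the
   expansion of [T] and from t_n take at most rho each, which leaves the two events disjoint; the
   price is eta/2 in t' N. *)
pose t' := t / N ^+ 2 + eta / (2 * N).
have t'0 : 0 < t' by rewrite addr_gt0// divr_gt0// ?exprn_gt0// mulr_gt0.
have ht' : cvg_in_pos (fun=> t') t' by split => //; exact: cvg_cst.
have N0 : N != 0 by rewrite gt_eqF.
have t'N : t' * N = t / N + eta / 2 by rewrite /t'; field.
have t'N2 : t' * N ^+ 2 = t + 4 * rho by rewrite /t' /rho; field.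
have cdot : sg * L2dot P kappa (g m) @[m --> \oo] --> N ^+ 2.
  have e : L2dot P kappa k = sg * (sg * L2dot P kappa k).
    by rewrite mulrA -expr2 sg2 mul1r.
  rewrite NE -kdot e.
  apply: cvgMl_tmp; rewrite /L2dot.
  rewrite (_ : sg * _ = \int[P]_x (kappa x * (sg *: k) x)).
    exact: (l2lim_dot (l2lim_cst (L2_sqi kappa)) gk).
  rewrite -EZ; last by apply: sqi_mul; exact: L2_sqi.
  by apply: eq_Rintegral => x _; rewrite L2_scaleE mulrCA.
have csq : \int[P]_x g m x ^+ 2 @[m --> \oo] --> N ^+ 2.
  rewrite NE (_ : \int[P]_x k x ^+ 2 = \int[P]_x (sg *: k) x ^+ 2).
    exact: l2lim_sqr gk.
  by apply: eq_Rintegral => x _; rewrite L2_scaleE exprMn sg2 mul1r.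
have eta2 : 0 < eta / 2 by rewrite divr_gt0.
have mA n : measurable [set x : n.-tuple X | sg * rescaled_error S (T P) x < tn n].
  have mE : measurable_fun setT (fun x : n.-tuple X => sg * rescaled_error S (T P) x).
    by apply: measurable_funM => //; exact: measurable_rescaled_error.
  rewrite (_ : [set _ | _] = ~` [set x | tn n <= sg * rescaled_error S (T P) x]).
    apply: measurableC; rewrite (_ : [set _ | _] =
      [set x | - (sg * rescaled_error S (T P) x) <= - tn n]).
      by apply: measurable_mfun_le; exact: measurable_funN.
    by apply/seteqP; split=> x /=; rewrite lerN2.
  by apply/seteqP; split=> x /=; rewrite ltNge => /negP.
have := @local_test_le _ _ _ P N (fun m => g m) (fun m n => alt (g m) n t')
  (fun n => [set x : n.-tuple X | sg * rescaled_error S (T P) x < tn n])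
  (B t') t' (eta / 2) (fun m => L2_sqi (g m)) _ csq (ltW t'0) (ltW Np) mA (mB t')
  _ (h12 _ t'0) eta2.
have lQ : \forall m \near \oo, local_seq P (fun n => alt (g m) n t') (g m) t'.
  by apply: nearW => m; exact: tangent_local_seq ht'.
move=> /(_ lQ) H; apply: filterS (H _).
  move=> n /le_trans; apply; rewrite t'N.
  have := ncdf_lip (t / N + eta / 2) (t / N).
  by rewrite addrAC subrr add0r (ger0_norm (ltW eta2)) ler_norml => /andP[_]; lra.
have ctD : t' * (sg * L2dot P kappa (g m)) @[m --> \oo] --> t' * N ^+ 2 by exact: cvgMl_tmp.
have /cvgrPdist_le/(_ _ rho0) := ctD; apply: filterS => m.
rewrite t'N2 ler_norml => /andP[_ hm].
have cTm : sg * (Num.sqrt n%:R * (T (alt (g m) n t') - T P)) @[n --> \oo]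
    --> sg * (t' * L2dot P kappa (g m)).
  by apply: cvgMl_tmp; exact: functional_expansion (Gg m) ht'.
have /cvgrPdist_le/(_ _ rho0) := cTm; have /cvgrPdist_le/(_ _ rho0) := ctn.
apply: filterS2 => n; rewrite !ler_norml => /andP[hn1 hn2] /andP[hn3 hn4] x /= hx hBx.
have := hB _ _ _ _ hBx; rewrite mulrCA in hn4; lra.
Qed.

Lemma sided_asymp_linear (sg : R) (S : estimator_seq X R) : sg ^+ 2 = 1 ->
  asymp_linear P T S k -> forall e : R, 0 < e ->
  iid_pr P [set x : n.-tuple X |
    e < `|sg * rescaled_error S (T P) x -
      (Num.sqrt n%:R)^-1 * tsum (fun x => sg * k x) x| ] @[n --> \oo] --> (0 : R).
Proof.
move=> sg2 lS e.
have sgN : `|sg| = 1 by rewrite -sqrtr_sqr sg2 sqrtr1.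
move=> e0; have /fine_cvgP[_] := lS _ e0; apply: cvg_trans; apply: near_eq_cvg.
apply: nearW => n; rewrite /= /iid_pr; congr (fine (iid_power _ _ _)).
have eY (x : n.-tuple X) : sg * rescaled_error S (T P) x -
    (Num.sqrt n%:R)^-1 * tsum (fun x => sg * k x) x =
    sg * (rescaled_error S (T P) x -
      (Num.sqrt n%:R)^-1 * \sum_(i < n) k (tnth x i)).
  by rewrite /tsum -mulr_sumr; ring.
by apply/seteqP; split=> x /=; rewrite eY normrM sgN mul1r.
Qed.

(** Under the alternative the signed error is centred near t sg <k, g_m>, while the functional moves
    by t sg <kappa, g_m>. For fixed m these may differ, so the limit bound is ncdf(t D m / N); as m
    grows both inner products, with their sign, tend to N^2 and the bound tends to 1/2. *)
Lemma sided_attained (sg : R) (S : estimator_seq X R) (g : nat -> L2 P)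
    (B : nat -> forall n, set (n.-tuple X)) tn t :
  sg ^+ 2 = 1 -> L2closure G k -> asymp_linear P T S k ->
  (forall m, G (g m)) -> L2cvg g (sg *: k) ->
  (forall m n, measurable (B m n)) ->
  (forall m n x, (0 < n)%N ->
    sg * (Num.sqrt n%:R * (T (alt (g m) n (tn n)) - T P)) <
    sg * rescaled_error S (T P) x -> B m n x) ->
  cvg_in_pos tn t ->
  ((2^-1)%:E <= limn_einf (fun m => limn_einf (fun n =>
     iid_power (alt (g m) n (tn n)) n (B m n))))%E.
Proof.
move=> sg2 kG lS Gg /L2cvgP gk mB hB htn.
have Np := nk; have NE := nk2; set N := L2norm P k in Np NE *.
have N0 : N != 0 by rewrite gt_eqF.
have sk : sqi P (fun x => sg * k x) by apply: sqiZ; exact: L2_sqi.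
have sgk0 : \int[P]_x (sg * k x) = 0.
  by rewrite EZ ?(closure_E0 kG) ?mulr0//; apply: sqi_integ; exact: L2_sqi.
have sgk2 : \int[P]_x (sg * k x) ^+ 2 = N ^+ 2.
  by rewrite NE; apply: eq_Rintegral => x _; rewrite exprMn sg2 mul1r.
have sgkp : 0 < \int[P]_x (sg * k x) ^+ 2 by rewrite sgk2 exprn_gt0.
have mY n : measurable_fun setT (fun x : n.-tuple X => sg * rescaled_error S (T P) x).
  by apply: measurable_funM => //; exact: measurable_rescaled_error.
have lY := sided_asymp_linear sg2 lS.
pose D m := sg * \int[P]_x (k x * g m x) - sg * L2dot P kappa (g m).
have cD : t * D m / N @[m --> \oo] --> (0 : R).
  have c1 : \int[P]_x (k x * g m x) @[m --> \oo] --> sg * N ^+ 2.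
    rewrite (_ : sg * _ = \int[P]_x (k x * (sg *: k) x)).
      exact: (l2lim_dot (l2lim_cst (L2_sqi k)) gk).
    rewrite NE -EZ; last exact: (L2_sqi k).2.
    by apply: eq_Rintegral => x _; rewrite L2_scaleE; ring.
  have c2 : L2dot P kappa (g m) @[m --> \oo] --> sg * N ^+ 2.
    rewrite (_ : sg * _ = \int[P]_x (kappa x * (sg *: k) x)).
      exact: (l2lim_dot (l2lim_cst (L2_sqi kappa)) gk).
    rewrite NE -kdot -EZ; last by apply: sqi_mul; exact: L2_sqi.
    by apply: eq_Rintegral => x _; rewrite L2_scaleE; ring.
  rewrite -[X in _ --> X](mul0r N^-1) -[X in X / _](mulr0 t).
  rewrite -[X in t * X](subrr (sg * (sg * N ^+ 2))).
  apply: cvgMr_tmp; apply: cvgMl_tmp.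
  by apply: cvgB; exact: cvgMl_tmp.
have key m (eta : R) : 0 < eta -> \forall n \near \oo,
    ncdf (t * D m / N) - eta <= iid_pr (alt (g m) n (tn n)) (B m n).
  move=> eta0; have eta2 : 0 < eta / 2 by rewrite divr_gt0.
  have eN : 0 < eta / 2 * N by rewrite mulr_gt0.
  have lQ := tangent_local_seq (Gg m) htn.
  have sgm := L2_sqi (g m).
  have H := asymp_linear_gt lQ sgm sk sgk0 sgkp mY lY eta2.
  have cT : sg * (Num.sqrt n%:R * (T (alt (g m) n (tn n)) - T P)) @[n --> \oo]
      --> sg * (t * L2dot P kappa (g m)).
    by apply: cvgMl_tmp; exact: functional_expansion (Gg m) htn.
  have /cvgrPdist_le/(_ _ eN) := cT.
  have n1 : \forall n \near \oo, (0 < n)%N by exists 1%N.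
  move: n1 H; apply: filterS3 => n n0 H hT'.
  set c := sg * (Num.sqrt n%:R * (T (alt (g m) n (tn n)) - T P)) in hT'.
  have := H c; rewrite sgk2 sqrtr_sqr (gtr0_norm Np).
  have Ek : \int[P]_x (sg * k x * g m x) = sg * \int[P]_x (k x * g m x).
    rewrite -EZ; last by apply: sqi_mul; exact: L2_sqi.
    by apply: eq_Rintegral => x _; rewrite mulrA.
  rewrite Ek => h1.
  have h2 : iid_pr (alt (g m) n (tn n)) [set x : n.-tuple X | c < sg * rescaled_error S (T P) x] <=
      iid_pr (alt (g m) n (tn n)) (B m n).
    have mC : measurable [set x : n.-tuple X | c < sg * rescaled_error S (T P) x].
      exact: measurable_mfun_gt.
    by apply: (le_iid_pr _ mC (mB m n)) => x; exact: hB.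
  have := ncdf_lip (t * D m / N) ((t * (sg * \int[P]_x (k x * g m x)) - c) / N).
  rewrite -mulrBl (_ : t * D m - _ = - (sg * (t * L2dot P kappa (g m)) - c)); last first.
    by rewrite /D; ring.
  rewrite normrM normrN (ger0_norm (_ : 0 <= N^-1)) ?invr_ge0 ?(ltW Np)//.
  have := hT'; rewrite -ler_pdivrMr// => h3 /le_trans/(_ h3).
  by rewrite ler_norml => /andP[_]; lra.
have half : ncdf (0 : R) = 2^-1 by exact: ncdf0.
apply: near_limn_einf => eta eta0.
have eta2 : 0 < eta / 2 by rewrite divr_gt0.
have /cvgrPdist_le/(_ _ eta2) := cD; apply: filterS => m hm.
apply: near_limn_einf => eta' eta'0.
have := key m (eta' + eta / 2) (addr_gt0 eta'0 eta2); apply: filterS => n h.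
rewrite iid_prE// lee_fin; apply: le_trans h.
have := ncdf_lip 0 (t * D m / N); rewrite half => /le_trans/(_ hm).
by rewrite ler_norml => /andP[_]; lra.
Qed.

(** What is available is a lower bound for events c < Y, uniform in c; reversing the sign turns sg Y
    < t into this form. It is used under [P] itself, with tangent 0, and infinite t is immediate. *)
Lemma sided_uniform (sg : R) (S : estimator_seq X R) (eta : R) :
  sg ^+ 2 = 1 -> L2closure G k -> asymp_linear P T S k -> 0 < eta ->
  \forall n \near \oo, forall t : \bar R,
  (Phi (t * ((L2norm P k)^-1)%:E) - eta%:E <= iid_power P n
     [set x : n.-tuple X | ((sg * rescaled_error S (T P) x)%:E < t)%E])%E.
Proof.
move=> sg2 kG lS eta0.
have Np := nk; have NE := nk2; set N := L2norm P k in Np NE *.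
have sg2' : (- sg) ^+ 2 = 1 by rewrite sqrrN.
have sk : sqi P (fun x => - sg * k x) by apply: sqiZ; exact: L2_sqi.
have sgk0 : \int[P]_x (- sg * k x) = 0.
  by rewrite EZ ?(closure_E0 kG) ?mulr0//; apply: sqi_integ; exact: L2_sqi.
have sgk2 : \int[P]_x (- sg * k x) ^+ 2 = N ^+ 2.
  by rewrite NE; apply: eq_Rintegral => x _; rewrite exprMn sg2' mul1r.
have sgkp : 0 < \int[P]_x (- sg * k x) ^+ 2 by rewrite sgk2 exprn_gt0.
have mY n : measurable_fun setT (fun x : n.-tuple X => - sg * rescaled_error S (T P) x).
  by apply: measurable_funM => //; exact: measurable_rescaled_error.
have lY := sided_asymp_linear sg2' lS.
have := asymp_linear_gt (local_seq_self P) (sqi_cst P 0) sk sgk0 sgkp mY lY eta0.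
apply: filterS => n H [r||].
- have := H (- r); rewrite sgk2 sqrtr_sqr (gtr0_norm Np) mul0r opprK add0r.
  rewrite -EFinM PhiE -EFinB.
  have -> : [set x : n.-tuple X | ((sg * rescaled_error S (T P) x)%:E < r%:E)%E] =
     [set x : n.-tuple X | - r < - sg * rescaled_error S (T P) x].
    by apply/seteqP; split=> x /=; rewrite lte_fin mulNr ltrN2.
  by rewrite iid_prE ?lee_fin//; exact: measurable_mfun_gt.
- rewrite gt0_mulye ?lte_fin ?invr_gt0// Phiy.
  have -> : [set x : n.-tuple X | ((sg * rescaled_error S (T P) x)%:E < +oo)%E] = setT.
    by apply/seteqP; split=> x //= _; rewrite ltry.
  by rewrite probability_setT -EFinB lee_fin; lra.
- rewrite gt0_mulNye ?lte_fin ?invr_gt0// PhiNy sub0e.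
  have -> : [set x : n.-tuple X | ((sg * rescaled_error S (T P) x)%:E < -oo)%E] = set0.
    by apply/seteqP; split=> x.
  by rewrite measure0 lee_fin; lra.
Qed.

End concentration.

(** * Tools for combining two tails *)

Section extended_Phi.
Context {R : realType}.

Lemma Phi_fin_num (t : \bar R) : Phi t \is a fin_num.
Proof. by case: t => [r||]; rewrite ?PhiE ?Phiy ?PhiNy. Qed.

Lemma PhiN (t : \bar R) : Phi (- t)%E = (1 - Phi t)%E.
Proof.
case: t => [r||] /=.
- by rewrite !PhiE ncdfN EFinB.
- by rewrite Phiy PhiNy subee.
- by rewrite Phiy PhiNy sube0.
Qed.

End extended_Phi.

(** The complements of [A] and [B] are disjoint, so their probabilities add. *)
Lemma iid_prI {d : measure_display} {X : measurableType d} {R : realType}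
    (P : probability X R) n (A B : set (n.-tuple X)) :
  measurable A -> measurable B -> A `|` B = setT ->
  iid_pr P (A `&` B) = iid_pr P A + iid_pr P B - 1.
Proof.
move=> mA mB AB; have mAB := measurableI _ _ mA mB.
have mCA := measurableC mA; have mCB := measurableC mB.
have e : iid_pr P (~` (A `&` B)) = iid_pr P (~` A) + iid_pr P (~` B).
  apply: EFin_inj; rewrite EFinD -!iid_prE//; last exact: measurableC.
  rewrite setCI measureU//; rewrite -setCU AB setCT//.
move: e; rewrite !iid_prC//; lra.
Qed.

(** * One-sided and two-sided concentration bounds, with attainment *)

Theorem theorem3p1 (d : measure_display) (X : measurableType d) (R : realType)
    (Pm : set (probability X R)) (P : probability X R) (hP : Pm P)
    (T : probability X R -> R) (kappa : L2 P)
    (hT : influence_curve Pm T kappa)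
    (path : L2 P -> R -> probability X R)
    (hpath : forall g : L2 P, tangent_set Pm P g ->
       path_with_tangent Pm P g (path g)) :
  (convex_cone (tangent_set Pm P) ->
   forall k : L2 P,
     closest_element (L2closure (tangent_set Pm P)) kappa k ->
     L2nonzero P k ->
     (forall S : estimator_seq X R,
        one_sided_assumption (tangent_set Pm P) k T path S ->
        forall (tn : nat -> R) (t : R), cvg_in_pos tn t ->
          (limn_esup (fun n => iid_power P n
             [set x | (rescaled_error S (T P) x < tn n)%R])
           <= Phi (t / L2norm P k)%:E)%E)
     /\
     (forall S : estimator_seq X R,
        asymp_linear P T S k ->
        one_sided_assumption (tangent_set Pm P) k T path S /\
        (0 <= limn_einf (fun n => ereal_inf
           [set (iid_power P n [set x | (rescaled_error S (T P) x)%:E < t]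
                 - Phi (t * ((L2norm P k)^-1)%:E))
           | t in [set: \bar R]]))%E))
  /\
  (linear_space (tangent_set Pm P) ->
   forall k : L2 P,
     orthogonal_projection (L2closure (tangent_set Pm P)) kappa k ->
     L2nonzero P k ->
     (forall S : estimator_seq X R,
        two_sided_assumption (tangent_set Pm P) k T path S ->
        forall (tn1 tn2 : nat -> R) (t1 t2 : R),
          cvg_in_pos tn1 t1 -> cvg_in_pos tn2 t2 ->
          (limn_esup (fun n => iid_power P n
             [set x | (- tn1 n < rescaled_error S (T P) x < tn2 n)%R])
           <= Phi (t2 / L2norm P k)%:E - Phi (- (t1 / L2norm P k))%:E)%E)
     /\
     (forall S : estimator_seq X R,
        asymp_linear P T S k ->
        two_sided_assumption (tangent_set Pm P) k T path S /\
        (0 <= limn_einf (fun n => ereal_inf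
           [set (iid_power P n
                   [set x | (- t.1 < (rescaled_error S (T P) x)%:E < t.2)]
                 - (Phi (t.2 * ((L2norm P k)^-1)%:E)
                    - Phi (- (t.1 * ((L2norm P k)^-1)%:E))))
           | t in [set t : \bar R * \bar R | - t.1 < t.2]]))%E)).
Proof.
have L2cvgZ (k : L2 P) (u : nat -> L2 P) (c : R) : L2cvg u k ->
    L2cvg (fun m => c *: u m) (c *: k).
  move=> /L2cvgP[su sk cu]; apply/L2cvgP; split.
  - by move=> m; exact: L2_sqi.
  - exact: L2_sqi.
  have cc : c ^+ 2 * \int[P]_x (u m x - k x) ^+ 2 @[m --> \oo] --> (0 : R).
    by rewrite -[X in _ --> X](mulr0 (c ^+ 2)); exact: cvgMl_tmp.
  apply: cvg_trans cc; apply: near_eq_cvg; apply: nearW => m.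
  rewrite -(EZ _ (sqiB (su m) sk).2); apply: eq_Rintegral => x _.
  by rewrite !L2_scaleE; ring.
have mge (S : estimator_seq X R) n (c : R) : measurable [set x : n.-tuple X | c <= S n x].
  rewrite (_ : [set _ | _] = [set x | - S n x <= - c]).
    by apply: measurable_mfun_le; exact: measurable_funN.
  by apply/seteqP; split=> x /=; rewrite lerN2.
have mle (S : estimator_seq X R) n (c : R) : measurable [set x : n.-tuple X | S n x <= c].
  exact: measurable_mfun_le.
have mgt (S : estimator_seq X R) n (c : R) :
    measurable [set x : n.-tuple X | c < rescaled_error S (T P) x].
  by apply: measurable_mfun_gt; exact: measurable_rescaled_error.
have mlt (S : estimator_seq X R) n (c : R) :
    measurable [set x : n.-tuple X | rescaled_error S (T P) x < c].
  rewrite (_ : [set _ | _] = [set x | - c < - rescaled_error S (T P) x]).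
    apply: measurable_mfun_gt; apply: measurable_funN.
    exact: measurable_rescaled_error.
  by apply/seteqP; split=> x /=; rewrite ltrN2.
have cst_pos (s : R) : 0 < s -> cvg_in_pos (fun=> s) s.
  by move=> s0; split => //; exact: cvg_cst.
have one : (1 : R) ^+ 2 = 1 by rewrite expr1n.
have mone : (- 1 : R) ^+ 2 = 1 by rewrite sqrrN expr1n.
have lower_tail (k : L2 P) (S : estimator_seq X R) (g : nat -> L2 P) tn t eta :
    L2nonzero P k -> L2dot P kappa k = \int[P]_x k x ^+ 2 ->
    (forall m, tangent_set Pm P (g m)) -> L2cvg g k ->
    asymp_no_underestimation T path S g -> cvg_in_pos tn t -> 0 < eta ->
    \forall n \near \oo, iid_pr P [set x : n.-tuple X |
      rescaled_error S (T P) x < tn n] <= ncdf (t / L2norm P k) + eta.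
  move=> k0 kdot Gg gk hg htn eta0.
  have gk1 : L2cvg g (1 *: k) by rewrite scale1r.
  have H := @sided_bound _ _ _ _ _ _ _ hT _ hpath _ k0 kdot 1 S g
    (fun s m n => [set x | T (local_alt (path (g m)) n s) <= S n x]) tn t eta
    one Gg gk1 (fun s m n => mge S n _) _ _ htn eta0.
  apply: filterS (H _ _) => [n|s m n x /= h|s s0].
  - by under eq_set do rewrite mul1r.
  - by rewrite !mul1r ler_wpM2l// lerB.
  - exact: hg (cst_pos s s0).
have upper_tail (k : L2 P) (S : estimator_seq X R) (g : nat -> L2 P) tn t eta :
    L2nonzero P k -> L2dot P kappa k = \int[P]_x k x ^+ 2 ->
    (forall m, tangent_set Pm P (g m)) -> L2cvg g (- k) ->
    asymp_no_overestimation T path S g -> cvg_in_pos tn t -> 0 < eta ->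
    \forall n \near \oo, iid_pr P [set x : n.-tuple X |
      - tn n < rescaled_error S (T P) x] <= ncdf (t / L2norm P k) + eta.
  move=> k0 kdot Gg gk hg htn eta0.
  have gk1 : L2cvg g (- 1 *: k) by rewrite scaleN1r.
  have H := @sided_bound _ _ _ _ _ _ _ hT _ hpath _ k0 kdot (- 1) S g
    (fun s m n => [set x | S n x <= T (local_alt (path (g m)) n s)]) tn t eta
    mone Gg gk1 (fun s m n => mle S n _) _ _ htn eta0.
  apply: filterS (H _ _) => [n|s m n x /= h|s s0].
  - by under eq_set do rewrite mulN1r ltrNl.
  - by rewrite !mulN1r lerN2 ler_wpM2l// lerB.
  - exact: hg (cst_pos s s0).
have no_under (k : L2 P) (S : estimator_seq X R) (g : nat -> L2 P) :
    L2nonzero P k -> L2dot P kappa k = \int[P]_x k x ^+ 2 ->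
    L2closure (tangent_set Pm P) k -> asymp_linear P T S k ->
    (forall m, tangent_set Pm P (g m)) -> L2cvg g k ->
    asymp_no_underestimation T path S g.
  move=> k0 kdot kG lS Gg gk tn t htn.
  have gk1 : L2cvg g (1 *: k) by rewrite scale1r.
  apply: (@sided_attained _ _ _ _ _ _ _ hT _ hpath _ k0 kdot 1 S g
    (fun m n => [set x | T (local_alt (path (g m)) n (tn n)) <= S n x]) tn t
    one kG lS Gg gk1 (fun m n => mge S n _) _ htn).
  move=> m n x n0; rewrite !mul1r ltr_pM2l ?sqrtn_gt0// ltrD2r; exact: ltW.
have no_over (k : L2 P) (S : estimator_seq X R) (g : nat -> L2 P) :
    L2nonzero P k -> L2dot P kappa k = \int[P]_x k x ^+ 2 ->
    L2closure (tangent_set Pm P) k -> asymp_linear P T S k ->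
    (forall m, tangent_set Pm P (g m)) -> L2cvg g (- k) ->
    asymp_no_overestimation T path S g.
  move=> k0 kdot kG lS Gg gk tn t htn.
  have gk1 : L2cvg g (- 1 *: k) by rewrite scaleN1r.
  apply: (@sided_attained _ _ _ _ _ _ _ hT _ hpath _ k0 kdot (- 1) S g
    (fun m n => [set x | S n x <= T (local_alt (path (g m)) n (tn n))]) tn t
    mone kG lS Gg gk1 (fun m n => mle S n _) _ htn).
  move=> m n x n0; rewrite !mulN1r ltrN2 ltr_pM2l ?sqrtn_gt0// ltrD2r; exact: ltW.
have unif_lower (k : L2 P) (S : estimator_seq X R) (eta : R) :
    L2nonzero P k -> L2closure (tangent_set Pm P) k -> asymp_linear P T S k ->
    0 < eta -> \forall n \near \oo, forall t : \bar R,
    (Phi (t * ((L2norm P k)^-1)%:E) - eta%:E <= iid_power P n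
       [set x : n.-tuple X | ((rescaled_error S (T P) x)%:E < t)%E])%E.
  move=> k0 kG lS eta0.
  have := @sided_uniform _ _ _ _ _ T _ hpath _ k0 1 S eta one kG lS eta0.
  by apply: filterS => n H t; have := H t; under eq_set do rewrite mul1r.
have unif_upper (k : L2 P) (S : estimator_seq X R) (eta : R) :
    L2nonzero P k -> L2closure (tangent_set Pm P) k -> asymp_linear P T S k ->
    0 < eta -> \forall n \near \oo, forall t : \bar R,
    (Phi (t * ((L2norm P k)^-1)%:E) - eta%:E <= iid_power P n
       [set x : n.-tuple X | (- t < (rescaled_error S (T P) x)%:E)%E])%E.
  move=> k0 kG lS eta0.
  have := @sided_uniform _ _ _ _ _ T _ hpath _ k0 (- 1) S eta mone kG lS eta0.
  apply: filterS => n H t; have := H t.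
  by under eq_set do rewrite mulN1r EFinN lteNl.
split.
- move=> cG k kP k0.
  have kG : L2closure (tangent_set Pm P) k by case: kP.
  have k2 : 0 < \int[P]_x k x ^+ 2.
    rewrite -(L2norm_sqr (L2_sqi k)) exprn_gt0//.
    exact: L2nonzero_norm (L2_sqi k) k0.
  have kdot := closest_element_cone_dot cG kP k2.
  split=> [S [g [Gg gk hg]] tn t htn|S lS].
    rewrite PhiE; apply: near_limn_esup => eta eta0.
    have := lower_tail k S g tn t eta k0 kdot Gg gk hg htn eta0.
    by apply: filterS => n h; rewrite iid_prE.
  split.
    (* Any sequence of tangents converging to [k] is a witness. *)
    have [u [Gu uk]] := kG; exists u; split => //.
    exact: (no_under k).
  apply: near_limn_einf => eta eta0.
  have := unif_lower k S eta k0 kG lS eta0; apply: filterS => n H.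
  apply: le_ereal_inf_tmp => _ [t _ <-].
  by rewrite leeBrDr ?Phi_fin_num// sub0r EFinN addeC.
move=> [G0 lG] k kP k0.
have kG : L2closure (tangent_set Pm P) k by case: kP.
have kdot := orthogonal_projection_dot kP.
split=> [S [g1 [g2 [[Gg1 Gg2 gk1 gk2] [hg1 hg2]]]] tn1 tn2 t1 t2 htn1 htn2|S lS].
  rewrite !PhiE -EFinB; apply: near_limn_esup => eta eta0.
  have eta2 : 0 < eta / 2 by rewrite divr_gt0.
  have H1 := lower_tail k S g1 tn2 t2 (eta / 2) k0 kdot Gg1 gk1 hg1 htn2 eta2.
  have := upper_tail k S g2 tn1 t1 (eta / 2) k0 kdot Gg2 gk2 hg2 htn1 eta2.
  apply: filterS2 H1 => n H1 H2.
  have -> : [set x : n.-tuple X | - tn1 n < rescaled_error S (T P) x < tn2 n] =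
      [set x | rescaled_error S (T P) x < tn2 n] `&`
      [set x | - tn1 n < rescaled_error S (T P) x].
    by apply/seteqP; split=> x /= => [/andP[? ?]|[? ?]]; [split|apply/andP].
  rewrite iid_prE ?lee_fin; last exact: measurableI.
  rewrite iid_prI//; first by rewrite ncdfN; lra.
  apply/seteqP; split=> x //= _.
  (* The two events cover the sample space: an error of at least tn2 n > 0 exceeds - tn1 n < 0. *)
  have [h|h] := ltP (rescaled_error S (T P) x) (tn2 n); [by left|right].
  have [/(_ n) p1 _ _] := htn1; have [/(_ n) p2 _ _] := htn2.
  by apply: lt_le_trans h; lra.
have [u [Gu uk]] := kG.
split.
  (* Linearity makes the negatives of [u] tangents too, which supplies the sequence tending to -
     k. *)
  have Gu' m : tangent_set Pm P (- 1 *: u m).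
    by have := lG (u m) (u m) (- 1) 0 (Gu m) (Gu m); rewrite scale0r addr0.
  have uk' : L2cvg (fun m => - 1 *: u m) (- k).
    by have := L2cvgZ k u (- 1) uk; rewrite scaleN1r.
  exists u, (fun m => - 1 *: u m); split => //; split.
    exact: (no_under k).
  exact: (no_over k).
apply: near_limn_einf => eta eta0.
have eta2 : 0 < eta / 2 by rewrite divr_gt0.
have H1 := unif_lower k S (eta / 2) k0 kG lS eta2.
have := unif_upper k S (eta / 2) k0 kG lS eta2.
apply: filterS2 H1 => n H1 H2.
apply: le_ereal_inf_tmp => _ [[t1 t2] /= t12 <-].
have {}H1 := H1 t2; have {}H2 := H2 t1.
have m1 : measurable [set x : n.-tuple X | ((rescaled_error S (T P) x)%:E < t2)%E].
  case: t2 {t12 H1} => [r||].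
  - under eq_set do rewrite lte_fin; exact: mlt.
  - by rewrite (_ : [set _ | _] = setT)//; apply/seteqP; split=> x //= _; rewrite ltry.
  - by rewrite (_ : [set _ | _] = set0)//; apply/seteqP; split=> x.
have m2 : measurable [set x : n.-tuple X | (- t1 < (rescaled_error S (T P) x)%:E)%E].
  case: t1 {t12 H2} => [r||] /=.
  - under eq_set do rewrite lte_fin; exact: mgt.
  - by rewrite (_ : [set _ | _] = setT)//; apply/seteqP; split=> x //= _; rewrite ltNyr.
  - by rewrite (_ : [set _ | _] = set0)//; apply/seteqP; split=> x.
have -> : [set x : n.-tuple X | (- t1 < (rescaled_error S (T P) x)%:E < t2)%E] =
    [set x | ((rescaled_error S (T P) x)%:E < t2)%E] `&`
    [set x | (- t1 < (rescaled_error S (T P) x)%:E)%E].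
  by apply/seteqP; split=> x /= => [/andP[? ?]|[? ?]]; [split|apply/andP].
(* Now the normal side is Phi(t2 / N) + Phi(t1 / N) - 1, matching term by term the decomposition of
   the probability by [iid_prI]; t12 ensures that the events cover. *)
rewrite PhiN iid_prE; last exact: measurableI.
rewrite iid_prI//; last first.
  apply/seteqP; split=> x //= _.
  have [h|h] := ltP (rescaled_error S (T P) x)%:E t2; [by left|right].
  exact: lt_le_trans t12 h.
move: H1 H2; rewrite !iid_prE//.
rewrite -(fineK (Phi_fin_num (t2 * _))) -(fineK (Phi_fin_num (t1 * _))).
rewrite -!EFinB !lee_fin; lra.
Qed.
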